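(* Let $\alpha>-1$ and let $\phi(w)=aw+b$ be an affine symbol, where $a>0$ and $\operatorname{Re}(b)\ge 0$. Then the composition operator $C_\phi$ is supercyclic on $\mathcal{A}^2_\alpha(\mathbb{C}_+)$ if and only if $a>1$ and $\operatorname{Re}(b)>0$ (that is, $\phi$ is hyperbolic of type II and not an automorphism).
   Context: $\mathbb{C}_+=\{z\in\mathbb{C}:\operatorname{Re}(z)>0\}$ is the open right half-plane. For $\alpha>-1$, the weighted Bergman space $\mathcal{A}^2_\alpha(\mathbb{C}_+)$ is the Hilbert space of all holomorphic functions $f$ on $\mathbb{C}_+$ with finite norm $\|f\|=\left(\int_{\mathbb{C}_+}|f(x+iy)|^2x^\alpha\,dx\,dy\right)^{1/2}$. An affine symbol is a map $\phi:\mathbb{C}_+\to\mathbb{C}_+$, $\phi(w)=aw+b$ with $a>0$ and $\operatorname{Re}(b)\ge 0$; the composition operator $C_\phi f=f\circ\phi$ is then a bounded operator on $\mathcal{A}^2_\alpha(\mathbb{C}_+)$. A bounded linear operator $T$ on a separable Banach space $\mathcal{X}$ is supercyclic if there is a non-zero $f\in\mathcal{X}$ such that $\{\lambda T^nf: n\in\mathbb{N},\ \lambda\in\mathbb{C}\}$ is dense in $\mathcal{X}$, where $\mathbb{N}$ is the set of non-negative integers. *)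

(* Defs.v *)
From HB Require Import structures.
From mathcomp Require Import all_boot all_order all_algebra.
From mathcomp Require Import all_classical all_reals all_analysis.
From mathcomp Require Import measurable_realfun complex.
From mathcomp Require Import ring lra.

Set Implicit Arguments.
Unset Strict Implicit.
Unset Printing Implicit Defensive.

Import Order.TTheory GRing.Theory Num.Theory.
Import numFieldNormedType.Exports.
Import ComplexField.Normc.

Local Open Scope classical_set_scope.
Local Open Scope ring_scope.
Local Open Scope complex_scope.

Section supercyclic.
Context (K : numFieldType) (X : normedModType K).

(* For a bounded operator T on a separable Banach space X over K this is
   supercyclicity; none of these standing assumptions enters the formula. *)
Definition supercyclic (T : X -> X) : Prop :=
  exists2 f : X, f != 0 &
    dense [set g | exists (n : nat) (lambda : K), g = lambda *: iter n T f].

End supercyclic.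

Section bergman.
Context (R : realType).

Definition halfplane : set R[i] := [set z | 0 < complex.Re z].

(* With R[i]^o as a normed module over the field R[i], derivability in the
   direction 1 is complex differentiability. *)
Definition holomorphic_on (U : set R[i]) (f : R[i] -> R[i]) : Prop :=
  forall z, U z -> derivable (f : R[i]^o -> R[i]^o) z 1.

Definition bergman_sqnorm (alpha : R) (f : R[i] -> R[i]) : \bar R :=
  (\int[lebesgue_measure \x lebesgue_measure]_(p in [set p : R * R | (0 < p.1)%R])
    ((normc (f (p.1 +i* p.2))) ^+ 2 * p.1 `^ alpha)%:E)%E.

(* A function on the half-plane is represented by its extension by 0 to the
   whole of R[i], so that equality of representatives is equality of functions
   on the half-plane. *)
Definition in_bergman (alpha : R) : {pred R[i] -> R[i]} :=
  mem [set f : R[i] -> R[i] |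
  [/\ (forall z, ~ halfplane z -> f z = 0), holomorphic_on halfplane f &
      (bergman_sqnorm alpha f < +oo)%E]].

Record bergman (alpha : R) : Type :=
  Bergman { bergman_fun :> R[i] -> R[i]; _ : bergman_fun \in in_bergman alpha }.

End bergman.


Section bergman_theory.
Context (R : realType).
Implicit Types (alpha : R) (f g : R[i] -> R[i]).

Let addfE f g z : (f + g) z = f z + g z. Proof. by []. Qed.

Let scalefE (l : R[i]) f z : (l *: f) z = l * f z. Proof. by []. Qed.

Lemma holomorphic_near f (z : R[i]) (e : R) :
  holomorphic_on (@halfplane R) f -> halfplane z -> 0 < e ->
  exists2 d : R, 0 < d & forall w, normc (w - z) < d -> normc (f w - f z) < e.
Proof.
move=> hf /hf /derivable1_diffP /differentiable_continuous.
move=> /(@cvgrPdist_lt _ R[i]^o) cf e0.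
have e0' : 0 < e%:C by rewrite ltcR.
have /nbhs_ballP[d /= d0 hd] := cf _ e0'.
have dE : d = (complex.Re d)%:C by case: d d0 {hd} => a b /= /andP[/eqP -> _].
have d0' : 0 < complex.Re d by rewrite -ltcR -dE.
exists (complex.Re d) => // w wz.
have /hd : @ball _ R[i]^o z d w.
  rewrite -ball_normE /ball_ /= distrC dE.
  by change ((normc (w - z))%:C < (complex.Re d)%:C); rewrite ltcR.
by rewrite distrC => h; rewrite -ltcR.
Qed.

Lemma normc_box (x y d : R) (p : R * R) :
  `|p.1 - x| < d / 2 -> `|p.2 - y| < d / 2 ->
  normc ((p.1 +i* p.2) - (x +i* y)) < d.
Proof.
move=> h1 h2.
have d0 : 0 < d / 2 by exact: le_lt_trans h1.
rewrite /= -[ltRHS]gtr0_norm; last by lra.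
rewrite -sqrtr_sqr ltr_sqrt; last by rewrite exprn_gt0//; lra.
rewrite -real_normK ?num_real// -[X in _ + X]real_normK ?num_real//.
have n1 := normr_ge0 (p.1 - x); have n2 := normr_ge0 (p.2 - y).
nra.
Qed.

Lemma holomorphic_box f (x y e : R) :
  holomorphic_on (@halfplane R) f -> 0 < x -> 0 < e ->
  exists2 d : R, 0 < d & forall q : R * R, `|q.1 - x| < d -> `|q.2 - y| < d ->
    0 < q.1 /\ normc (f (q.1 +i* q.2) - f (x +i* y)) < e.
Proof.
move=> hf x0 e0.
have [|d d0 hd] := @holomorphic_near f (x +i* y) e hf _ e0; first exact: x0.
exists (Num.min (d / 2) x); first by rewrite lt_min x0 divr_gt0.
move=> q; rewrite !lt_min => /andP[h1 h1'] /andP[h2 _]; split.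
  by move: h1'; rewrite ltr_norml => /andP[]; lra.
by apply: hd; apply: normc_box.
Qed.

Lemma open_box_measurable (U : set (R * R)) :
  (forall p, U p -> exists2 d : R, 0 < d &
     forall q : R * R, `|q.1 - p.1| < d -> `|q.2 - p.2| < d -> U q) ->
  measurable U.
Proof.
move=> oU.
pose I n (k : int) : set R := `[k%:~R / n.+1%:R, (k%:~R + 1) / n.+1%:R[%classic.
pose B (t : int * int * nat) : set (R * R) := I t.2 t.1.1 `*` I t.2 t.1.2.
pose F t : set (R * R) := if pselect (B t `<=` U) then B t else set0.
have IP n (x : R) : I n (Num.floor (x * n.+1%:R)) x.
  rewrite /I /= in_itv/= ler_pdivrMr// ltr_pdivlMr//.
  by have := floor_itv (x * n.+1%:R); rewrite intrD.
have Id n k (x y : R) : I n k x -> I n k y -> `|x - y| < n.+1%:R^-1.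
  rewrite /I /= !in_itv/= mulrDl mul1r.
  move: n.+1%:R^-1 (k%:~R / _) => v u /andP[a b] /andP[c d].
  by rewrite ltr_norml; apply/andP; split; lra.
suff -> : U = \bigcup_t F t.
  apply: countable_bigcupT_measurable => [|t]; first exact: countableP.
  rewrite /F; case: pselect => [BU|BU]; last exact: measurable0.
  by apply: measurableX; exact: measurable_itv.
apply/seteqP; split=> [p Up|p [t _]]; last first.
  by rewrite /F; case: pselect => [BU /BU|].
have [d d0 hd] := oU _ Up.
have [n _ hn] := near_infty_natSinv_lt (PosNum d0).
have {}hn : n.+1%:R^-1 < d by exact: hn (leqnn n).
exists (Num.floor (p.1 * n.+1%:R), Num.floor (p.2 * n.+1%:R), n) => //.
rewrite /F; case: pselect => [BU|nBU]; first by split; exact: IP.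
apply: False_ind; apply: nBU => q [/= h1 h2]; apply: hd; apply: lt_trans hn.
- exact: Id h1 (IP _ _).
- exact: Id h2 (IP _ _).
Qed.

Definition bergman_weighted alpha f (p : R * R) : R :=
  normc (f (p.1 +i* p.2)) * p.1 `^ (alpha / 2).

Lemma measurable_bergman_weighted alpha f :
  (forall z, ~ halfplane z -> f z = 0) -> holomorphic_on (@halfplane R) f ->
  measurable_fun setT (bergman_weighted alpha f).
Proof.
move=> f0 hf.
apply: measurable_funM; last first.
  exact: (@measurableT_comp _ _ _ _ _ _ (@powR R ^~ (alpha / 2))).
apply: (measurability _ (RGenOInfty.measurableE R)) => //.
move=> _ [_ [y ->] <-]; rewrite setTI.
have normc_ge0 (z : R[i]) : 0 <= normc z by case: z => a b; exact: sqrtr_ge0.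
have [y0|y0] := ltP y 0.
  rewrite [X in measurable X](_ : _ = setT); first exact: measurableT.
  by apply/seteqP; split=> // p _ /=; rewrite in_itv/= andbT (lt_le_trans y0).
apply: open_box_measurable => p; rewrite /= in_itv/= andbT => yp.
have p0 : 0 < p.1.
  apply/negPn/negP => np; move: yp; rewrite f0; last exact/negP.
  by rewrite normc0 ltNge y0.
have e0 : 0 < normc (f (p.1 +i* p.2)) - y by lra.
have [d d0 hd] := @holomorphic_box f p.1 p.2 _ hf p0 e0.
exists d => // q q1 q2; rewrite in_itv/= andbT.
have [_ h] := hd q q1 q2.
have := @le_normcD R (f (p.1 +i* p.2) - f (q.1 +i* q.2)) (f (q.1 +i* q.2)).
have -> : normc (f (p.1 +i* p.2) - f (q.1 +i* q.2)) =
          normc (f (q.1 +i* q.2) - f (p.1 +i* p.2)).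
  by rewrite -[LHS]normcN opprB.
rewrite subrK; lra.
Qed.

Lemma bergman_weighted_ge0 alpha f p : 0 <= bergman_weighted alpha f p.
Proof.
by rewrite mulr_ge0 ?powR_ge0//; case: (f _) => a b; exact: sqrtr_ge0.
Qed.

Lemma bergman_sqnormE alpha f : (forall z, ~ halfplane z -> f z = 0) ->
  bergman_sqnorm alpha f =
  (\int[lebesgue_measure \x lebesgue_measure]_p
    ((bergman_weighted alpha f p) ^+ 2)%:E)%E.
Proof.
move=> f0; rewrite /bergman_sqnorm integral_mkcond.
apply: eq_integral => p _; rewrite patchE.
case: ifPn => [|/negP]; rewrite inE /= => p0.
  rewrite /bergman_weighted exprMn; congr (_ * _)%:E.
  by rewrite -powR_mulrn ?powR_ge0// -powRrM divfK.
by rewrite /bergman_weighted f0// normc0 mul0r expr0n.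
Qed.

Lemma bergman_LnormE alpha f : (forall z, ~ halfplane z -> f z = 0) ->
  'N[lebesgue_measure \x lebesgue_measure]_2[EFin \o bergman_weighted alpha f]%E
  = (bergman_sqnorm alpha f `^ 2^-1)%E.
Proof.
move=> f0; rewrite bergman_sqnormE// unlock; congr (_ `^ _)%E.
apply: eq_integral => p _ /=.
by rewrite ger0_norm ?bergman_weighted_ge0// powR_mulrn ?bergman_weighted_ge0.
Qed.

Lemma bergman_sqnorm_ge0 alpha f : (0 <= bergman_sqnorm alpha f)%E.
Proof.
apply: integral_ge0 => p _; rewrite lee_fin mulr_ge0 ?powR_ge0//.
exact: sqr_ge0.
Qed.

Lemma bergman_sqnormZ alpha (l : R[i]) f : 
  (forall z, ~ halfplane z -> f z = 0) -> holomorphic_on (@halfplane R) f ->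
  bergman_sqnorm alpha (l *: f) = ((normc l ^+ 2)%:E * bergman_sqnorm alpha f)%E.
Proof.
move=> f0 hf.
rewrite !bergman_sqnormE//; last first.
  by move=> z /f0 fz; rewrite scalefE fz mulr0.
rewrite -ge0_integralZl_EFin ?sqr_ge0//; last 2 first.
- by move=> p _; rewrite lee_fin sqr_ge0.
- apply/measurable_EFinP; apply: measurable_funX.
  exact: measurable_bergman_weighted.
apply: eq_integral => p _; rewrite /bergman_weighted -EFinM -exprMn mulrA.
by rewrite -normcM.
Qed.

Lemma bergman_LnormD alpha f g :
  (forall z, ~ halfplane z -> f z = 0) -> holomorphic_on (@halfplane R) f ->
  (forall z, ~ halfplane z -> g z = 0) -> holomorphic_on (@halfplane R) g ->
  (bergman_sqnorm alpha (f + g)%R `^ 2^-1 <=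
   bergman_sqnorm alpha f `^ 2^-1 + bergman_sqnorm alpha g `^ 2^-1)%E.
Proof.
move=> f0 hf g0 hg.
have fg0 z : ~ halfplane z -> (f + g) z = 0.
  move=> zD; by rewrite addfE f0// g0// addr0.
have hfg : holomorphic_on (@halfplane R) (f + g).
  by move=> z zD; apply: derivableD; [exact: hf|exact: hg].
have mf := measurable_bergman_weighted alpha f0 hf.
have mg := measurable_bergman_weighted alpha g0 hg.
have mfg := measurable_bergman_weighted alpha fg0 hfg.
rewrite -!bergman_LnormE//.
have l12 : (1 <= 2%:E :> \bar R)%E by rewrite lee_fin ler1n.
have M := eminkowski (lebesgue_measure \x lebesgue_measure)%E mf mg l12.
apply: (le_trans _ M).
rewrite unlock; apply: gt0_ler_poweR; rewrite ?invr_ge0//.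
- by rewrite in_itv/= leey andbT integral_ge0// => p _; exact: poweR_ge0.
- by rewrite in_itv/= leey andbT integral_ge0// => p _; exact: poweR_ge0.
have w0 h := bergman_weighted_ge0 alpha h.
apply: ge0_le_integral => //=.
- apply/measurable_EFinP.
  apply: (@measurableT_comp _ _ _ _ _ _ (@powR R ^~ 2)) => //.
  exact: measurableT_comp.
- apply/measurable_EFinP.
  apply: (@measurableT_comp _ _ _ _ _ _ (@powR R ^~ 2)) => //.
  by apply: measurableT_comp => //; exact: measurable_funD.
move=> p _; rewrite lee_fin ge0_ler_powR ?nnegrE//.
rewrite !ger0_norm ?addr_ge0// /bergman_weighted -mulrDl.
by rewrite ler_wpM2r ?powR_ge0//; exact: le_normcD.
Qed.

Lemma bergman_submod_closed alpha : submod_closed (@in_bergman R alpha).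
Proof.
split.
  rewrite inE; split=> //.
  rewrite /bergman_sqnorm integral0_eq// => p _.
  by rewrite normc0 expr0n mul0r.
move=> l f g; rewrite !inE => -[f0 hf ff] [g0 hg gf].
have lf0 z : ~ halfplane z -> (l *: f) z = 0.
  by move=> zD; rewrite scalefE f0// mulr0.
have hlf : holomorphic_on (@halfplane R) (l *: f).
  by move=> z zD; apply: derivableZ; exact: hf.
split.
- by move=> z zD; rewrite addfE lf0// g0// addr0.
- by move=> z zD; apply: derivableD; [exact: hlf|exact: hg].
have := bergman_LnormD alpha lf0 hlf g0 hg.
rewrite bergman_sqnormZ// => h.
apply: (@lty_poweRy _ _ 2^-1); first by rewrite invr_neq0.
apply: (le_lt_trans h); rewrite lte_add_pinfty//; apply: poweR_lty => //.
by rewrite lte_mul_pinfty// lee_fin sqr_ge0.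
Qed.

End bergman_theory.

Section bergman_normed_module.
Context (R : realType) (alpha : R).

HB.instance Definition _ := [isSub for @bergman_fun R alpha].
HB.instance Definition _ := [Choice of bergman alpha by <:].
HB.instance Definition _ := GRing.isSubmodClosed.Build _ _ (@in_bergman R alpha)
  (@bergman_submod_closed R alpha).
HB.instance Definition _ := [SubChoice_isSubLmodule of bergman alpha by <:].

(* The norm of a normed module over R[i] takes its values in R[i]. *)
Definition bergman_norm (f : bergman alpha) : R[i] :=
  (Num.sqrt (fine (bergman_sqnorm alpha f)))%:C.

Lemma bergmanP (f : bergman alpha) :
  [/\ forall z, ~ halfplane z -> f z = 0, holomorphic_on (@halfplane R) f &
      bergman_sqnorm alpha f \is a fin_num].
Proof.
case: f => f /= /[!inE] -[f0 hf ff]; split=> //.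
by rewrite ge0_fin_numE// bergman_sqnorm_ge0.
Qed.

Lemma bergman_normD f g :
  bergman_norm (f + g) <= bergman_norm f + bergman_norm g.
Proof.
have [f0 hf ff] := bergmanP f; have [g0 hg gf] := bergmanP g.
have [_ _ fgf] := bergmanP (f + g).
rewrite -rmorphD lecR -lee_fin EFinD.
have E (h : bergman alpha) : bergman_sqnorm alpha h \is a fin_num ->
    (Num.sqrt (fine (bergman_sqnorm alpha h)))%:E =
    (bergman_sqnorm alpha h `^ 2^-1)%E.
  move=> hf'; rewrite -[in RHS](fineK hf') poweR_EFin powR12_sqrt//.
  by rewrite fine_ge0// bergman_sqnorm_ge0.
rewrite (E f ff) (E g gf) (E (f + g) fgf).
by have := bergman_LnormD alpha f0 hf g0 hg.
Qed.

Lemma bergman_normZ (l : R[i]) f : bergman_norm (l *: f) = `|l| * bergman_norm f.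
Proof.
have [f0 hf ff] := bergmanP f.
rewrite /bergman_norm bergman_sqnormZ// fineM//= sqrtrM ?sqr_ge0// rmorphM/=.
congr (_ * _); rewrite [RHS]/((normc l)%:C); congr (_ +i* _).
by rewrite sqrtr_sqr ger0_norm//; case: l => a b; exact: sqrtr_ge0.
Qed.

Lemma bergman_norm0_eq0 f : bergman_norm f = 0 -> f = 0.
Proof.
have [f0 hf ff] := bergmanP f.
move=> [] /eqP; rewrite sqrtr_eq0 => s0.
have {s0}s0 : bergman_sqnorm alpha f = 0%E.
  rewrite -(fineK ff); congr EFin; apply/eqP; rewrite eq_le s0.
  by rewrite fine_ge0// bergman_sqnorm_ge0.
have mf := measurable_bergman_weighted alpha f0 hf.
have /Lnorm_eq0_eq0 : 'N[lebesgue_measure \x lebesgue_measure]_2[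
    EFin \o bergman_weighted alpha f]%E = 0%E.
  by rewrite bergman_LnormE// s0 poweR0r// invr_neq0.
move=> /(_ _ _) [||N [mN N0 sN]]; [exact/measurable_EFinP|by []|].
apply/val_inj/funext => -[x y]; apply/eqP/negPn/negP => fz.
have x0 : 0 < x.
  by apply/negPn/negP => nx; move/eqP: fz; apply; apply: f0; exact/negP.
have normc_gt0 (z : R[i]) : z != 0 -> 0 < normc z by rewrite -normr_gt0 -ltcR.
have [d d0 hd] := holomorphic_box y hf x0 (normc_gt0 _ fz).
pose J (t : R) : set R := `]t - d, t + d[%classic.
have mI t : lebesgue_measure (J t) = (d + d)%:E.
  rewrite lebesgue_measure_itv/= lte_fin ifT; last by lra.
  by rewrite -EFinB; congr EFin; lra.
have sub : J x `*` J y `<=` N.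
  move=> q [/= q1 q2]; apply: sN => /(_ I) /= [] /eqP.
  have [||q0 hq] := hd q; [move: q1|move: q2|].
  1, 2: by rewrite /J/= in_itv/= ltr_distlC => /andP[? ?]; apply/andP; split; lra.
  rewrite mulf_eq0 [X in _ || X]gt_eqF ?powR_gt0//= orbF => /eqP/eq0_normc q00.
  by move: hq; rewrite q00 sub0r normcN ltxx.
have mB : measurable (J x `*` J y) by apply: measurableX; exact: measurable_itv.
have : ((lebesgue_measure \x lebesgue_measure) (J x `*` J y) <=
        (lebesgue_measure \x lebesgue_measure) N)%E.
  by apply: le_measure; rewrite ?inE.
rewrite N0 product_measure1E; [|exact: measurable_itv..].
rewrite /= !mI -EFinM lee_fin leNgt => /negP; apply.
by rewrite mulr_gt0// addr_gt0.
Qed.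

HB.instance Definition _ := Lmodule_isNormed.Build R[i] (bergman alpha)
  bergman_normD bergman_normZ bergman_norm0_eq0.

End bergman_normed_module.

Definition affine_symbol (R : realType) (a : R) (b w : R[i]) : R[i] :=
  a%:C * w + b.

(* The function f \o phi on the half-plane, again extended by 0. The default
   value 0 of insubd is returned only if f \o phi fails to be in the Bergman
   space, which never happens when C_phi is bounded, as it is for every
   affine symbol with 0 < a and 0 <= Re b. *)
Definition composition_op (R : realType) (alpha : R) (phi : R[i] -> R[i])
    (f : bergman alpha) : bergman alpha :=
  insubd (0 : bergman alpha)
    (fun z => if 0 < complex.Re z then f (phi z) else 0).

(* Main.v *)
(** Let [T_t f (w) = f (w + t)]. Cauchy's theorem for
    [z |-> f (x + t + z) * conj (f (x + t - conj z))] on a strip yields the Gram identity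
    [|f|^2 + |T_2t f|^2 = |f - T_2t f|^2 + 2 |T_t f|^2], that is, [<T_2t f, f> = |T_t f|^2].
    It implies that [T] is a contraction semigroup, strongly continuous at 0, with
    [T_t f --> 0] at infinity, [t |-> |T_t f|^2] log-convex and all ranges dense.

    If [a > 1] and [Re b > 0], put [p = b / (a - 1)]. Then [C^n S_n = T_p] where
    [S_n h (w) = h (a^-n (w + p))], the range of [T_p] is dense and
    [|C^n x| |S_n h| <= |h| |T_(Re p (a^n - 1)) x|] tends to 0; a nested sequence of balls
    then produces a supercyclic vector.

    Conversely, if [Re b = 0] then [C] is a multiple of an isometry, so [|C g - c g| / |g|]
    is constant on a dense projective orbit, hence everywhere, and polarisation makes [C] a
    scalar. If [a = 1] and [Re b > 0], then [|C g| / |g|] is bounded below along an orbit by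
    log-convexity, hence everywhere, which is refuted by dilating [g]. If [a < 1], the fixed
    point [p] of the symbol satisfies [C^n f (p) = f p] while [C^n f (p + 1)] is bounded, so
    that every [g] vanishing at [p] would vanish at [p + 1]. *)

From HB Require Import structures.
Require Import Defs.
From mathcomp Require Import all_boot all_order all_algebra.
From mathcomp Require Import all_classical all_reals all_analysis.
From mathcomp Require Import measurable_realfun complex.
From mathcomp Require Import ring lra.

Set Implicit Arguments.
Unset Strict Implicit.
Unset Printing Implicit Defensive.

Import Order.TTheory GRing.Theory Num.Theory.
Import numFieldNormedType.Exports.
Import ComplexField.Normc.

Local Open Scope classical_set_scope.
Local Open Scope ring_scope.
Local Open Scope complex_scope.

(** * Complex differentiability *)

Section normc_theory.
Context (R : realType).
Implicit Types (z w : R[i]).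

(** The classical model is the Paley-Wiener theorem: a Laplace transform turns [T_t] into
    multiplication by [exp(-ts)] on a weighted L2 space of the half-line, where contractivity,
    decay, log-convexity and dense range can be read off. The Gram identity replaces that model. It
    expresses the self-adjointness of [T_t] through its quadratic form and rests on nothing beyond
    Cauchy's theorem for rectangles. It holds on each vertical line separately, so the weight
    [x^alpha] enters only when the lines are integrated. The obstacle is integrability. Membership
    in the space controls [f] a priori only on average over lines, so the sides of rectangles are
    chosen by averaging, and identities on lines are equalities of sums in the extended reals.
    Contractivity of [T_t] is therefore not immediate: convexity of the line integrals bounds
    [T_t f] up to a far translate, and [alpha > -1] lets the weight absorb this remainder. The
    winding integral [2 pi i] is never evaluated; a lower bound for its modulus and its
    differentiability take the place of its value. *)

Lemma normc_ge0 z : 0 <= normc z.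
Proof. by case: z => a b; exact: sqrtr_ge0. Qed.

Lemma normcD z w : normc (z + w) <= normc z + normc w.
Proof. exact: le_normcD. Qed.

Lemma normcNr z : normc (- z) = normc z.
Proof. exact: normcN. Qed.

Lemma normcB z w : normc (z - w) <= normc z + normc w.
Proof. by rewrite (le_trans (normcD _ _))// normcNr. Qed.

Lemma normcC z w : normc (z - w) = normc (w - z).
Proof. by rewrite -normcNr opprB. Qed.

Lemma normc_gt0 z : (0 < normc z) = (z != 0).
Proof.
by rewrite lt_neqAle normc_ge0 andbT eq_sym; congr negb; apply/eqP/eqP => [/eq0_normc //|->];
  rewrite normc0.
Qed.

Lemma sqr_normc_ReIm z : normc z ^+ 2 = complex.Re z ^+ 2 + complex.Im z ^+ 2.
Proof. by case: z => a b; rewrite /= sqr_sqrtr// addr_ge0// sqr_ge0. Qed.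

Lemma normc_real (x : R) : normc x%:C = `|x|.
Proof. by rewrite /= expr0n addr0 sqrtr_sqr. Qed.

Lemma normc_i : normc 'i = 1 :> R.
Proof. by rewrite /= expr0n expr1n add0r sqrtr1. Qed.

Lemma normcX z n : normc (z ^+ n) = normc z ^+ n.
Proof. by elim: n => [|n IH]; rewrite ?normc1// !exprS normcM IH. Qed.

Lemma normc_conj z : normc (conjc z) = normc z.
Proof. by case: z => a b /=; rewrite sqrrN. Qed.

Lemma normc_Re z : `|complex.Re z| <= normc z.
Proof.
rewrite -(@ler_pXn2r _ 2)// ?nnegrE ?normc_ge0// sqr_normc_ReIm real_normK ?num_real//.
by rewrite lerDl sqr_ge0.
Qed.

Lemma normc_Im z : `|complex.Im z| <= normc z.
Proof.
rewrite -(@ler_pXn2r _ 2)// ?nnegrE ?normc_ge0// sqr_normc_ReIm real_normK ?num_real//.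
by rewrite lerDr sqr_ge0.
Qed.

Lemma normc_le_ReIm z : normc z <= `|complex.Re z| + `|complex.Im z|.
Proof.
rewrite -(@ler_pXn2r _ 2)// ?nnegrE ?normc_ge0 ?addr_ge0// sqr_normc_ReIm.
rewrite -[X in X + _]real_normK ?num_real// -[X in _ + X <= _]real_normK ?num_real//.
by rewrite sqrrD lerD2r lerDl mulrn_wge0// mulr_ge0.
Qed.

Lemma conjcD z w : conjc (z + w) = conjc z + conjc w.
Proof. by case: z => a b; case: w => c d /=; congr (_ +i* _); ring. Qed.
Lemma conjcN z : conjc (- z) = - conjc z.
Proof. by case: z. Qed.
Lemma conjcB z w : conjc (z - w) = conjc z - conjc w.
Proof. by rewrite conjcD conjcN. Qed.
Lemma cReD z w : complex.Re (z + w) = complex.Re z + complex.Re w.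
Proof. by case: z; case: w. Qed.
Lemma cImD z w : complex.Im (z + w) = complex.Im z + complex.Im w.
Proof. by case: z; case: w. Qed.
Lemma cReN z : complex.Re (- z) = - complex.Re z.
Proof. by case: z. Qed.
Lemma cImN z : complex.Im (- z) = - complex.Im z.
Proof. by case: z. Qed.
Lemma cReM z w :
  complex.Re (z * w) = complex.Re z * complex.Re w - complex.Im z * complex.Im w.
Proof. by case: z; case: w. Qed.
Lemma cImM z w :
  complex.Im (z * w) = complex.Re z * complex.Im w + complex.Im z * complex.Re w.
Proof. by case: z => a b; case: w => c d /=; rewrite [b * c]mulrC. Qed.

End normc_theory.

Section epsilon_delta.
Context (R : realType).
Implicit Types (f g : R[i] -> R[i]) (z w : R[i]).

Definition ccont_at f z := forall e : R, 0 < e ->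
  exists2 d : R, 0 < d & forall w, normc (w - z) < d -> normc (f w - f z) < e.

(** Differentiability in first-order Taylor form. Without a quotient the point [w = z] needs no
    exception, and the estimate can be integrated as it stands in Goursat's argument. *)
Definition cdiff_at f z := exists L : R[i], forall e : R, 0 < e ->
  exists2 d : R, 0 < d &
    forall w, normc (w - z) < d -> normc (f w - f z - L * (w - z)) <= e * normc (w - z).

Lemma complex_pos (e : R[i]) : 0 < e -> e = (complex.Re e)%:C /\ 0 < complex.Re e.
Proof.
by case: e => a b; rewrite ltcE /= => /andP[/eqP -> h].
Qed.

Lemma derivable_cdiff f z : derivable (f : R[i]^o -> R[i]^o) z 1 -> cdiff_at f z.
Proof.
move=> /cvg_ex[/= L]; rewrite /= => /(@cvgrPdist_le _ R[i]^o) cL.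
exists L => e e0.
have e0' : 0 < e%:C by rewrite ltcR.
have := cL _ e0'; rewrite /dnbhs/= near_withinE => /nbhs_ballP[d /= d0 hd].
have [dE d1] := complex_pos d0.
exists (complex.Re d) => // w wz.
have [->|wz0] := eqVneq w z; first by rewrite !subrr mulr0 subr0 normc0 mulr0.
have /= h := hd (w - z) _ _.
have := h _ _; rewrite subr_eq0 wz0 => {}h.
have : `|L - (w - z)^-1 *: (f ((w - z) *: 1 + z) - f z)| <= e%:C.
  apply: h => //.
  rewrite sub0r normrN dE.
  by change ((normc (w - z))%:C < (complex.Re d)%:C); rewrite ltcR.
have -> : (w - z) *: (1 : R[i]^o) + z = w.
  by change ((w - z) * 1 + z = w); rewrite mulr1 subrK.
change ((normc (L - (w - z)^-1 * (f w - f z)))%:C <= e%:C ->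
  normc (f w - f z - L * (w - z)) <= e * normc (w - z)); rewrite lecR => hh.
have -> : f w - f z - L * (w - z) = - (L - (w - z)^-1 * (f w - f z)) * (w - z).
  by field; rewrite subr_eq0.
by rewrite normcM normcNr ler_wpM2r ?normc_ge0.
Qed.

Lemma cdiff_derivable f z : cdiff_at f z -> derivable (f : R[i]^o -> R[i]^o) z 1.
Proof.
move=> [L hL]; apply/cvg_ex; exists L => /=.
apply/(@cvgrPdist_le _ R[i]^o) => e /complex_pos[eE e0].
have [d d0 hd] := hL _ e0.
rewrite /dnbhs/= near_withinE; apply/nbhs_ballP; exists d%:C => /=; first by rewrite ltcR.
move=> h; rewrite /ball_ /= sub0r normrN => hlt h0.
have hlt' : normc h < d by rewrite -ltcR.
have -> : h *: (1 : R[i]^o) + z = h + z.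
  by change (h * 1 + z = h + z); rewrite mulr1.
rewrite eE; change ((normc (L - h^-1 * (f (h + z) - f z)))%:C <= (complex.Re e)%:C).
rewrite lecR.
have := hd (h + z); rewrite addrK => /(_ hlt').
have -> : f (h + z) - f z - L * h = - (L - h^-1 * (f (h + z) - f z)) * h.
  by field.
by rewrite normcM normcNr ler_pM2r// normc_gt0.
Qed.

Lemma cdiff_ccont f z : cdiff_at f z -> ccont_at f z.
Proof.
move=> [L hL] e e0; have [d d0 hd] := hL _ (@ltr01 R).
have n0 := normc_ge0 L.
exists (Num.min d (e / (2 + normc L))); first by rewrite lt_min d0 divr_gt0//; lra.
move=> w; rewrite lt_min => /andP[/hd h1].
rewrite ltr_pdivlMr; last by lra.
move=> h2.
have -> : f w - f z = (f w - f z - L * (w - z)) + L * (w - z) by rewrite subrK.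
have := normcD (f w - f z - L * (w - z)) (L * (w - z)); rewrite normcM.
have := normc_ge0 (w - z); nra.
Qed.

Lemma cdiff_near f g z (d : R) : 0 < d -> (forall w, normc (w - z) < d -> f w = g w) ->
  cdiff_at f z -> cdiff_at g z.
Proof.
move=> d0 fg [L hL]; exists L => e e0; have [d1 d10 h1] := hL _ e0.
exists (Num.min d d1); first by rewrite lt_min d0.
move=> w; rewrite lt_min => /andP[h2 h3]; rewrite -!fg//; first exact: h1.
by rewrite subrr normc0.
Qed.

(** This is the shape in which differentiation under the integral sign arrives: the Cauchy kernel
    differs from its first-order expansion in [h] by a term of order [h ^+ 2]. *)
Lemma cdiff_quadratic f z (L : R[i]) (C d : R) : 0 < d ->
  (forall h, normc h < d -> normc (f (z + h) - f z - L * h) <= C * normc h ^+ 2) ->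
  cdiff_at f z.
Proof.
move=> d0 hC; exists L => e e0; exists (Num.min d (e / (1 + `|C|))).
  by rewrite lt_min d0 divr_gt0// ltr_pwDl.
move=> w; rewrite lt_min => /andP[h1 h2].
have := hC (w - z) h1; rewrite (_ : z + (w - z) = w); last by ring.
move=> /le_trans; apply; move: h2; rewrite ltr_pdivlMr ?ltr_pwDl//.
have := normc_ge0 (w - z); have := ler_norm C; have := normr_ge0 C.
nra.
Qed.

Lemma cdiff_cst (c : R[i]) z : cdiff_at (fun=> c) z.
Proof.
exists 0 => e e0; exists 1 => // w _; rewrite mul0r subr0 subrr normc0.
by rewrite mulr_ge0 ?normc_ge0 ?ltW.
Qed.

Lemma cdiff_id z : cdiff_at id z.
Proof.
exists 1 => e e0; exists 1 => // w _; rewrite mul1r subrr normc0.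
by rewrite mulr_ge0 ?normc_ge0 ?ltW.
Qed.

Lemma cdiffD f g z : cdiff_at f z -> cdiff_at g z -> cdiff_at (fun w => f w + g w) z.
Proof.
by move=> /cdiff_derivable hf /cdiff_derivable hg; apply: derivable_cdiff; exact: derivableD.
Qed.

Lemma cdiffN f z : cdiff_at f z -> cdiff_at (fun w => - f w) z.
Proof. by move=> /cdiff_derivable hf; apply: derivable_cdiff; exact: derivableN. Qed.

Lemma cdiffB f g z : cdiff_at f z -> cdiff_at g z -> cdiff_at (fun w => f w - g w) z.
Proof. by move=> hf /cdiffN; exact: cdiffD. Qed.

Lemma cdiffM f g z : cdiff_at f z -> cdiff_at g z -> cdiff_at (fun w => f w * g w) z.
Proof.
by move=> /cdiff_derivable hf /cdiff_derivable hg; apply: derivable_cdiff; exact: (derivableM hf hg).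
Qed.

Lemma cdiffV f z : f z != 0 -> cdiff_at f z -> cdiff_at (fun w => (f w)^-1) z.
Proof.
by move=> fz /cdiff_derivable hf; apply: derivable_cdiff; exact: (derivableV fz hf).
Qed.

Lemma cdiffX f z n : cdiff_at f z -> cdiff_at (fun w => f w ^+ n) z.
Proof.
move=> hf; elim: n => [|n IH]; first by under eq_fun do rewrite expr0; exact: cdiff_cst.
by under eq_fun do rewrite exprS; exact: cdiffM.
Qed.

Lemma cdiff_affine f (a b : R[i]) z : cdiff_at f (a * z + b) ->
  cdiff_at (fun w => f (a * w + b)) z.
Proof.
have [->|a0] := eqVneq a 0.
  by move=> _; under eq_fun do rewrite mul0r; exact: cdiff_cst.
have na0 : 0 < normc a by rewrite normc_gt0.
move=> [L hL]; exists (L * a) => e e0.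
have [|d d0 hd] := hL (e / normc a); first by rewrite divr_gt0.
exists (d / normc a); first by rewrite divr_gt0.
move=> w; rewrite ltr_pdivlMr// => wz.
have E : a * w + b - (a * z + b) = (w - z) * a by ring.
have := hd (a * w + b); rewrite E normcM => /(_ wz).
have -> : e / normc a * (normc (w - z) * normc a) = e * normc (w - z).
  by field; rewrite gt_eqF.
by rewrite (_ : L * ((w - z) * a) = L * a * (w - z)); last by ring.
Qed.

(** Reflection principle: two conjugations cancel, and the derivative is [- conjc L]. This makes the
    second factor of the integrand on the strip holomorphic. *)
Lemma cdiff_conj f (c z : R[i]) : cdiff_at f (c - conjc z) ->
  cdiff_at (fun w => conjc (f (c - conjc w))) z.
Proof.
move=> [L hL]; exists (- conjc L) => e /hL[d d0 hd]; exists d => // w wz.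
have E : c - conjc w - (c - conjc z) = - conjc (w - z) by rewrite conjcB; ring.
have := hd (c - conjc w); rewrite E normcNr normc_conj => /(_ wz).
rewrite -[X in X <= _ -> _]normc_conj.
rewrite (_ : conjc _ = conjc (f (c - conjc w)) - conjc (f (c - conjc z)) - - conjc L * (w - z))//.
move: (f _) (f _) (w - z) => [? ?] [? ?] [? ?]; case: L {hL hd} => ? ? /=.
by congr (_ +i* _); ring.
Qed.

Lemma ccontD f g z : ccont_at f z -> ccont_at g z -> ccont_at (fun w => f w + g w) z.
Proof.
move=> hf hg e e0; have e2 : 0 < e / 2 by rewrite divr_gt0.
have [d d0 h] := hf _ e2; have [d' d'0 h'] := hg _ e2.
exists (Num.min d d'); first by rewrite lt_min d0.
move=> w; rewrite lt_min => /andP[/h h1 /h' h2].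
rewrite opprD addrACA (le_lt_trans (normcD _ _))//; lra.
Qed.

Lemma ccontM f g z : ccont_at f z -> ccont_at g z -> ccont_at (fun w => f w * g w) z.
Proof.
move=> hf hg e e0.
have [d d0 h] := hf _ (@ltr01 R).
have n1 := normc_ge0 (f z); have n2 := normc_ge0 (g z).
have [|d1 d10 h1] := hf (e / (2 * (normc (g z) + 1))).
  by rewrite divr_gt0// mulr_gt0// ltr_wpDl.
have [|d2 d20 h2] := hg (e / (2 * (normc (f z) + 1))).
  by rewrite divr_gt0// mulr_gt0// ltr_wpDl.
exists (Num.min d (Num.min d1 d2)); first by rewrite !lt_min d0 d10.
move=> w; rewrite !lt_min => /and3P[/h a1 /h1 a2 /h2 a3].
have -> : f w * g w - f z * g z = (f w) * (g w - g z) + (f w - f z) * g z by ring.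
apply: le_lt_trans (normcD _ _) _; rewrite !normcM.
have a4 : normc (f w) < normc (f z) + 1.
  by have := normcD (f w - f z) (f z); rewrite subrK; lra.
move: a2 a3; rewrite !ltr_pdivlMr ?mulr_gt0// ?ltr_wpDl// => a2 a3.
have n3 := normc_ge0 (g w - g z); have n4 := normc_ge0 (f w - f z).
have n5 := normc_ge0 (f w).
have b1 : normc (f w) * normc (g w - g z) <= (normc (f z) + 1) * normc (g w - g z).
  by rewrite ler_wpM2r// ltW.
nra.
Qed.

End epsilon_delta.

(** * Integrals of continuous functions over segments *)

Section segment_integral.
Context (R : realType).
Implicit Types (g h : R -> R) (a b c : R).
Local Notation mu := (@lebesgue_measure R).

(** For [b < a] the segment is empty and the value is 0, not minus the integral from [b] to [a];
    hence the order hypotheses below. *)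
Definition segint g a b : R := \int[mu]_(x in `[a, b]) g x.

Definition segcont g a b := {in `[a, b], continuous g}.

Lemma segcont_integrable g a b : segcont g a b -> mu.-integrable `[a, b] (EFin \o g).
Proof.
move=> hg; apply: continuous_compact_integrable; first exact: segment_compact.
by apply: continuous_in_subspaceT => x; rewrite inE; exact: hg.
Qed.

Lemma segcontD g h a b : segcont g a b -> segcont h a b -> segcont (g \+ h) a b.
Proof. by move=> hg hh x xab; apply: continuousD; [exact: hg|exact: hh]. Qed.

Lemma segcontN g a b : segcont g a b -> segcont (fun x => - g x) a b.
Proof. by move=> hg x xab; apply: continuousN; exact: hg. Qed.

Lemma segint_split g a b c : a <= b -> b <= c -> segcont g a c ->
  segint g a c = segint g a b + segint g b c.
Proof.
move=> ab bc hg; have ig := segcont_integrable hg.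
apply/eqP; rewrite addrC -subr_eq; apply/eqP.
rewrite /segint (@Rintegral_itvB _ g)//.
rewrite Rintegral_itv_obnd_cbnd//.
apply: (@integrableS _ _ _ mu `[a, c]) => //.
by apply: subset_itv; rewrite bnd_simp.
Qed.

Lemma segintD g h a b : segcont g a b -> segcont h a b ->
  segint (fun x => g x + h x) a b = segint g a b + segint h a b.
Proof. by move=> hg hh; apply: RintegralD => //; exact: segcont_integrable. Qed.

Lemma segintB g h a b : segcont g a b -> segcont h a b ->
  segint (fun x => g x - h x) a b = segint g a b - segint h a b.
Proof. by move=> hg hh; apply: RintegralB => //; exact: segcont_integrable. Qed.

Lemma segintZ g (k : R) a b : segcont g a b ->
  segint (fun x => k * g x) a b = k * segint g a b.
Proof. by move=> hg; apply: RintegralZl => //; exact: segcont_integrable. Qed.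

Lemma segint_cst (k : R) a b : a <= b -> segint (fun=> k) a b = k * (b - a).
Proof.
move=> ab; rewrite /segint Rintegral_cst//= lebesgue_measure_itv/= lte_fin.
by case: ltgtP ab => //= ->; rewrite subrr.
Qed.

Lemma eq_segint g h a b : (forall x, a <= x <= b -> g x = h x) -> segint g a b = segint h a b.
Proof. by move=> gh; apply: eq_Rintegral => x; rewrite inE/= in_itv/=; exact: gh. Qed.

Lemma segcont_cst (k : R) a b : segcont (fun=> k) a b.
Proof. by move=> x _; exact: cst_continuous. Qed.

Lemma segcontZ (k : R) g a b : segcont g a b -> segcont (fun x => k * g x) a b.
Proof. by move=> hg x hx; apply: continuousM; [exact: cst_continuous|exact: hg]. Qed.

Lemma le_segint g h a b : segcont g a b -> segcont h a b ->
  (forall x, a <= x <= b -> g x <= h x) -> segint g a b <= segint h a b.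
Proof.
move=> hg hh gh.
have ig := segcont_integrable hg; have ih := segcont_integrable hh.
by apply: le_Rintegral => // x; rewrite /= in_itv/=; exact: gh.
Qed.

Lemma segint_bound g a b (M : R) : a <= b -> segcont g a b ->
  (forall x, a <= x <= b -> `|g x| <= M) -> `|segint g a b| <= M * (b - a).
Proof.
move=> ab hg gM; rewrite ler_norml; apply/andP; split.
  rewrite -mulNr -segint_cst//; apply: le_segint => //; first exact: segcont_cst.
  by move=> x /gM; rewrite ler_norml => /andP[].
rewrite -segint_cst//; apply: le_segint => //; first exact: segcont_cst.
by move=> x /gM; rewrite ler_norml => /andP[].
Qed.

End segment_integral.

(** * Dyadic subdivision of a rectangle *)

Section bisection.
Context (R : realType).

(** Cousin's lemma in dyadic form. [P x y k] speaks of the rectangle with lower left corner [(x, y)]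
    and sides [u / 2 ^+ k], [v / 2 ^+ k]. If [P] failed at the top it would fail on nested
    rectangles shrinking to a point, against the local hypothesis there. *)
Lemma bisection (P : R -> R -> nat -> Prop) (x0 y0 u v : R) : 0 < u -> 0 < v ->
  (forall x y k, P x y k.+1 -> P (x + u / 2 ^+ k.+1) y k.+1 ->
     P x (y + v / 2 ^+ k.+1) k.+1 -> P (x + u / 2 ^+ k.+1) (y + v / 2 ^+ k.+1) k.+1 -> P x y k) ->
  (forall xs ys, x0 <= xs <= x0 + u -> y0 <= ys <= y0 + v ->
     exists k0, forall x y k, (k0 <= k)%N ->
       x0 <= x -> x + u / 2 ^+ k <= x0 + u -> y0 <= y -> y + v / 2 ^+ k <= y0 + v ->
       x <= xs <= x + u / 2 ^+ k -> y <= ys <= y + v / 2 ^+ k -> P x y k) ->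
  P x0 y0 0%N.
Proof.
move=> u0 v0 split_ local; apply: contrapT => nP0.
pose ux k := u / 2 ^+ k; pose vy k := v / 2 ^+ k.
have uxS k : ux k = ux k.+1 + ux k.+1 by rewrite /ux exprS; field; rewrite expf_neq0.
have vyS k : vy k = vy k.+1 + vy k.+1 by rewrite /vy exprS; field; rewrite expf_neq0.
have ux0 k : 0 < ux k by rewrite divr_gt0// exprn_gt0.
have vy0 k : 0 < vy k by rewrite divr_gt0// exprn_gt0.
(* The implication guards the choice, so that some [q] exists for every [p]; a rectangle violating
   [P] has a violating quarter. *)
have step (k : nat) (p : R * R) : exists q : R * R, ~ P p.1 p.2 k ->
    [/\ ~ P q.1 q.2 k.+1, p.1 <= q.1, q.1 + ux k.+1 <= p.1 + ux k,
        p.2 <= q.2 & q.2 + vy k.+1 <= p.2 + vy k].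
  have := ux0 k.+1; have := vy0 k.+1; have := uxS k; have := vyS k.
  move=> e1 e2 e3 e4.
  have [h|] := pselect (P p.1 p.2 k); first by exists p.
  move=> h; apply: contrapT => /forallNP nq; apply: h; apply: split_.
  - by apply: contrapT => h; apply: (nq p) => _; split => //; lra.
  - by apply: contrapT => h; apply: (nq (p.1 + ux k.+1, p.2)) => _; split => //=; lra.
  - by apply: contrapT => h; apply: (nq (p.1, p.2 + vy k.+1)) => _; split => //=; lra.
  - by apply: contrapT => h; apply: (nq (p.1 + ux k.+1, p.2 + vy k.+1)) => _; split => //=; lra.
pose nxt k p := projT1 (cid (step k p)).
pose s := fix s k := if k is k'.+1 then nxt k' (s k') else (x0, y0).
have sP k : ~ P (s k).1 (s k).2 k.
  elim: k => [|k IH] //=; rewrite /nxt; case: cid => q /= hq.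
  by have [] := hq IH.
have sS k : [/\ (s k).1 <= (s k.+1).1, (s k.+1).1 + ux k.+1 <= (s k).1 + ux k,
        (s k).2 <= (s k.+1).2 & (s k.+1).2 + vy k.+1 <= (s k).2 + vy k].
  by rewrite /= /nxt; case: cid => q /= hq; have [] := hq (sP k).
have smono m n : (m <= n)%N -> [/\ (s m).1 <= (s n).1, (s n).1 + ux n <= (s m).1 + ux m,
        (s m).2 <= (s n).2 & (s n).2 + vy n <= (s m).2 + vy m].
  move=> /subnK <-; elim: (n - m)%N => [|d [h1 h2 h3 h4]]; first by rewrite add0n.
  have [g1 g2 g3 g4] := sS (d + m)%N; rewrite addSn.
  by split; [exact: le_trans g1|exact: le_trans h2|exact: le_trans g3|exact: le_trans h4].
have sx m n : (s m).1 <= (s n).1 + ux n.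
  have [/smono[h _ _ _]|/ltnW/smono[_ h _ _]] := leqP m n.
    by apply: le_trans h _; rewrite lerDl ltW.
  by apply: le_trans h; rewrite lerDl ltW.
have sy m n : (s m).2 <= (s n).2 + vy n.
  have [/smono[_ _ h _]|/ltnW/smono[_ _ _ h]] := leqP m n.
    by apply: le_trans h _; rewrite lerDl ltW.
  by apply: le_trans h; rewrite lerDl ltW.
(* Every right edge bounds all left edges, and likewise for upper and lower ones, so the two suprema
   give a point common to all rectangles of the sequence. *)
pose X := [set (s k).1 | k in [set: nat]]; pose Y := [set (s k).2 | k in [set: nat]].
have bX n : ubound X ((s n).1 + ux n) by move=> _ [m _ <-]; exact: sx.
have bY n : ubound Y ((s n).2 + vy n) by move=> _ [m _ <-]; exact: sy.
have sX : has_sup X by split; [exists (s 0%N).1; exists 0%N|exists ((s 0%N).1 + ux 0%N); exact: bX].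
have sY : has_sup Y by split; [exists (s 0%N).2; exists 0%N|exists ((s 0%N).2 + vy 0%N); exact: bY].
have xs k : (s k).1 <= sup X <= (s k).1 + ux k.
  apply/andP; split; first by apply: ub_le_sup; [case: sX|exists k].
  by apply: ge_sup; [case: sX|exact: bX].
have ys k : (s k).2 <= sup Y <= (s k).2 + vy k.
  apply/andP; split; first by apply: ub_le_sup; [case: sY|exists k].
  by apply: ge_sup; [case: sY|exact: bY].
have E (t : R) : t / 2 ^+ 0 = t by rewrite expr0 divr1.
have [||k0 hk] := local (sup X) (sup Y).
- by have := xs 0%N; rewrite /ux E.
- by have := ys 0%N; rewrite /vy E.
apply: (sP k0); have [h1 h2 h3 h4] := smono 0%N k0 (leq0n _).
move: h2 h4; rewrite /ux /vy !E => h2 h4.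
by apply: hk.
Qed.

End bisection.

(** * Cauchy's formula on rectangles *)

Section rectangle_integral.
Context (R : realType).
Implicit Types (f g : R[i] -> R[i]) (x y : R).

(* The real part of the integral of [f] along the boundary of a rectangle,
   oriented counterclockwise. *)
Definition rint f x1 x2 y1 y2 : R :=
  segint (fun x => complex.Re (f (x +i* y1))) x1 x2
  - segint (fun x => complex.Re (f (x +i* y2))) x1 x2
  + segint (fun y => complex.Im (f (x1 +i* y))) y1 y2
  - segint (fun y => complex.Im (f (x2 +i* y))) y1 y2.

Definition rcont f x1 x2 y1 y2 := forall x y,
  x1 <= x <= x2 -> y1 <= y <= y2 -> ccont_at f (x +i* y).

Lemma ccont_hcont f x y : ccont_at f (x +i* y) ->
  {for x, continuous (fun t => complex.Re (f (t +i* y)))}.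
Proof.
move=> hf; apply/cvgrPdist_lt => e /hf[d d0 hd].
near=> t; have := hd (t +i* y) _; rewrite /= subrr => h.
apply: le_lt_trans (h _).
  by rewrite distrC -cReN -cReD; exact: normc_Re.
rewrite expr0n addr0 sqrtr_sqr distrC; near: t.
by apply/nbhs_ballP; exists d => // t; rewrite /ball /= .
Unshelve. all: by end_near. Qed.

Lemma ccont_vcont f x y : ccont_at f (x +i* y) ->
  {for y, continuous (fun t => complex.Im (f (x +i* t)))}.
Proof.
move=> hf; apply/cvgrPdist_lt => e /hf[d d0 hd].
near=> t; have := hd (x +i* t) _; rewrite /= subrr => h.
apply: le_lt_trans (h _).
  by rewrite distrC -cImN -cImD; exact: normc_Im.
rewrite expr0n add0r sqrtr_sqr distrC; near: t.
by apply/nbhs_ballP; exists d => // t; rewrite /ball /= .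
Unshelve. all: by end_near. Qed.

Lemma rcont_h f x1 x2 y1 y2 y : rcont f x1 x2 y1 y2 -> y1 <= y <= y2 ->
  segcont (fun x => complex.Re (f (x +i* y))) x1 x2.
Proof. by move=> hf hy x; rewrite in_itv/= => hx; apply: ccont_hcont; exact: hf. Qed.

Lemma rcont_v f x1 x2 y1 y2 x : rcont f x1 x2 y1 y2 -> x1 <= x <= x2 ->
  segcont (fun y => complex.Im (f (x +i* y))) y1 y2.
Proof. by move=> hf hy y; rewrite in_itv/= => hx; apply: ccont_vcont; exact: hf. Qed.

(** Continuity at the points of the boundary only, because kernels such as [(w - z)^-1] are singular
    inside the rectangle. *)
Definition bcont f x1 x2 y1 y2 := forall x y, x1 <= x <= x2 -> y1 <= y <= y2 ->
  [\/ x = x1, x = x2, y = y1 | y = y2] -> ccont_at f (x +i* y).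

Lemma rcont_bcont f x1 x2 y1 y2 : rcont f x1 x2 y1 y2 -> bcont f x1 x2 y1 y2.
Proof. by move=> hf x y hx hy _; exact: hf. Qed.

Lemma bcont_h f x1 x2 y1 y2 y : bcont f x1 x2 y1 y2 -> y1 <= y2 -> y = y1 \/ y = y2 ->
  segcont (fun x => complex.Re (f (x +i* y))) x1 x2.
Proof.
move=> hf y12 hy x; rewrite in_itv/= => hx; apply: ccont_hcont.
by apply: hf => //; case: hy => ->; rewrite ?lexx ?y12//; [constructor 3|constructor 4].
Qed.

Lemma bcont_v f x1 x2 y1 y2 x : bcont f x1 x2 y1 y2 -> x1 <= x2 -> x = x1 \/ x = x2 ->
  segcont (fun y => complex.Im (f (x +i* y))) y1 y2.
Proof.
move=> hf y12 hy y; rewrite in_itv/= => hx; apply: ccont_vcont.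
by apply: hf => //; case: hy => ->; rewrite ?lexx ?y12//; [constructor 1|constructor 2].
Qed.

Lemma rcontS f x1 x2 y1 y2 x1' x2' y1' y2' : x1 <= x1' -> x2' <= x2 -> y1 <= y1' -> y2' <= y2 ->
  rcont f x1 x2 y1 y2 -> rcont f x1' x2' y1' y2'.
Proof.
move=> a1 a2 a3 a4 hf x y /andP[b1 b2] /andP[c1 c2]; apply: hf; apply/andP; split; lra.
Qed.

Lemma rint_addx f x1 x2 x3 y1 y2 : x1 <= x2 -> x2 <= x3 -> y1 <= y2 -> rcont f x1 x3 y1 y2 ->
  rint f x1 x3 y1 y2 = rint f x1 x2 y1 y2 + rint f x2 x3 y1 y2.
Proof.
move=> h1 h2 h3 hf; rewrite /rint.
rewrite (segint_split h1 h2 (rcont_h hf _)) ?lexx//.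
rewrite (segint_split h1 h2 (rcont_h hf _)) ?lexx ?h3//; ring.
Qed.

Lemma rint_addy f x1 x2 y1 y2 y3 : x1 <= x2 -> y1 <= y2 -> y2 <= y3 -> rcont f x1 x2 y1 y3 ->
  rint f x1 x2 y1 y3 = rint f x1 x2 y1 y2 + rint f x1 x2 y2 y3.
Proof.
move=> h1 h2 h3 hf; rewrite /rint.
rewrite (segint_split h2 h3 (rcont_v hf _)) ?lexx//.
rewrite (segint_split h2 h3 (rcont_v hf _)) ?lexx ?h1//; ring.
Qed.

Lemma eq_rint f g x1 x2 y1 y2 : x1 <= x2 -> y1 <= y2 ->
  (forall x y, x1 <= x <= x2 -> y1 <= y <= y2 -> [\/ x = x1, x = x2, y = y1 | y = y2] ->
     f (x +i* y) = g (x +i* y)) ->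
  rint f x1 x2 y1 y2 = rint g x1 x2 y1 y2.
Proof.
move=> x12 y12 fg; rewrite /rint; congr (_ - _ + _ - _); apply: eq_segint => t ht.
- by rewrite fg ?lexx//; constructor 3.
- by rewrite fg ?lexx ?y12//; constructor 4.
- by rewrite fg ?lexx//; constructor 1.
- by rewrite fg ?lexx ?x12//; constructor 2.
Qed.

Lemma rintD f g x1 x2 y1 y2 : x1 <= x2 -> y1 <= y2 ->
  bcont f x1 x2 y1 y2 -> bcont g x1 x2 y1 y2 ->
  rint (fun z => f z + g z) x1 x2 y1 y2 = rint f x1 x2 y1 y2 + rint g x1 x2 y1 y2.
Proof.
move=> x12 y12 hf hg.
have H y : y = y1 \/ y = y2 ->
  segint (fun x => complex.Re (f (x +i* y) + g (x +i* y))) x1 x2 =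
  segint (fun x => complex.Re (f (x +i* y))) x1 x2 + segint (fun x => complex.Re (g (x +i* y))) x1 x2.
  move=> hy; rewrite -segintD; [|exact: bcont_h hf _ hy|exact: bcont_h hg _ hy].
  by apply: eq_segint => x _; rewrite cReD.
have V x : x = x1 \/ x = x2 ->
  segint (fun y => complex.Im (f (x +i* y) + g (x +i* y))) y1 y2 =
  segint (fun y => complex.Im (f (x +i* y))) y1 y2 + segint (fun y => complex.Im (g (x +i* y))) y1 y2.
  move=> hx; rewrite -segintD; [|exact: bcont_v hf _ hx|exact: bcont_v hg _ hx].
  by apply: eq_segint => y _; rewrite cImD.
rewrite /rint (H y1 (or_introl erefl)) (H y2 (or_intror erefl)).
rewrite (V x1 (or_introl erefl)) (V x2 (or_intror erefl)); ring.
Qed.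

Lemma rintZ (k : R) f x1 x2 y1 y2 : x1 <= x2 -> y1 <= y2 -> bcont f x1 x2 y1 y2 ->
  rint (fun z => k%:C * f z) x1 x2 y1 y2 = k * rint f x1 x2 y1 y2.
Proof.
move=> x12 y12 hf.
have H y : y = y1 \/ y = y2 ->
  segint (fun x => complex.Re (k%:C * f (x +i* y))) x1 x2 =
  k * segint (fun x => complex.Re (f (x +i* y))) x1 x2.
  move=> hy; rewrite -segintZ; last exact: bcont_h hf _ hy.
  by apply: eq_segint => x _; rewrite cReM /= mul0r subr0.
have V x : x = x1 \/ x = x2 ->
  segint (fun y => complex.Im (k%:C * f (x +i* y))) y1 y2 =
  k * segint (fun y => complex.Im (f (x +i* y))) y1 y2.
  move=> hx; rewrite -segintZ; last exact: bcont_v hf _ hx.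
  by apply: eq_segint => x0 _; rewrite cImM /= mul0r addr0.
rewrite /rint (H y1 (or_introl erefl)) (H y2 (or_intror erefl)).
rewrite (V x1 (or_introl erefl)) (V x2 (or_intror erefl)); ring.
Qed.

Lemma bcontM f g x1 x2 y1 y2 : bcont f x1 x2 y1 y2 -> bcont g x1 x2 y1 y2 ->
  bcont (fun z => f z * g z) x1 x2 y1 y2.
Proof. by move=> hf hg x y hx hy bxy; apply: ccontM; [exact: hf|exact: hg]. Qed.

Lemma bcontD f g x1 x2 y1 y2 : bcont f x1 x2 y1 y2 -> bcont g x1 x2 y1 y2 ->
  bcont (fun z => f z + g z) x1 x2 y1 y2.
Proof. by move=> hf hg x y hx hy bxy; apply: ccontD; [exact: hf|exact: hg]. Qed.

Lemma rcont_cst c x1 x2 y1 y2 : rcont (fun=> c) x1 x2 y1 y2.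
Proof. by move=> x y _ _; apply: cdiff_ccont; exact: cdiff_cst. Qed.

Lemma rint_bound f x1 x2 y1 y2 (M : R) : x1 <= x2 -> y1 <= y2 -> bcont f x1 x2 y1 y2 ->
  (forall x y, x1 <= x <= x2 -> y1 <= y <= y2 -> [\/ x = x1, x = x2, y = y1 | y = y2] ->
     normc (f (x +i* y)) <= M) ->
  `|rint f x1 x2 y1 y2| <= 2 * M * ((x2 - x1) + (y2 - y1)).
Proof.
move=> x12 y12 hf hM.
have H y : y = y1 \/ y = y2 -> `|segint (fun x => complex.Re (f (x +i* y))) x1 x2| <= M * (x2 - x1).
  move=> hy; have y12' : y1 <= y <= y2 by case: hy => ->; rewrite lexx y12.
  apply: segint_bound => //; first exact: bcont_h hf _ _.
  move=> x hx; apply: le_trans (normc_Re _) (hM _ _ hx y12' _).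
  by case: hy => ->; [constructor 3|constructor 4].
have V x : x = x1 \/ x = x2 -> `|segint (fun y => complex.Im (f (x +i* y))) y1 y2| <= M * (y2 - y1).
  move=> hx; have x12' : x1 <= x <= x2 by case: hx => ->; rewrite lexx x12.
  apply: segint_bound => //; first exact: bcont_v hf _ _.
  move=> y hy; apply: le_trans (normc_Im _) (hM _ _ x12' hy _).
  by case: hx => ->; [constructor 1|constructor 2].
rewrite /rint.
have := H _ (or_introl (erefl y1)); have := H _ (or_intror (erefl y2)).
have := V _ (or_introl (erefl x1)); have := V _ (or_intror (erefl x2)).
move: (segint _ _ _) (segint _ _ _) (segint _ _ _) (segint _ _ _) => a b c d.
rewrite !ler_norml => /andP[? ?] /andP[? ?] /andP[? ?] /andP[? ?].
apply/andP; split; lra.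
Qed.

Lemma rcont_affine (A L : R[i]) x1 x2 y1 y2 : rcont (fun z => A + L * z) x1 x2 y1 y2.
Proof.
move=> x y _ _; apply: cdiff_ccont; apply: cdiffD; first exact: cdiff_cst.
by apply: cdiffM; [exact: cdiff_cst|exact: cdiff_id].
Qed.

Lemma rint_affine (A L : R[i]) x1 x2 y1 y2 : x1 <= x2 -> y1 <= y2 ->
  rint (fun z => A + L * z) x1 x2 y1 y2 = 0.
Proof.
move=> x12 y12; have hf := @rcont_affine A L x1 x2 y1 y2.
have h1 := rcont_h hf (y := y1); have h2 := rcont_h hf (y := y2).
have h3 := rcont_v hf (x := x1); have h4 := rcont_v hf (x := x2).
rewrite !lexx ?x12 ?y12 in h1 h2 h3 h4.
rewrite /rint -segintB; [|exact: h1|exact: h2].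
rewrite -addrA -segintB; [|exact: h3|exact: h4].
rewrite [X in X + _](@eq_segint _ _ (fun=> complex.Im L * (y2 - y1))); last first.
  by move=> x _; rewrite !cReD !cReM /=; ring.
rewrite [X in _ + X](@eq_segint _ _ (fun=> complex.Im L * (x1 - x2))); last first.
  by move=> x _; rewrite !cImD !cImM /=; ring.
rewrite !segint_cst//; ring.
Qed.

Lemma pow2_small (c d : R) : 0 < c -> 0 < d ->
  exists k0, forall k, (k0 <= k)%N -> c / 2 ^+ k < d.
Proof.
move=> c0 d0; exists (Num.truncn (c / d)).+1 => k hk.
rewrite ltr_pdivrMr ?exprn_gt0// mulrC -ltr_pdivrMr//.
apply: lt_trans (truncnS_gt _) _.
by rewrite -natrX ltr_nat (leq_trans _ (ltn_expl k (ltnSn 1)))// ltnS.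
Qed.

Lemma rint_split4 f x y s t : 0 <= s -> 0 <= t -> rcont f x (x + s + s) y (y + t + t) ->
  rint f x (x + s + s) y (y + t + t) =
  (rint f x (x + s) y (y + t) + rint f (x + s) (x + s + s) y (y + t)) +
  (rint f x (x + s) (y + t) (y + t + t) + rint f (x + s) (x + s + s) (y + t) (y + t + t)).
Proof.
move=> s0 t0 hf.
have [xs yt] : x <= x + s /\ y <= y + t by rewrite !lerDl.
have [xss ytt] : x + s <= x + s + s /\ y + t <= y + t + t by rewrite !lerDl.
rewrite (@rint_addy _ _ _ y (y + t))//; last exact: le_trans xss.
have hf1 : rcont f x (x + s + s) y (y + t) by apply: rcontS hf.
have hf2 : rcont f x (x + s + s) (y + t) (y + t + t) by apply: rcontS hf.
by rewrite (rint_addx xs xss yt hf1) (rint_addx xs xss ytt hf2).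
Qed.

(** Near a point of differentiability [f] is affine up to an error small against the diameter. The
    affine part integrates to 0, and the error times the perimeter is of order [4^-k], the rate at
    which a bound splits evenly among four quarters. *)
Lemma goursat f x1 x2 y1 y2 : x1 <= x2 -> y1 <= y2 ->
  (forall x y, x1 <= x <= x2 -> y1 <= y <= y2 -> cdiff_at f (x +i* y)) ->
  rint f x1 x2 y1 y2 = 0.
Proof.
move=> x12 y12 hd.
have hc : rcont f x1 x2 y1 y2 by move=> x y hx hy; apply: cdiff_ccont; exact: hd.
have degen a b : segint (fun x => complex.Re (f (x +i* a))) b b = 0.
  by rewrite /segint set_itv1 Rintegral_set1.
have degen' a b : segint (fun x => complex.Im (f (a +i* x))) b b = 0.
  by rewrite /segint set_itv1 Rintegral_set1.
move: x12; rewrite le_eqVlt => /predU1P[<-|x12].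
  by rewrite /rint !degen; ring.
move: y12; rewrite le_eqVlt => /predU1P[<-|y12].
  by rewrite /rint !degen'; ring.
apply/eqP; rewrite -normr_eq0 -[_ == 0]negbK; apply/negP => ne0.
have {ne0}n0 : 0 < `|rint f x1 x2 y1 y2| by rewrite lt_neqAle eq_sym ne0 /=.
set u := x2 - x1; set v := y2 - y1.
have u0 : 0 < u by rewrite subr_gt0.
have v0 : 0 < v by rewrite subr_gt0.
(* With half the modulus, the bound at level 0 would read |I| <= |I| / 2, impossible for a nonzero
   integral. *)
set e := `|rint f x1 x2 y1 y2| / 2.
have e0 : 0 < e by rewrite divr_gt0.
pose P x y k := x1 <= x -> x + u / 2 ^+ k <= x1 + u -> y1 <= y -> y + v / 2 ^+ k <= y1 + v ->
  `|rint f x (x + u / 2 ^+ k) y (y + v / 2 ^+ k)| <= e / (2 ^+ k) ^+ 2.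
suff : P x1 y1 0%N.
  rewrite /P expr0 !divr1 /u /v expr1n divr1 => /(_ _ _ _ _)/=.
  by rewrite !subrKC => /(_ (lexx _) (lexx _) (lexx _) (lexx _)); rewrite /e; lra.
have x1u : x1 + u = x2 by rewrite /u; ring.
have y1v : y1 + v = y2 by rewrite /v; ring.
apply: (bisection u0 v0) => [x y k|xs ys]; rewrite /P ?x1u ?y1v.
- rewrite ![2 ^+ k.+1]exprS; set p := 2 ^+ k; have p0 : 0 < p by rewrite exprn_gt0.
  have -> : u / p = u / (2 * p) + u / (2 * p) by field; rewrite gt_eqF.
  have -> : v / p = v / (2 * p) + v / (2 * p) by field; rewrite gt_eqF.
  have -> : e / p ^+ 2 = 4 * (e / (2 * p) ^+ 2) by field; rewrite gt_eqF.
  have s0 : 0 < u / (2 * p) by rewrite divr_gt0// mulr_gt0.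
  have t0 : 0 < v / (2 * p) by rewrite divr_gt0// mulr_gt0.
  move: (u / (2 * p)) (v / (2 * p)) (e / (2 * p) ^+ 2) s0 t0 => s t e' s0 t0.
  move=> h1 h2 h3 h4 a1 a2 a3 a4; rewrite !addrA in a2 a4 *.
  move: hc h1 h2 h3 h4 a1 a2 a3 a4; clear -s0 t0; move=> hc h1 h2 h3 h4 a1 a2 a3 a4.
  rewrite (rint_split4 (ltW s0) (ltW t0)); last by apply: rcontS hc.
  have g1 : y + t <= y2 by apply: le_trans a4; rewrite lerDl ltW.
  have g2 : x + s <= x2 by apply: le_trans a2; rewrite lerDl ltW.
  have g3 : y1 <= y + t by apply: le_trans a3 _; rewrite lerDl ltW.
  have g4 : x1 <= x + s by apply: le_trans a1 _; rewrite lerDl ltW.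
  have {}h1 := h1 a1 g2 a3 g1; have {}h2 := h2 g4 a2 a3 g1.
  have {}h3 := h3 a1 g2 g3 a4; have {}h4 := h4 g4 a2 g3 a4.
  apply: (le_trans (ler_normD _ _)); have := ler_normD (rint f x (x + s) y (y + t)) (rint f (x + s) (x + s + s) y (y + t)).
  have := ler_normD (rint f x (x + s) (y + t) (y + t + t)) (rint f (x + s) (x + s + s) (y + t) (y + t + t)).
  clear -h1 h2 h3 h4; lra.
- move=> hx hy; have [L hL] := hd _ _ hx hy.
  have uv : 0 < u + v by rewrite addr_gt0.
  (* On a rectangle with sides [u / p] and [v / p] the error is at most this constant times
     [(u + v) / p], and [rint_bound] contributes a factor [2 (u + v) / p]; the product is
     [e / p ^+ 2]. *)
  have [|d d0 {}hL] := hL (e / (2 * (u + v) ^+ 2)).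
    by rewrite divr_gt0// mulr_gt0// exprn_gt0.
  have [k0 hk0] := pow2_small uv d0; exists k0 => x y k /hk0.
  set p := 2 ^+ k; have p0 : 0 < p by rewrite exprn_gt0.
  have up : 0 < u / p by rewrite divr_gt0.
  have vp : 0 < v / p by rewrite divr_gt0.
  rewrite mulrDl => kd a1 a2 a3 a4 b1 b2 _ _ _ _.
  set zs := xs +i* ys in hL.
  pose A z := (f zs - L * zs) + L * z.
  have hcA : bcont A x (x + u / p) y (y + v / p) by exact/rcont_bcont/rcont_affine.
  have hcf : bcont f x (x + u / p) y (y + v / p) by apply/rcont_bcont/(rcontS _ _ _ _ hc).
  pose A' z := (-1)%:C * A z.
  have hcA' : bcont A' x (x + u / p) y (y + v / p).
    by apply: bcontM => //; exact/rcont_bcont/rcont_cst.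
  have -> : rint f x (x + u / p) y (y + v / p) = rint (fun z => f z + A' z) x (x + u / p) y (y + v / p).
    by rewrite rintD ?lerDl 1?ltW// /A' rintZ ?lerDl 1?ltW// rint_affine ?lerDl 1?ltW// mulr0 addr0.
  apply: (le_trans (@rint_bound _ _ _ _ _ (e / (2 * (u + v) ^+ 2) * (u / p + v / p)) _ _ _ _)).
  + by rewrite lerDl ltW.
  + by rewrite lerDl ltW.
  + exact: bcontD.
  + move=> x' y' hx' hy' _.
    have hz : normc ((x' +i* y') - zs) <= u / p + v / p.
      apply: le_trans (normc_le_ReIm _) _; rewrite /=; apply: lerD; rewrite ler_norml; apply/andP; split; lra.
    have -> : f (x' +i* y') + A' (x' +i* y') = f (x' +i* y') - f zs - L * ((x' +i* y') - zs).
      by rewrite /A' /A rmorphN rmorph1; ring.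
    apply: le_trans (hL _ _) _; first exact: le_lt_trans hz _.
    by rewrite ler_wpM2l// divr_ge0 1?ltW// mulr_gt0// exprn_gt0.
  + rewrite le_eqVlt; apply/orP; left; apply/eqP; field.
    by rewrite !gt_eqF.
Qed.

End rectangle_integral.

(** * Cauchy's formula with an unevaluated winding integral *)

Section cauchy.
Context (R : realType).
Implicit Types (f g : R[i] -> R[i]) (x y a b : R) (z w : R[i]).

(** A removable point: Goursat's theorem disposes of everything outside a square of half-side [t]
    around it, and there the integrand is bounded while the perimeter is arbitrarily small. *)
Lemma goursat_punctured f x1 x2 y1 y2 a b : x1 < a < x2 -> y1 < b < y2 ->
  rcont f x1 x2 y1 y2 ->
  (forall x y, x1 <= x <= x2 -> y1 <= y <= y2 -> x +i* y != a +i* b -> cdiff_at f (x +i* y)) ->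
  rint f x1 x2 y1 y2 = 0.
Proof.
move=> /andP[xa ax] /andP[yb by_] hf hd.
have ha : x1 <= a <= x2 by rewrite !ltW.
have hb : y1 <= b <= y2 by rewrite !ltW.
have [d d0 hM] := hf a b ha hb _ (@ltr01 R).
set z := a +i* b in hM *; pose M := normc (f z) + 1.
have M0 : 0 < M by rewrite ltr_wpDl ?normc_ge0.
apply/eqP; rewrite -normr_eq0 -[_ == 0]negbK; apply/negP => ne0.
have {ne0}n0 : 0 < `|rint f x1 x2 y1 y2| by rewrite lt_neqAle eq_sym ne0 /=.
have [t [t0 [t1 t2 t3 t4] t5 t6]] : exists t, [/\ 0 < t,
    [/\ x1 < a - t, a + t < x2, y1 < b - t & b + t < y2], 2 * t < d &
    16 * M * t < `|rint f x1 x2 y1 y2|].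
  pose m := Num.min (Num.min (a - x1) (x2 - a)) (Num.min (b - y1) (y2 - b)).
  pose m' := Num.min (d / 2) (`|rint f x1 x2 y1 y2| / (16 * M)).
  have m0 : 0 < Num.min m m'.
    by rewrite !lt_min !subr_gt0 xa ax yb by_ /= !divr_gt0// mulr_gt0.
  exists (Num.min m m' / 2).
  have : Num.min m m' / 2 < Num.min m m' by rewrite ltr_pdivrMr// ltr_pMr// ltr1n.
  move: {-1}(Num.min m m' / 2) (erefl (Num.min m m' / 2)) => t tE.
  rewrite !lt_min -!andbA => /and5P[? ? ? ?] /andP[?].
  rewrite ltr_pdivlMr ?mulr_gt0// => ?.
  by split; [rewrite -tE divr_gt0|split; lra|lra|lra].
have hS x1' x2' y1' y2' : x1 <= x1' -> x2' <= x2 -> y1 <= y1' -> y2' <= y2 ->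
    x1' <= x2' -> y1' <= y2' -> (x2' < a \/ a < x1' \/ y2' < b \/ b < y1') ->
    rint f x1' x2' y1' y2' = 0.
  move=> h1 h2 h3 h4 h5 h6 h7; apply: goursat => // x y /andP[g1 g2] /andP[g3 g4].
  apply: hd; rewrite ?(le_trans h1 g1) ?(le_trans g2 h2) ?(le_trans h3 g3) ?(le_trans g4 h4)//.
  apply/negP => /eqP[xE yE]; subst; lra.
have A1 : rint f x1 x2 y1 y2 = rint f (a - t) (a + t) y1 y2.
  rewrite (@rint_addx _ _ x1 (a - t)) ?(hS x1 (a - t))//; [|lra..].
  rewrite (@rint_addx _ _ (a - t) (a + t)) ?(hS (a + t) x2)//; [|lra..|]; first by rewrite add0r addr0.
  by apply: rcontS hf; lra.
have A2 : rint f (a - t) (a + t) y1 y2 = rint f (a - t) (a + t) (b - t) (b + t).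
  rewrite (@rint_addy _ _ _ _ y1 (b - t)) ?(hS _ _ y1 (b - t))//; [|lra..|]; last first.
    by apply: rcontS hf; lra.
  rewrite (@rint_addy _ _ _ _ (b - t) (b + t)) ?(hS _ _ (b + t) y2)//; [|lra..|]; first by rewrite add0r addr0.
  by apply: rcontS hf; lra.
have : `|rint f (a - t) (a + t) (b - t) (b + t)| <= 2 * M * ((a + t - (a - t)) + (b + t - (b - t))).
  apply: rint_bound; [lra|lra|by apply/rcont_bcont/(rcontS _ _ _ _ hf); lra|].
  move=> x y hx hy _.
  have : normc (x +i* y - z) < d.
    apply: le_lt_trans (normc_le_ReIm _) _; rewrite /=.
    have : `|x - a| <= t by rewrite ler_norml; apply/andP; split; lra.
    have : `|y - b| <= t by rewrite ler_norml; apply/andP; split; lra.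
    lra.
  move=> /hM; have := normcD (f (x +i* y) - f z) (f z); rewrite subrK /M; lra.
by rewrite -A2 -A1; lra.
Qed.

(* The imaginary part of a contour integral is minus the real part of that of ['i * f]. *)
Definition cint f x1 x2 y1 y2 : R[i] :=
  rint f x1 x2 y1 y2 +i* - rint (fun z => 'i * f z) x1 x2 y1 y2.

Lemma bcont_cst (c : R[i]) x1 x2 y1 y2 : bcont (fun=> c) x1 x2 y1 y2.
Proof. exact/rcont_bcont/rcont_cst. Qed.

Lemma bcontZ (c : R[i]) f x1 x2 y1 y2 : bcont f x1 x2 y1 y2 -> bcont (fun z => c * f z) x1 x2 y1 y2.
Proof. by move=> hf; apply: bcontM => //; exact: bcont_cst. Qed.

Lemma eq_cint f g x1 x2 y1 y2 : x1 <= x2 -> y1 <= y2 ->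
  (forall x y, x1 <= x <= x2 -> y1 <= y <= y2 -> [\/ x = x1, x = x2, y = y1 | y = y2] ->
     f (x +i* y) = g (x +i* y)) ->
  cint f x1 x2 y1 y2 = cint g x1 x2 y1 y2.
Proof.
move=> x12 y12 fg; congr (_ +i* - _); apply: eq_rint => // x y hx hy bxy; by rewrite fg.
Qed.

Lemma cintD f g x1 x2 y1 y2 : x1 <= x2 -> y1 <= y2 ->
  bcont f x1 x2 y1 y2 -> bcont g x1 x2 y1 y2 ->
  cint (fun z => f z + g z) x1 x2 y1 y2 = cint f x1 x2 y1 y2 + cint g x1 x2 y1 y2.
Proof.
move=> x12 y12 hf hg; rewrite /cint rintD//.
have -> : (fun z => 'i * (f z + g z)) = (fun z => 'i * f z + 'i * g z).
  by apply/funext => z; rewrite mulrDr.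
by rewrite rintD//; [rewrite opprD|exact: bcontZ..].
Qed.

Lemma cintZ (c : R[i]) f x1 x2 y1 y2 : x1 <= x2 -> y1 <= y2 -> bcont f x1 x2 y1 y2 ->
  cint (fun z => c * f z) x1 x2 y1 y2 = c * cint f x1 x2 y1 y2.
Proof.
case: c => c1 c2 x12 y12 hf; have hif := bcontZ 'i hf.
have E1 : (fun z => (c1 +i* c2) * f z) = (fun z => c1%:C * f z + c2%:C * ('i * f z)).
  by apply/funext => z; case: (f z) => u v; simpc; congr (_ +i* _); ring.
have E2 : (fun z => 'i * ((c1 +i* c2) * f z)) = (fun z => c1%:C * ('i * f z) + (- c2)%:C * f z).
  by apply/funext => z; case: (f z) => u v; simpc; congr (_ +i* _); ring.
rewrite /cint E2 E1 !rintD// ?rintZ//; [|by do ?apply: bcontZ..].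
by simpc; congr (_ +i* _); ring.
Qed.

Lemma cint_bound f x1 x2 y1 y2 (M : R) : x1 <= x2 -> y1 <= y2 -> bcont f x1 x2 y1 y2 ->
  (forall x y, x1 <= x <= x2 -> y1 <= y <= y2 -> [\/ x = x1, x = x2, y = y1 | y = y2] ->
     normc (f (x +i* y)) <= M) ->
  normc (cint f x1 x2 y1 y2) <= 4 * M * ((x2 - x1) + (y2 - y1)).
Proof.
move=> x12 y12 hf hM; apply: le_trans (normc_le_ReIm _) _; rewrite /= normrN.
have := rint_bound x12 y12 hf hM.
have := rint_bound x12 y12 (bcontZ 'i hf) (M := M).
have H x y : x1 <= x <= x2 -> y1 <= y <= y2 -> [\/ x = x1, x = x2, y = y1 | y = y2] ->
    normc ('i * f (x +i* y)) <= M.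
  by move=> hx hy bxy; rewrite normcM normc_i mul1r; exact: hM.
by move=> /(_ H); lra.
Qed.

Lemma bcont_inv_sub x1 x2 y1 y2 a b : x1 < a < x2 -> y1 < b < y2 ->
  bcont (fun w => (w - (a +i* b))^-1) x1 x2 y1 y2.
Proof.
move=> ha hb x y hx hy bxy; apply: cdiff_ccont.
apply: (@cdiffV _ (fun w => w - (a +i* b))); last first.
  by apply: cdiffB; [exact: cdiff_id|exact: cdiff_cst].
rewrite subr_eq0; apply/negP => /eqP[xE yE]; subst.
by case: bxy => E; rewrite E ltxx ?andbF in ha hb.
Qed.

(** The difference quotient, completed by the derivative [L] at the point, is continuous there and
    differentiable elsewhere, so its integral vanishes. The winding integral stays on the right as a
    factor. *)
Lemma cauchy_formula f x1 x2 y1 y2 a b : x1 < a < x2 -> y1 < b < y2 ->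
  (forall x y, x1 <= x <= x2 -> y1 <= y <= y2 -> cdiff_at f (x +i* y)) ->
  cint (fun w => f w * (w - (a +i* b))^-1) x1 x2 y1 y2 =
  f (a +i* b) * cint (fun w => (w - (a +i* b))^-1) x1 x2 y1 y2.
Proof.
move=> ha hb hd; set z := a +i* b.
have x12 : x1 <= x2 by case/andP: ha => h1 h2; exact: ltW (lt_trans h1 h2).
have y12 : y1 <= y2 by case/andP: hb => h1 h2; exact: ltW (lt_trans h1 h2).
have [L hL] : cdiff_at f z by apply: hd; rewrite !ltW//; [case/andP: ha|case/andP: ha|case/andP: hb|case/andP: hb].
pose g w := if w == z then L else (f w - f z) * (w - z)^-1.
have gd w : w != z -> cdiff_at f w -> cdiff_at g w.
  move=> wz fw; have d0 : 0 < normc (w - z) by rewrite normc_gt0 subr_eq0.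
  apply: (@cdiff_near _ (fun w => (f w - f z) * (w - z)^-1) _ _ _ d0).
    move=> w' h; rewrite /g; case: eqP => // w'z; move: h.
    by rewrite w'z normcC ltxx.
  apply: cdiffM; first by apply: cdiffB => //; exact: cdiff_cst.
  apply: (@cdiffV _ (fun w => w - z)); first by rewrite subr_eq0.
  by apply: cdiffB; [exact: cdiff_id|exact: cdiff_cst].
have gz : ccont_at g z.
  move=> e e0; have [|d d0 hd'] := hL (e / 2); first by rewrite divr_gt0.
  exists d => // w /hd'; rewrite /g eqxx; case: eqVneq => [->|wz].
    by move=> _; rewrite subrr normc0.
  have n0 : 0 < normc (w - z) by rewrite normc_gt0 subr_eq0.
  have -> : f w - f z - L * (w - z) = ((f w - f z) * (w - z)^-1 - L) * (w - z).
    by field; rewrite subr_eq0.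
  rewrite normcM ler_pM2r// => h; apply: le_lt_trans h _; lra.
have gc : rcont g x1 x2 y1 y2.
  move=> x y hx hy; have [->//|ne] := eqVneq (x +i* y) z.
  by apply/cdiff_ccont/gd => //; exact: hd.
have g0 : cint g x1 x2 y1 y2 = 0.
  rewrite /cint !(@goursat_punctured _ x1 x2 y1 y2 a b) ?oppr0//.
  - by move=> x y hx hy; apply: ccontM; [exact: rcont_cst hx hy|exact: gc].
  - move=> x y hx hy ne; apply: cdiffM; first exact: cdiff_cst.
    by apply: gd => //; exact: hd.
  - by move=> x y hx hy ne; apply: gd => //; exact: hd.
have bi := bcont_inv_sub ha hb.
have bf : bcont f x1 x2 y1 y2 by move=> x y hx hy _; apply/cdiff_ccont/hd.
rewrite -cintZ//.
transitivity (cint (fun w => g w + f z * (w - z)^-1) x1 x2 y1 y2).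
  apply: eq_cint => // x y hx hy bxy; rewrite /g; case: eqP => [[xE yE]|_]; last by ring.
  by subst; case: bxy => E; rewrite E ltxx ?andbF in ha hb.
rewrite cintD//; [by rewrite g0 add0r|exact: rcont_bcont|exact: bcontZ].
Qed.

(** The imaginary part is enough. Each side contributes the integral of [dist / |w - z|^2], where
    [dist] is its distance from [z]. The squared diagonal [D] bounds the denominator, and the
    distances to opposite sides add up to a full side length. *)
Lemma cint_inv_ge x1 x2 y1 y2 a b : x1 < a < x2 -> y1 < b < y2 ->
  2 * (x2 - x1) * (y2 - y1) / ((x2 - x1) ^+ 2 + (y2 - y1) ^+ 2) <=
  normc (cint (fun w => (w - (a +i* b))^-1) x1 x2 y1 y2).
Proof.
move=> ha hb; set z := a +i* b.
have x12 : x1 < x2 by case/andP: ha; exact: lt_trans.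
have y12 : y1 < y2 by case/andP: hb; exact: lt_trans.
have [x12' y12'] := (ltW x12, ltW y12).
have bi := bcontZ 'i (bcont_inv_sub ha hb).
have reE u v : complex.Re ('i * ((u +i* v) - z)^-1) = (v - b) / ((u - a) ^+ 2 + (v - b) ^+ 2).
  by rewrite /=; ring.
have imE u v : complex.Im ('i * ((u +i* v) - z)^-1) = (u - a) / ((u - a) ^+ 2 + (v - b) ^+ 2).
  by rewrite /=; ring.
set D := (x2 - x1) ^+ 2 + _; have D0 : 0 < D by rewrite addr_gt0// exprn_gt0// subr_gt0.
have sqb (s t c d : R) : s < t < d -> s <= c <= d -> (c - t) ^+ 2 <= (d - s) ^+ 2.
  move=> h1 h2; rewrite -[leLHS]real_normK ?num_real// ler_pXn2r// ?nnegrE//; last by lra.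
  by rewrite ler_norml; apply/andP; split; lra.
have nb u v : x1 <= u <= x2 -> y1 <= v <= y2 -> (u - a) ^+ 2 + (v - b) ^+ 2 <= D.
  by move=> hu hv; have := sqb _ _ _ _ ha hu; have := sqb _ _ _ _ hb hv; rewrite /D; lra.
have pos (c n : R) : 0 < c -> c ^+ 2 <= n -> n <= D -> c / D <= c / n.
  by move=> c0 cn nD; rewrite ler_pM2l// lef_pV2// posrE (lt_le_trans _ cn)// exprn_gt0.
have h1 := bcont_h bi y12' (or_introl erefl); have h2 := bcont_h bi y12' (or_intror erefl).
have h3 := bcont_v bi x12' (or_introl erefl); have h4 := bcont_v bi x12' (or_intror erefl).
have e1 : segint (fun u => complex.Re ('i * ((u +i* y1) - z)^-1)) x1 x2 <= - (b - y1) / D * (x2 - x1).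
  rewrite -segint_cst//; apply: le_segint => //; first exact: segcont_cst.
  move=> u hu; rewrite reE -[_ - b]opprB !mulNr lerN2 sqrrN; apply: pos; first by case/andP: hb; lra.
    by rewrite lerDr sqr_ge0.
  by rewrite -[b - _]opprB sqrrN; apply: nb => //; rewrite lexx.
have e2 : segint (fun u => complex.Re ('i * ((u +i* y2) - z)^-1)) x1 x2 >= (y2 - b) / D * (x2 - x1).
  rewrite -segint_cst//; apply: le_segint => //; first exact: segcont_cst.
  move=> u hu; rewrite reE; apply: pos; first by case/andP: hb; lra.
    by rewrite lerDr sqr_ge0.
  by apply: nb => //; rewrite lexx y12'.
have e3 : segint (fun v => complex.Im ('i * ((x1 +i* v) - z)^-1)) y1 y2 <= - (a - x1) / D * (y2 - y1).
  rewrite -segint_cst//; apply: le_segint => //; first exact: segcont_cst.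
  move=> u hu; rewrite imE -[_ - a]opprB !mulNr lerN2 sqrrN; apply: pos; first by case/andP: ha; lra.
    by rewrite lerDl sqr_ge0.
  by rewrite -[a - _]opprB sqrrN; apply: nb => //; rewrite lexx.
have e4 : segint (fun v => complex.Im ('i * ((x2 +i* v) - z)^-1)) y1 y2 >= (x2 - a) / D * (y2 - y1).
  rewrite -segint_cst//; apply: le_segint => //; first exact: segcont_cst.
  move=> u hu; rewrite imE; apply: pos; first by case/andP: ha; lra.
    by rewrite lerDl sqr_ge0.
  by apply: nb => //; rewrite lexx x12'.
apply: le_trans (normc_Im _); apply: le_trans (ler_norm _); rewrite /= /rint.
have -> : 2 * (x2 - x1) * (y2 - y1) / D =
   (b - y1) / D * (x2 - x1) + (y2 - b) / D * (x2 - x1) +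
   ((a - x1) / D * (y2 - y1) + (x2 - a) / D * (y2 - y1)).
  by field; rewrite gt_eqF.
move: e1 e2 e3 e4; rewrite !mulNr; lra.
Qed.

End cauchy.

(** * Point evaluations *)

Section lebesgue_affine.
Context (R : realType).
Local Notation mu := (@lebesgue_measure R).

Lemma measurable_affine (s c : R) :
  measurable_fun [set: measurableTypeR R] (fun x : measurableTypeR R => (s * x + c)%R : measurableTypeR R).
Proof.
by apply: measurable_funD => //; apply: measurable_funM.
Qed.

(** The pushforward of Lebesgue measure under the affine map, multiplied by [s], agrees with
    Lebesgue measure on half-open intervals and hence everywhere. *)
Lemma integral_affine (s c : R) (F : R -> \bar R) : 0 < s ->
  measurable_fun [set: measurableTypeR R] F -> (forall x, (0 <= F x)%E) ->
  (\int[mu]_x F (s * x + c)%R = (s^-1)%:E * \int[mu]_x F x)%E.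
Proof.
move=> s0 mF F0.
have mphi := measurable_affine s c.
have sV : 0 <= s^-1 by rewrite invr_ge0 ltW.
pose k := NngNum sV.
transitivity (\int[pushforward mu (fun x : measurableTypeR R => (s * x + c)%R : measurableTypeR R)]_x F x)%E.
  by rewrite ge0_integral_pushforward//.
transitivity (\int[mscale k mu]_x F x)%E; last by rewrite ge0_integral_mscale.
apply: eq_measure_integral => A mA _.
have sV0 : 0 <= s by rewrite ltW.
pose k' := NngNum sV0.
change (pushforward mu (fun x : measurableTypeR R => (s * x + c)%R : measurableTypeR R) A = (s^-1)%:E * mu A)%E.
have -> : mu A = mscale k' (pushforward mu (fun x : measurableTypeR R => (s * x + c)%R : measurableTypeR R)) A; last first.
  by rewrite /mscale /= muleA -EFinM mulVf ?mul1e// gt_eqF.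
move=> ?; apply: lebesgue_measure_unique => // _ [[a b]] _ <-.
pose J : set R := `](a - c) / s, (b - c) / s]%classic.
transitivity (s%:E * mu J)%E; last first.
  rewrite /mscale /= /pushforward; congr (_ * mu _)%E.
  rewrite /J; apply/seteqP; split=> x /=; rewrite !in_itv/= ltr_pdivrMr// ler_pdivlMr// => /andP[? ?];
    apply/andP; split; lra.
rewrite /J !lebesgue_measure_itv/= !lte_fin ltr_pM2r ?invr_gt0// ltrD2r.
case: ifP => _; last by rewrite mule0.
by rewrite -!EFinB -EFinM; congr EFin; field; rewrite gt_eqF.
Qed.

(** A function cannot stay above its mean. This is how sides of rectangles are selected on which an
    integral known only on average is controlled. *)
Lemma exists_small (F : R -> \bar R) (a b c : R) : a < b -> measurable_fun `[a, b] F ->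
  (forall x, (0 <= F x)%E) ->
  (\int[mu]_(x in `[a, b]) F x < (c * (b - a))%:E)%E -> exists2 x, a <= x <= b & (F x < c%:E)%E.
Proof.
move=> ab mF F0 hI; apply: contrapT => nex.
have hc x : a <= x <= b -> (c%:E <= F x)%E.
  by move=> hx; rewrite leNgt; apply/negP => h; apply: nex; exists x.
have c0 : 0 < c.
  rewrite -(@pmulr_lgt0 _ (b - a)) ?subr_gt0// -lte_fin; apply: le_lt_trans hI.
  exact: integral_ge0.
move: hI; rewrite ltNge => /negP; apply.
have -> : (c * (b - a))%:E = (\int[mu]_(x in `[a, b]) (cst c%:E x))%E.
  rewrite integral_cst//= lebesgue_measure_itv/= lte_fin ab -EFinB -EFinM//.
apply: ge0_le_integral => //.
  by move=> x _; rewrite lee_fin ltW.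
Qed.

End lebesgue_affine.

Section point_evaluation.
Context (R : realType).
Local Notation mu := (@lebesgue_measure R).
Implicit Types (f : R[i] -> R[i]) (alpha : R).

Definition hol0 f := (forall z, ~ halfplane z -> f z = 0) /\ holomorphic_on (@halfplane R) f.

Lemma hol0_cdiff f x y : hol0 f -> 0 < x -> cdiff_at f (x +i* y).
Proof. by move=> [_ hf] x0; apply: derivable_cdiff; exact: hf. Qed.

Definition sqabs f (p : R * R) : \bar R := (normc (f (p.1 +i* p.2)) ^+ 2)%:E.

Lemma sqabs_ge0 f p : (0 <= sqabs f p)%E.
Proof. by rewrite lee_fin sqr_ge0. Qed.

Lemma measurable_sqabs f : hol0 f -> measurable_fun setT (sqabs f).
Proof.
move=> [f0 hf]; apply/measurable_EFinP; apply: measurable_funX.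
have := measurable_bergman_weighted 0 f0 hf.
by congr (measurable_fun _ _); apply/funext => p; rewrite /bergman_weighted mul0r powRr0 mulr1.
Qed.

Lemma sqnormE alpha f : hol0 f ->
  bergman_sqnorm alpha f = (\int[mu \x mu]_p ((p.1 `^ alpha)%:E * sqabs f p))%E.
Proof.
move=> [f0 hf]; rewrite bergman_sqnormE//; apply: eq_integral => -[x y] _.
rewrite /sqabs /bergman_weighted -EFinM; congr EFin => /=; rewrite exprMn mulrC.
have [x0|x0] := ltP 0 x; last first.
  by rewrite f0 ?normc0 ?expr0n ?mulr0//; rewrite /halfplane /=; apply/negP; rewrite -leNgt.
by rewrite -powR_mulrn ?powR_ge0// -powRrM divfK.
Qed.

(** Extended-valued, since finiteness on an individual vertical line is not known in advance. *)
Definition slice f (x : R) : \bar R := (\int[mu]_y sqabs f (x, y))%E.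

Lemma slice_ge0 f x : (0 <= slice f x)%E.
Proof. by apply: integral_ge0 => y _; exact: sqabs_ge0. Qed.

Lemma measurable_slice f : hol0 f -> measurable_fun setT (slice f).
Proof.
move=> hf; apply: (@measurable_fun_fubini_tonelli_F _ _ _ _ _ mu (sqabs f)).
  exact: measurable_sqabs.
exact: sqabs_ge0.
Qed.

Lemma measurable_sqabs_section f x : hol0 f -> measurable_fun setT (fun y => sqabs f (x, y)).
Proof. by move=> /measurable_sqabs mf; apply: measurableT_comp mf _; exact: pair1_measurable. Qed.

Lemma measurable_sqabs_hsection f y : hol0 f -> measurable_fun setT (fun x => sqabs f (x, y)).
Proof. by move=> /measurable_sqabs mf; apply: measurableT_comp mf _; exact: pair2_measurable. Qed.

Lemma slice_le0 f x : hol0 f -> x <= 0 -> slice f x = 0%E.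
Proof.
move=> [f0 _] x0; apply: integral0_eq => y _; rewrite /sqabs f0 ?normc0 ?expr0n//.
by rewrite /halfplane /=; apply/negP; rewrite -leNgt.
Qed.

Lemma measurable_powRE alpha : measurable_fun setT (fun x : R => (x `^ alpha)%:E).
Proof. exact/measurable_EFinP. Qed.

Lemma sqnorm_slice alpha f : hol0 f ->
  bergman_sqnorm alpha f = (\int[mu]_x ((x `^ alpha)%:E * slice f x))%E.
Proof.
move=> hf; rewrite sqnormE//.
have ms := measurable_sqabs hf.
rewrite (@fubini_tonelli1 _ _ _ _ R mu mu (fun p => (p.1 `^ alpha)%:E * sqabs f p)%E)//.
- apply: eq_integral => x _; rewrite /fubini_F /= ge0_integralZl//.
  + exact: measurable_sqabs_section.
  + by move=> y _; exact: sqabs_ge0.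
  + by rewrite lee_fin powR_ge0.
- apply: emeasurable_funM; last exact: ms.
  apply/measurable_EFinP.
  exact: (@measurableT_comp _ _ _ _ _ _ (@powR R ^~ alpha)).
- by move=> p; rewrite mule_ge0 ?sqabs_ge0// lee_fin powR_ge0.
Qed.

Lemma ccont_hsq f x y : ccont_at f (x +i* y) ->
  {for x, continuous (fun t : R => normc (f (t +i* y)) ^+ 2)}.
Proof.
move=> hc; have h1 := ccont_hcont hc.
have h2 : {for x, continuous (fun t => complex.Im (f (t +i* y)))}.
  have hc' : ccont_at (fun z => - 'i * f z) (x +i* y).
    by apply: ccontM => //; apply: cdiff_ccont; exact: cdiff_cst.
  rewrite (_ : (fun t => _) = (fun t => complex.Re (- 'i * f (t +i* y)))); first exact: ccont_hcont hc'.
  by apply/funext => t; case: (f _) => u v /=; ring.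
have h3 : {for x, continuous (fun t : R => complex.Re (f (t +i* y)) * complex.Re (f (t +i* y)) +
    complex.Im (f (t +i* y)) * complex.Im (f (t +i* y)))}.
  by apply: continuousD; apply: continuousM.
rewrite (_ : (fun _ => _) = (fun t : R => complex.Re (f (t +i* y)) * complex.Re (f (t +i* y)) +
    complex.Im (f (t +i* y)) * complex.Im (f (t +i* y)))); first exact: h3.
by apply/funext => t; rewrite sqr_normc_ReIm !expr2.
Qed.

Lemma hol0_hcont f y : hol0 f -> forall a b, 0 < a ->
  segcont (fun x => normc (f (x +i* y)) ^+ 2) a b.
Proof.
move=> hf a b a0 x; rewrite in_itv/= => /andP[ax xb]; apply: ccont_hsq.
by apply: cdiff_ccont; apply: hol0_cdiff => //; exact: lt_le_trans ax.
Qed.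

Lemma hol0_vcont f x : hol0 f -> 0 < x -> forall a b,
  segcont (fun y => normc (f (x +i* y)) ^+ 2) a b.
Proof.
move=> hf x0 a b y; rewrite in_itv/= => /andP[ay yb].
have hc : ccont_at f (x +i* y) by apply: cdiff_ccont; exact: hol0_cdiff.
have h1 := ccont_vcont hc.
have h2 : {for y, continuous (fun t => complex.Re (f (x +i* t)))}.
  have hc' : ccont_at (fun z => 'i * f z) (x +i* y).
    by apply: ccontM => //; apply: cdiff_ccont; exact: cdiff_cst.
  rewrite (_ : (fun t => _) = (fun t => complex.Im ('i * f (x +i* t)))); first exact: ccont_vcont hc'.
  by apply/funext => t; case: (f _) => u v /=; ring.
have h3 : {for y, continuous (fun t : R => complex.Re (f (x +i* t)) * complex.Re (f (x +i* t)) +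
    complex.Im (f (x +i* t)) * complex.Im (f (x +i* t)))}.
  by apply: continuousD; apply: continuousM.
rewrite (_ : (fun _ => _) = (fun t : R => complex.Re (f (x +i* t)) * complex.Re (f (x +i* t)) +
    complex.Im (f (x +i* t)) * complex.Im (f (x +i* t)))); first exact: h3.
by apply/funext => t; rewrite sqr_normc_ReIm !expr2.
Qed.

(** Cauchy's formula is applied to [f ^+ 2], so that the boundary integrals are already those of
    [|f|^2]. The kernel is at most 4 on the sides, real and imaginary parts double this, and the
    winding integral is at least 1/4: this gives 32, within the 64 claimed. *)
Lemma eval_boundary f x1 x2 y1 y2 : hol0 f ->
  1 / 2 <= x1 <= 3 / 4 -> 5 / 4 <= x2 <= 3 / 2 -> - (1 / 2) <= y1 <= - (1 / 4) -> 1 / 4 <= y2 <= 1 / 2 ->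
  normc (f 1) ^+ 2 <= 64 *
    (segint (fun x => normc (f (x +i* y1)) ^+ 2) x1 x2 +
     segint (fun x => normc (f (x +i* y2)) ^+ 2) x1 x2 +
     (segint (fun y => normc (f (x1 +i* y)) ^+ 2) y1 y2 +
      segint (fun y => normc (f (x2 +i* y)) ^+ 2) y1 y2)).
Proof.
move=> hf hx1 hx2 hy1 hy2.
have h1 : x1 < 1 < x2 by apply/andP; split; lra.
have h0 : y1 < 0 < y2 by apply/andP; split; lra.
have x12 : x1 <= x2 by lra.
have y12 : y1 <= y2 by lra.
have x10 : 0 < x1 by lra.
have x20 : 0 < x2 by lra.
have fd x y : x1 <= x <= x2 -> y1 <= y <= y2 -> cdiff_at (fun z => f z ^+ 2) (x +i* y).
  by move=> hx hy; apply: cdiffX; apply: hol0_cdiff => //; lra.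
have C := cauchy_formula h1 h0 fd.
have J := cint_inv_ge h1 h0.
have {}J : 1 / 4 <= normc (cint (fun w => (w - (1 +i* 0))^-1) x1 x2 y1 y2).
  apply: le_trans J; rewrite ler_pdivlMr ?addr_gt0 ?exprn_gt0 ?subr_gt0//; [|lra..].
  have : 1 / 2 <= x2 - x1 <= 1 by apply/andP; split; lra.
  have : 1 / 2 <= y2 - y1 <= 1 by apply/andP; split; lra.
  move: (x2 - x1) (y2 - y1) => u v /andP[? ?] /andP[? ?]; nra.
set g := (fun w : R[i] => f w ^+ 2 * (w - (1 +i* 0))^-1) in C.
have bg : bcont g x1 x2 y1 y2.
  apply: bcontM; last exact: bcont_inv_sub.
  by move=> x y hx hy _; exact/cdiff_ccont/fd.
have gb x y : x1 <= x <= x2 -> y1 <= y <= y2 -> [\/ x = x1, x = x2, y = y1 | y = y2] ->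
    normc (g (x +i* y)) <= 4 * normc (f (x +i* y)) ^+ 2.
  move=> hx hy bxy; rewrite /g normcM normcX normcV mulrC ler_wpM2r ?sqr_ge0//.
  rewrite -[4](invrK (4 : R)) lef_pV2 ?posrE//; last first.
    rewrite normc_gt0 subr_eq0; apply/negP => /eqP[xE yE]; subst.
    by case: bxy => E; move: h1 h0; rewrite E ?ltxx ?andbF.
  have [h|h] : 4^-1 <= `|x - 1| \/ 4^-1 <= `|y|.
    case: bxy => ->; [left; rewrite distrC ger0_norm; lra|left; rewrite ger0_norm; lra
      |right; rewrite ler0_norm; lra|right; rewrite ger0_norm; lra].
  - apply: le_trans h _; exact: (normc_Re ((x +i* y) - (1 +i* 0))).
  - apply: le_trans h _; have := (normc_Im ((x +i* y) - (1 +i* 0))).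
    by rewrite /= subr0.
have i1 : bcont (fun z => 'i * g z) x1 x2 y1 y2 by exact: bcontZ.
have side (h : R[i] -> R[i]) : bcont h x1 x2 y1 y2 -> 
    (forall x y, x1 <= x <= x2 -> y1 <= y <= y2 -> [\/ x = x1, x = x2, y = y1 | y = y2] ->
      normc (h (x +i* y)) <= 4 * normc (f (x +i* y)) ^+ 2) ->
    `|rint h x1 x2 y1 y2| <= 4 * 
    (segint (fun x => normc (f (x +i* y1)) ^+ 2) x1 x2 +
     segint (fun x => normc (f (x +i* y2)) ^+ 2) x1 x2 +
     (segint (fun y => normc (f (x1 +i* y)) ^+ 2) y1 y2 +
      segint (fun y => normc (f (x2 +i* y)) ^+ 2) y1 y2)).
  move=> bh hb.
  have H y : y = y1 \/ y = y2 -> `|segint (fun x => complex.Re (h (x +i* y))) x1 x2| <=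
      4 * segint (fun x => normc (f (x +i* y)) ^+ 2) x1 x2.
    move=> hy; have c1 := bcont_h bh y12 hy.
    have c2 := @hol0_hcont f y hf x1 x2 x10.
    have c3 : segcont (fun x => 4 * normc (f (x +i* y)) ^+ 2) x1 x2.
      exact: segcontZ.
    have hb' x : x1 <= x <= x2 -> `|complex.Re (h (x +i* y))| <= 4 * normc (f (x +i* y)) ^+ 2.
      move=> hx; apply: le_trans (normc_Re _) (hb _ _ hx _ _).
        by case: hy => ->; rewrite lexx y12.
      by case: hy => ->; [constructor 3|constructor 4].
    rewrite -segintZ// ler_norml; apply/andP; split; last first.
      by apply: le_segint => // x /hb'; rewrite ler_norml => /andP[].
    rewrite -mulN1r -segintZ//; apply: le_segint => //.
      exact: segcontZ.
    by move=> x /hb'; rewrite ler_norml mulN1r => /andP[].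
  have V x : x = x1 \/ x = x2 -> `|segint (fun y => complex.Im (h (x +i* y))) y1 y2| <=
      4 * segint (fun y => normc (f (x +i* y)) ^+ 2) y1 y2.
    move=> hx; have c1 := bcont_v bh x12 hx.
    have x0 : 0 < x by case: hx => ->.
    have c2 := @hol0_vcont f x hf x0 y1 y2.
    have c3 : segcont (fun y => 4 * normc (f (x +i* y)) ^+ 2) y1 y2.
      exact: segcontZ.
    have hb' y : y1 <= y <= y2 -> `|complex.Im (h (x +i* y))| <= 4 * normc (f (x +i* y)) ^+ 2.
      move=> hy; apply: le_trans (normc_Im _) (hb _ _ _ hy _).
        by case: hx => ->; rewrite lexx x12.
      by case: hx => ->; [constructor 1|constructor 2].
    rewrite -segintZ// ler_norml; apply/andP; split; last first.
      by apply: le_segint => // y /hb'; rewrite ler_norml => /andP[].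
    rewrite -mulN1r -segintZ//; apply: le_segint => //.
      exact: segcontZ.
    by move=> y /hb'; rewrite ler_norml mulN1r => /andP[].
  have := H _ (or_introl erefl); have := H _ (or_intror erefl).
  have := V _ (or_introl erefl); have := V _ (or_intror erefl).
  rewrite /rint; clear; move: (segint _ _ _) (segint _ _ _) (segint _ _ _) (segint _ _ _).
  move=> a1 a2 a3 a4; move: (segint _ _ _) (segint _ _ _) (segint _ _ _) (segint _ _ _).
  move=> b1 b2 b3 b4; rewrite !ler_norml => /andP[? ?] /andP[? ?] /andP[? ?] /andP[? ?].
  by apply/andP; split; lra.
have r1 := side _ bg gb.
have gb' x y : x1 <= x <= x2 -> y1 <= y <= y2 -> [\/ x = x1, x = x2, y = y1 | y = y2] ->
    normc ('i * g (x +i* y)) <= 4 * normc (f (x +i* y)) ^+ 2.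
  by move=> hx hy bxy; rewrite normcM normc_i mul1r; exact: gb.
have r2 := side _ i1 gb'.
have := normc_le_ReIm (cint g x1 x2 y1 y2); rewrite [X in _ <= X -> _]/= normrN C normcM normcX.
have -> : (1 +i* 0 : R[i]) = 1 by [].
have := mulr_ge0 (sqr_ge0 (normc (f 1))) (normc_ge0 (cint (fun w => (w - 1)^-1) x1 x2 y1 y2)).
have := ler_wpM2l (sqr_ge0 (normc (f 1))) J.
move: r1 r2; clear; lra.
Qed.

Lemma EFin_segint (g : R -> R) a b : segcont g a b ->
  ((segint g a b)%:E = \int[mu]_(x in `[a, b]) (g x)%:E)%E.
Proof. by move=> /segcont_integrable hg; rewrite fineK//; exact: integrable_fin_num. Qed.

Definition hslice alpha f (y : R) : \bar R :=
  (\int[mu]_x ((x `^ alpha)%:E * sqabs f (x, y)))%E.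

Lemma measurable_weighted_sqabs alpha f : hol0 f ->
  measurable_fun setT (fun p : R * R => (p.1 `^ alpha)%:E * sqabs f p)%E.
Proof.
move=> /measurable_sqabs ms.
apply: emeasurable_funM; last exact: ms.
apply/measurable_EFinP.
exact: (@measurableT_comp _ _ _ _ _ _ (@powR R ^~ alpha)).
Qed.

Lemma weighted_sqabs_ge0 alpha f (p : R * R) : (0 <= (p.1 `^ alpha)%:E * sqabs f p)%E.
Proof. by rewrite mule_ge0 ?sqabs_ge0// lee_fin powR_ge0. Qed.

Lemma sqnorm_hslice alpha f : hol0 f ->
  bergman_sqnorm alpha f = (\int[mu]_y hslice alpha f y)%E.
Proof.
move=> hf; rewrite sqnormE//.
rewrite (@fubini_tonelli2 _ _ _ _ R mu mu (fun p => (p.1 `^ alpha)%:E * sqabs f p)%E)//.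
  exact: measurable_weighted_sqabs.
by move=> p; exact: weighted_sqabs_ge0.
Qed.

Lemma measurable_hslice alpha f : hol0 f -> measurable_fun setT (hslice alpha f).
Proof.
move=> hf; apply: (@measurable_fun_fubini_tonelli_G _ _ _ _ _ mu (fun p => (p.1 `^ alpha)%:E * sqabs f p)%E).
  exact: measurable_weighted_sqabs.
by move=> p; exact: weighted_sqabs_ge0.
Qed.

Lemma hslice_ge0 alpha f y : (0 <= hslice alpha f y)%E.
Proof. by apply: integral_ge0 => x _; exact: (weighted_sqabs_ge0 _ _ (x, y)). Qed.

(** The weight is bounded below on a compact interval by its value at one end, which end depending
    on the sign of [alpha]; adding the two inverses serves both signs. *)
Lemma powR_lower alpha (a b : R) : 0 < a -> 0 < b ->
  exists2 C : R, 0 < C & forall x, a <= x <= b -> 1 <= C * x `^ alpha.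
Proof.
move=> a0 b0.
have h (t : R) : 0 < t -> 0 < (t `^ alpha)^-1 by move=> t0; rewrite invr_gt0 powR_gt0.
exists ((a `^ alpha)^-1 + (b `^ alpha)^-1); first by rewrite addr_gt0// h.
move=> x /andP[x1 x2]; have x0 : 0 < x by exact: lt_le_trans x1.
rewrite mulrDl; have [al0|al0] := leP 0 alpha.
  apply: (@le_trans _ _ ((a `^ alpha)^-1 * x `^ alpha)); last first.
    by rewrite lerDl mulr_ge0 ?powR_ge0// ltW// h.
  rewrite mulrC ler_pdivlMr ?powR_gt0// mul1r.
  by apply: ge0_ler_powR => //; rewrite nnegrE ltW.
apply: (@le_trans _ _ ((b `^ alpha)^-1 * x `^ alpha)); last first.
  by rewrite lerDr mulr_ge0 ?powR_ge0// ltW// h.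
have E (t : R) : t `^ alpha = (t `^ (- alpha))^-1 by rewrite -powRN opprK.
rewrite !E invrK ler_pdivlMr ?powR_gt0// mul1r.
apply: ge0_ler_powR => //; rewrite ?nnegrE ?oppr_ge0; exact: ltW.
Qed.

(** Both orders of integration are used: vertical sides are chosen where [slice] is small and
    horizontal sides where [hslice] is, each within a range that keeps the rectangle around 1 and
    away from the imaginary axis. *)
Lemma eval_at1 alpha : exists2 C : R, 0 < C &
  forall f, hol0 f -> (((normc (f 1)) ^+ 2)%:E <= C%:E * bergman_sqnorm alpha f)%E.
Proof.
have [p1 p2] : 0 < 1 / 2 :> R /\ 0 < 3 / 2 :> R by split; lra.
have [C C0 hC] := powR_lower alpha p1 p2; move: p1 p2 => _ _.
(* 2048 is 64 from the boundary estimate, times four sides, times 8 for choosing each side by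
   averaging over an interval of length 1/4. *)
pose K : R := 2048 * C.
have K0 : 0 < K by rewrite /K; lra.
exists K => // f hf.
have q0 := bergman_sqnorm_ge0 alpha f.
have [->|qoo] := eqVneq (bergman_sqnorm alpha f) +oo%E.
  by rewrite gt0_muley ?lte_fin// leey.
have qfin : bergman_sqnorm alpha f \is a fin_num by rewrite ge0_fin_numE// lt_neqAle qoo leey.
move: qfin q0 => /fineK <-; set q := fine _; rewrite lee_fin => q0.
have qE : bergman_sqnorm alpha f = q%:E.
  by rewrite fineK// ge0_fin_numE ?bergman_sqnorm_ge0// lt_neqAle qoo leey.
rewrite -EFinM lee_fin; apply/ler_addgt0Pr => e e0.
(* Keeps the averages strictly below their thresholds even when [q = 0]. *)
pose e' := e / K; have e'0 : 0 < e' by rewrite divr_gt0.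
have Iv a b : 1 / 2 <= a -> b <= 3 / 2 -> (\int[mu]_(x in `[a, b]) slice f x <= (C * q)%:E)%E.
  move=> ha hb; rewrite EFinM -qE sqnorm_slice//.
  have m1 : measurable_fun setT (fun x : R => (x `^ alpha)%:E * slice f x)%E.
    apply: emeasurable_funM; [exact: measurable_powRE|exact: measurable_slice].
  have n1 (x : R) : (0 <= (x `^ alpha)%:E * slice f x)%E.
    by rewrite mule_ge0 ?slice_ge0// lee_fin powR_ge0.
  rewrite -ge0_integralZl//; last by rewrite lee_fin ltW.
  apply: (@le_trans _ _ (\int[mu]_(x in `[a, b]) (C%:E * ((x `^ alpha)%:E * slice f x)))%E).
    apply: ge0_le_integral => //.
    - by move=> x _; exact: slice_ge0.
    - by apply: measurable_funTS; exact: measurable_slice.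
    - by apply: measurable_funTS; apply: measurable_funeM.
    - move=> x /=; rewrite in_itv/= => /andP[ax xb].
      rewrite muleA -EFinM -[leLHS]mul1e lee_wpmul2r ?slice_ge0// lee_fin hC//.
      by rewrite (le_trans ha ax) (le_trans xb hb).
  apply: ge0_subset_integral => //; first exact: measurable_funeM.
  by move=> x _; rewrite mule_ge0// lee_fin ltW.
have Ih a b : (\int[mu]_(y in `[a, b]) hslice alpha f y <= q%:E)%E.
  rewrite -qE sqnorm_hslice//; apply: ge0_subset_integral => //; first exact: measurable_hslice.
  by move=> y _; exact: hslice_ge0.
have ms : measurable_fun setT (slice f) by exact: measurable_slice.
have mh : measurable_fun setT (hslice alpha f) by exact: measurable_hslice.
have Vx a b : 1 / 2 <= a -> b <= 3 / 2 -> b - a = 1 / 4 ->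
    exists2 x, a <= x <= b & (slice f x < (8 * C * (q + e'))%:E)%E.
  move=> ha hb ab; apply: exists_small; [by lra|exact: measurable_funTS|exact: slice_ge0|].
  apply: le_lt_trans (Iv _ _ ha hb) _; rewrite lte_fin ab.
  have := mulr_gt0 C0 e'0; have := mulr_ge0 (ltW C0) q0; lra.
have Hy a b : b - a = 1 / 4 -> exists2 y, a <= y <= b & (hslice alpha f y < (8 * (q + e'))%:E)%E.
  move=> ab; apply: exists_small; [by lra|exact: measurable_funTS|exact: hslice_ge0|].
  by apply: le_lt_trans (Ih _ _) _; rewrite lte_fin ab; lra.
have [|||x1 hx1 sx1] := Vx (1 / 2) (3 / 4); [lra|lra|lra|].
have [|||x2 hx2 sx2] := Vx (5 / 4) (3 / 2); [lra|lra|lra|].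
have [|y1 hy1 sy1] := Hy (- (1 / 2)) (- (1 / 4)); first by lra.
have [|y2 hy2 sy2] := Hy (1 / 4) (1 / 2); first by lra.
have := eval_boundary hf hx1 hx2 hy1 hy2.
have v x : 0 < x -> (slice f x < (8 * C * (q + e'))%:E)%E ->
    segint (fun y => normc (f (x +i* y)) ^+ 2) y1 y2 <= 8 * C * (q + e').
  move=> x0 sx; rewrite -lee_fin EFin_segint; last exact: hol0_vcont.
  apply: le_trans (ltW sx); apply: ge0_subset_integral => //.
    exact: measurable_sqabs_section.
  by move=> y _; rewrite lee_fin sqr_ge0.
have h y : (hslice alpha f y < (8 * (q + e'))%:E)%E ->
    segint (fun x => normc (f (x +i* y)) ^+ 2) x1 x2 <= C * (8 * (q + e')).
  move=> sx; rewrite -lee_fin EFin_segint; last by apply: hol0_hcont => //; lra.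
  have m1 : measurable_fun setT (fun x : R => (x `^ alpha)%:E * sqabs f (x, y))%E.
    by apply: emeasurable_funM; [exact: measurable_powRE|exact: measurable_sqabs_hsection].
  have n1 (x : R) : (0 <= (x `^ alpha)%:E * sqabs f (x, y))%E by exact: (weighted_sqabs_ge0 _ _ (x, y)).
  apply: (@le_trans _ _ (C%:E * hslice alpha f y)%E); last first.
    by rewrite EFinM lee_wpmul2l ?lee_fin ?ltW.
  rewrite -ge0_integralZl//; last by rewrite lee_fin ltW.
  apply: (@le_trans _ _ (\int[mu]_(x in `[x1, x2]) (C%:E * ((x `^ alpha)%:E * sqabs f (x, y))))%E).
    apply: ge0_le_integral => //.
    - by move=> x _; exact: (sqabs_ge0 f (x, y)).
    - by apply: measurable_funTS; exact: measurable_sqabs_hsection.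
    - by apply: measurable_funTS; apply: measurable_funeM.
    - move=> x /=; rewrite in_itv/= => /andP[ax xb].
      rewrite /sqabs -!EFinM lee_fin /= mulrA -[leLHS]mul1r ler_wpM2r ?sqr_ge0// hC//.
      by apply/andP; split; lra.
  apply: ge0_subset_integral => //; first exact: measurable_funeM.
  by move=> x _; rewrite mule_ge0// lee_fin ltW.
have := v _ _ sx1; have := v _ _ sx2; have := h _ sy1; have := h _ sy2.
have -> : K * q + e = K * (q + e') by rewrite /e'; field; rewrite gt_eqF.
move=> h2 h1 v2 v1 hb; apply: le_trans hb _; rewrite /K.
have p1 : 0 < x1 by lra.
have p2 : 0 < x2 by lra.
move: (v1 p1) (v2 p2) => {}v1 {}v2.
lra.
Qed.

End point_evaluation.

(** * The Gram identity *)

Section affine_composition.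
Context (R : realType).
Local Notation mu := (@lebesgue_measure R).
Implicit Types (f : R[i] -> R[i]) (alpha a : R) (b : R[i]).

(** The composition as a bare function; [composition_op] can be identified with it only once the
    norm is known to be finite. *)
Definition acomp a b f : R[i] -> R[i] :=
  fun z => if 0 < complex.Re z then f (affine_symbol a b z) else 0.

Lemma affine_symbolE a b x y :
  affine_symbol a b (x +i* y) = (a * x + complex.Re b) +i* (a * y + complex.Im b).
Proof. by rewrite /affine_symbol; case: b => c d; simpc. Qed.

Lemma hol0_acomp a b f : 0 < a -> 0 <= complex.Re b -> hol0 f -> hol0 (acomp a b f).
Proof.
move=> a0 b0 hf; split=> [z|[x y]].
  by rewrite /halfplane /= /acomp; case: ifP.
rewrite /halfplane /= => x0; apply: cdiff_derivable.
apply: (@cdiff_near _ (fun z => f (affine_symbol a b z)) _ _ x x0).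
  move=> [u v] h; rewrite /acomp /= ifT//.
  have := le_lt_trans (normc_Re _) h; rewrite /= ltr_norml; lra.
apply: cdiff_affine; have := affine_symbolE a b x y; rewrite /affine_symbol => ->.
by apply: hol0_cdiff => //; rewrite ltr_pwDl// mulr_gt0.
Qed.

Lemma slice_acomp a b f x : 0 < a -> hol0 f -> 0 < x ->
  slice (acomp a b f) x = ((a^-1)%:E * slice f (a * x + complex.Re b))%E.
Proof.
move=> a0 hf x0; rewrite /slice.
rewrite -(@integral_affine _ a (complex.Im b) (fun y => sqabs f (a * x + complex.Re b, y)))//.
- by apply: eq_integral => y _; rewrite /sqabs /acomp /= x0 affine_symbolE.
- exact: measurable_sqabs_section.
- by move=> y; exact: sqabs_ge0.
Qed.

Lemma integral_reflect (c : R) (F : R -> \bar R) :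
  measurable_fun [set: measurableTypeR R] F -> (forall x, (0 <= F x)%E) ->
  (\int[mu]_x F (c - x)%R = \int[mu]_x F x)%E.
Proof.
move=> mF F0.
have mN : measurable_fun [set: measurableTypeR R] (-%R : measurableTypeR R -> measurableTypeR R).
  exact: oppr_measurable.
transitivity (\int[mu]_x F (1 * x + c)%R)%E; last first.
  by rewrite integral_affine// invr1 mul1e.
transitivity (\int[pushforward mu (-%R : measurableTypeR R -> measurableTypeR R)]_x F (1 * x + c)%R)%E.
  rewrite ge0_integral_pushforward//.
    by apply: eq_integral => x _ /=; rewrite mul1r addrC.
  by apply: measurableT_comp mF _; exact: measurable_affine.
by apply: eq_measure_integral => A mA _; exact: lebesgue_measureN.
Qed.

Lemma mem_segment (a b x : R) : (x \in [set` `[a, b]]) = (a <= x <= b).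
Proof. by apply/idP/idP; rewrite inE /= in_itv. Qed.

Lemma integral_shift_itv (c a b : R) (F : R -> \bar R) :
  measurable_fun [set: measurableTypeR R] F -> (forall x, (0 <= F x)%E) ->
  (\int[mu]_(u in `[a, b]) F (c + u)%R = \int[mu]_(x in `[(c + a)%R, (c + b)%R]) F x)%E.
Proof.
move=> mF F0; rewrite integral_mkcond [RHS]integral_mkcond.
rewrite -[RHS]mul1e -[in X in (X%:E * _)%E]invr1 -(@integral_affine _ 1 c)//.
- by apply: eq_integral => u _; rewrite !patchE mul1r addrC !mem_segment [c + a]addrC [c + b]addrC !lerD2r.
- by apply/(measurable_restrictT _ _).1 => //; exact: measurable_funTS.
- by move=> x; rewrite patchE; case: ifP.
Qed.

Lemma integral_reflect_itv (c a b : R) (F : R -> \bar R) :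
  measurable_fun [set: measurableTypeR R] F -> (forall x, (0 <= F x)%E) ->
  (\int[mu]_(u in `[a, b]) F (c - u)%R = \int[mu]_(x in `[(c - b)%R, (c - a)%R]) F x)%E.
Proof.
move=> mF F0; rewrite integral_mkcond [RHS]integral_mkcond.
rewrite -[RHS](integral_reflect c)//.
- by apply: eq_integral => u _; rewrite !patchE !mem_segment !lerD2l !lerN2 andbC.
- by apply/(measurable_restrictT _ _).1 => //; exact: measurable_funTS.
- by move=> x; rewrite patchE; case: ifP.
Qed.

(** The segments may be chosen freely as long as they contain [[-N, N]]: Cauchy's theorem will give
    a comparison only between heights where the horizontal sides are negligible, and only up to a
    small error. *)
Lemma integral_le_of_segs (A B : R -> R) :
  measurable_fun setT A -> measurable_fun setT B -> (forall x, 0 <= A x) -> (forall x, 0 <= B x) ->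
  (forall (e N : R), 0 < e -> exists Y1 Y2, [/\ Y1 <= - N, N <= Y2 &
    (\int[mu]_(x in `[Y1, Y2]) (A x)%:E <= \int[mu]_(x in `[Y1, Y2]) (B x)%:E + e%:E)%E]) ->
  (\int[mu]_x (A x)%:E <= \int[mu]_x (B x)%:E)%E.
Proof.
move=> mA mB A0 B0 h.
have mA' : measurable_fun setT (EFin \o A) by exact/measurable_EFinP.
have mB' : measurable_fun setT (EFin \o B) by exact/measurable_EFinP.
apply/lee_addgt0Pr => e e0.
pose F (n : nat) : set R := `[- n%:R, n%:R]%classic.
have FT : \bigcup_n F n = setT.
  apply/seteqP; split=> // x _; exists (Num.truncn `|x|).+1 => //.
  rewrite /F /= in_itv/= -ler_norml; exact: ltW (truncnS_gt _).
rewrite -FT.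
have cv : (\int[mu]_(x in F i) (A x)%:E)%E @[i --> \oo] --> (\int[mu]_(x in \bigcup_i F i) (A x)%:E)%E.
  apply: ge0_nondecreasing_set_cvg_integral => //.
  - move=> n m nm; apply/subsetPset; rewrite /F; apply: subset_itv; rewrite bnd_simp ?lerN2 ler_nat//.
  - by move=> n; exact: measurable_itv.
  - by move=> n; exact: measurable_funTS.
  - by move=> n x _; rewrite lee_fin.
have := cvg_lim (@ereal_hausdorff R) cv => <-.
apply: lime_le; first by apply/cvg_ex; eexists; exact: cv.
apply: nearW => n.
have [Y1 [Y2 [hY1 hY2 hY]]] := h e n%:R e0.
apply: (@le_trans _ _ (\int[mu]_(x in `[Y1, Y2]) (A x)%:E)%E).
  apply: ge0_subset_integral => //.
  - exact: measurable_itv.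
  - exact: measurable_funTS.
  - by move=> x _; rewrite lee_fin.
  - by rewrite /F; apply: subset_itv; rewrite bnd_simp.
apply: le_trans hY _; rewrite leeD2r// FT.
apply: ge0_subset_integral => //.
by move=> x _; rewrite lee_fin.
Qed.

End affine_composition.

(** * Cauchy's theorem on a strip *)

Section strip.
Context (R : realType).
Local Notation mu := (@lebesgue_measure R).
Implicit Types (f : R[i] -> R[i]) (alpha : R).

Lemma segint_hslice alpha f (a b : R) : hol0 f -> 0 < a -> 0 < b ->
  exists2 C : R, 0 < C & forall y x1 x2, a <= x1 -> x2 <= b ->
    ((segint (fun x => normc (f (x +i* y)) ^+ 2) x1 x2)%:E <= C%:E * hslice alpha f y)%E.
Proof.
move=> hf a0 b0; have [C C0 hC] := powR_lower alpha a0 b0.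
exists C => // y x1 x2 hx1 hx2.
rewrite EFin_segint; last by apply: hol0_hcont => //; exact: lt_le_trans hx1.
have m1 : measurable_fun setT (fun x : R => (x `^ alpha)%:E * sqabs f (x, y))%E.
  by apply: emeasurable_funM; [exact: measurable_powRE|exact: measurable_sqabs_hsection].
have n1 (x : R) : (0 <= (x `^ alpha)%:E * sqabs f (x, y))%E by exact: (weighted_sqabs_ge0 _ _ (x, y)).
rewrite -ge0_integralZl//; last by rewrite lee_fin ltW.
apply: (@le_trans _ _ (\int[mu]_(x in `[x1, x2]) (C%:E * ((x `^ alpha)%:E * sqabs f (x, y))))%E).
  apply: ge0_le_integral => //.
  - by move=> x _; exact: (sqabs_ge0 f (x, y)).
  - by apply: measurable_funTS; exact: measurable_sqabs_hsection.
  - by apply: measurable_funTS; apply: measurable_funeM.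
  - move=> x /=; rewrite in_itv/= => /andP[ax xb].
    rewrite /sqabs -!EFinM lee_fin /= mulrA -[leLHS]mul1r ler_wpM2r ?sqr_ge0// hC//.
    by rewrite (le_trans hx1 ax) (le_trans xb hx2).
apply: ge0_subset_integral => //; first exact: measurable_funeM.
by move=> x _; rewrite mule_ge0// lee_fin ltW.
Qed.

(** The horizontal slices have a finite integral over all heights, so on an interval of length [L]
    their mean falls below [e]; one such interval is taken beyond each of [-N] and [N]. *)
Lemma exists_small_hslice alpha f (N e : R) : hol0 f -> (bergman_sqnorm alpha f < +oo)%E -> 0 < e ->
  exists y1 y2, [/\ y1 <= - N, N <= y2, (hslice alpha f y1 < e%:E)%E & (hslice alpha f y2 < e%:E)%E].
Proof.
move=> hf ff e0.
have mh : measurable_fun setT (hslice alpha f) by exact: measurable_hslice.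
have q0 := bergman_sqnorm_ge0 alpha f.
have qE : bergman_sqnorm alpha f = (fine (bergman_sqnorm alpha f))%:E by rewrite fineK// ge0_fin_numE.
set q := fine _ in qE.
pose L := (`|q| + 1) / e; have L0 : 0 < L by rewrite divr_gt0// ltr_wpDl.
have Ih a b : (\int[mu]_(y in `[a, b]) hslice alpha f y <= q%:E)%E.
  rewrite -qE sqnorm_hslice//; apply: ge0_subset_integral => //.
  by move=> y _; exact: hslice_ge0.
have P a b : b - a = L -> exists2 y, a <= y <= b & (hslice alpha f y < e%:E)%E.
  move=> ab; apply: exists_small; [by lra|exact: measurable_funTS|exact: hslice_ge0|].
  apply: le_lt_trans (Ih _ _) _; rewrite lte_fin ab /L mulrCA divff ?gt_eqF// mulr1.
  by rewrite (le_lt_trans (ler_norm _))// ltrDl.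
have [|y1 /andP[h1 h2] h3] := P (- N - L) (- N); first by lra.
have [|y2 /andP[g1 g2] g3] := P N (N + L); first by lra.
by exists y1, y2.
Qed.

(* Cauchy's theorem for [f (x + t + z) * conj (f (x + t - conj z))] on a tall rectangle. *)
Lemma strip_identity alpha f (x t : R) : hol0 f -> (bergman_sqnorm alpha f < +oo)%E -> 0 < x -> 0 < t ->
  forall e N : R, 0 < e -> exists Y1 Y2, [/\ Y1 <= - N, N <= Y2, Y1 <= Y2 &
    `|segint (fun v => normc (f ((x + t) +i* v)) ^+ 2) Y1 Y2 -
      segint (fun v => complex.Re (f ((x + t + t) +i* v) * conjc (f (x +i* v)))) Y1 Y2| <= e].
Proof.
move=> hf ff x0 t0 e N e0.
have xt0 : 0 < x + t by rewrite addr_gt0.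
have xtt0 : 0 < x + t + t by rewrite addr_gt0.
have [C C0 hC] := segint_hslice alpha hf x0 xtt0.
have e'0 : 0 < e / (2 * C) by rewrite divr_gt0// mulr_gt0.
have [Y1 [Y2 [hY1 hY2 hs1 hs2]]] := exists_small_hslice `|N| hf ff e'0.
have Y12 : Y1 <= Y2.
  by apply: le_trans hY1 _; apply: le_trans hY2; apply: le_trans (normr_ge0 N); rewrite oppr_le0.
exists Y1, Y2; split=> //.
- by apply: le_trans hY1 _; rewrite lerN2 ler_norm.
- by apply: le_trans hY2; exact: ler_norm.
(* On [Re z = 0] the second factor is the conjugate of the first and [h] is [|f|^2] on the middle
   line; on [Re z = t] it pairs the two outer lines. *)
pose h (z : R[i]) := f (1 * z + (x + t)%:C) * conjc (f ((x + t)%:C - conjc z)).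
pose h1 (z : R[i]) := f (1 * z + (x + t)%:C).
pose h2 (z : R[i]) := conjc (f ((x + t)%:C - conjc z)).
have h1E u v : h1 (u +i* v) = f ((x + t + u) +i* v).
  by rewrite /h1 mul1r; congr f; simpc; rewrite [in LHS]addrC.
have h2E u v : h2 (u +i* v) = conjc (f ((x + t - u) +i* v)).
  by congr (conjc (f _)); apply/eqP; rewrite eq_complex /= add0r opprK !eqxx.
have hd1 u v : 0 <= u <= t -> cdiff_at h1 (u +i* v).
  move=> /andP[u0 ut]; apply: cdiff_affine; rewrite mul1r.
  have -> : u +i* v + (x + t)%:C = (u + (x + t)) +i* v by simpc.
  by apply: hol0_cdiff => //; lra.
have hd2 u v : 0 <= u <= t -> cdiff_at h2 (u +i* v).
  move=> /andP[u0 ut]; apply: cdiff_conj.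
  have -> : (x + t)%:C - conjc (u +i* v) = (x + t - u) +i* v.
    by apply/eqP; rewrite eq_complex /= add0r opprK !eqxx.
  by apply: hol0_cdiff => //; lra.
have hE u v : h (u +i* v) = f ((x + t + u) +i* v) * conjc (f ((x + t - u) +i* v)).
  by rewrite -h1E -h2E.
(* The factor ['i] is there because [rint] takes imaginary parts on vertical sides, where the real
   part of [h] is wanted. *)
have hd u v : 0 <= u <= t -> cdiff_at (fun z => 'i * h z) (u +i* v).
  by move=> hu; apply: cdiffM; [exact: cdiff_cst|apply: cdiffM; [exact: hd1|exact: hd2]].
have t0' := ltW t0.
have G : rint (fun z => 'i * h z) 0 t Y1 Y2 = 0.
  by apply: goursat => // u v hu hv; exact: hd.
(* On a horizontal side [2 |h|] is at most the sum of [|f|^2] at the two reflected points, and each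
   of these integrates to at most [C] times the horizontal slice at height [y]. *)
have bound y : (hslice alpha f y < (e / (2 * C))%:E)%E ->
    `|segint (fun u => complex.Re ('i * h (u +i* y))) 0 t| <= e / 2.
  move=> hy.
  have c0 : segcont (fun u => complex.Re ('i * h (u +i* y))) 0 t.
    by move=> u; rewrite in_itv/= => hu; apply: (@ccont_hcont _ (fun z => 'i * h z)); apply: cdiff_ccont; exact: hd.
  have cA : segcont (fun u => normc (f ((x + t + u) +i* y)) ^+ 2) 0 t.
    move=> u; rewrite in_itv/= => hu; under eq_fun do rewrite -h1E.
    by apply/ccont_hsq/cdiff_ccont; exact: hd1.
  have cB : segcont (fun u => normc (f ((x + t - u) +i* y)) ^+ 2) 0 t.
    move=> u; rewrite in_itv/= => hu; under eq_fun do rewrite -normc_conj -h2E.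
    by apply/ccont_hsq/cdiff_ccont; exact: hd2.
  have Ch : (C%:E * hslice alpha f y <= (e / 2)%:E)%E.
    have -> : e / 2 = C * (e / (2 * C)) by field; rewrite gt_eqF.
    by rewrite EFinM lee_wpmul2l ?lee_fin ?ltW.
  have mh := measurable_sqabs_hsection y hf.
  have h0 u : (0 <= sqabs f (u, y))%E by exact: sqabs_ge0.
  have iA : segint (fun u => normc (f ((x + t + u) +i* y)) ^+ 2) 0 t <= e / 2.
    rewrite -lee_fin EFin_segint// (@integral_shift_itv _ (x + t) 0 t (fun u => sqabs f (u, y)))//.
    rewrite -EFin_segint; last by apply: hol0_hcont => //; rewrite addr0.
    by apply: le_trans Ch; apply: hC => //; lra.
  have iB : segint (fun u => normc (f ((x + t - u) +i* y)) ^+ 2) 0 t <= e / 2.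
    rewrite -lee_fin EFin_segint// (@integral_reflect_itv _ (x + t) 0 t (fun u => sqabs f (u, y)))//.
    rewrite -EFin_segint; last by apply: hol0_hcont => //; lra.
    by apply: le_trans Ch; apply: hC => //; lra.
  pose AB u := 2^-1 * (normc (f ((x + t + u) +i* y)) ^+ 2 + normc (f ((x + t - u) +i* y)) ^+ 2).
  have cAB : segcont AB 0 t by apply: segcontZ; exact: segcontD.
  have iAB : segint AB 0 t <= e / 2.
    by rewrite segintZ ?segintD//; [lra|exact: segcontD].
  have pt u : `|complex.Re ('i * h (u +i* y))| <= AB u.
    apply: le_trans (normc_Re _) _; rewrite normcM normc_i mul1r hE normcM normc_conj /AB.
    move: (normc _) (normc _) => p q; have := sqr_ge0 (p - q); rewrite sqrrB; lra.
  rewrite ler_norml; apply/andP; split.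
    rewrite lerNl; apply: le_trans iAB; rewrite -mulN1r -segintZ//.
    apply: le_segint => //; first exact: segcontZ.
    by move=> u _; have := pt u; rewrite ler_norml mulN1r => /andP[]; lra.
  apply: le_trans iAB; apply: le_segint => // u _.
  by have := pt u; rewrite ler_norml => /andP[].
have b1 := bound _ hs1; have b2 := bound _ hs2.
have E0 : segint (fun v => complex.Im ('i * h (0 +i* v))) Y1 Y2 =
    segint (fun v => normc (f ((x + t) +i* v)) ^+ 2) Y1 Y2.
  apply: eq_segint => v _; rewrite hE addr0 subr0 sqr_normc_ReIm.
  by case: (f _) => p q /=; ring.
have Et : segint (fun v => complex.Im ('i * h (t +i* v))) Y1 Y2 =
    segint (fun v => complex.Re (f ((x + t + t) +i* v) * conjc (f (x +i* v)))) Y1 Y2.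
  apply: eq_segint => v _; rewrite hE addrK.
  by move: (f _) (f _) => [p q] [r s] /=; ring.
move: G b1 b2; rewrite /rint E0 Et; clear.
move: (segint _ _ _) (segint _ _ _) (segint _ _ _) (segint _ _ _) => p q r s.
rewrite !ler_norml => G /andP[? ?] /andP[? ?]; apply/andP; split; lra.
Qed.

Lemma hol0B f g : hol0 f -> hol0 g -> hol0 (fun z => f z - g z).
Proof.
move=> [f0 hf] [g0 hg]; split=> z hz; first by rewrite f0// g0// subr0.
by apply: derivableB; [exact: hf|exact: hg].
Qed.

Definition ctrans (t : R) f := acomp 1 t%:C f.

Lemma ctransE t f x y : 0 < x -> ctrans t f (x +i* y) = f ((x + t) +i* y).
Proof. by move=> x0; rewrite /ctrans /acomp /= x0 affine_symbolE /= !mul1r addr0. Qed.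

Lemma hol0_ctrans t f : 0 <= t -> hol0 f -> hol0 (ctrans t f).
Proof. by move=> t0; apply: hol0_acomp. Qed.

Lemma slice_ctrans t f x : hol0 f -> 0 < x -> slice (ctrans t f) x = slice f (x + t)%R.
Proof. by move=> hf x0; rewrite slice_acomp// invr1 mul1e mul1r. Qed.

(** Expanding [|f - T_2t f|^2] leaves the cross term [I], whose integral over tall segments is close
    to that of [|T_t f|^2] by Cauchy's theorem. Two inequalities through [integral_le_of_segs] give
    the equality even if both sides are infinite. *)
Lemma slice_identity alpha f (x t : R) : hol0 f -> (bergman_sqnorm alpha f < +oo)%E -> 0 < x -> 0 < t ->
  (slice f x + slice f (x + t + t)%R =
   slice (fun z => (f z - ctrans (t + t) f z)%R) x + (slice f (x + t)%R + slice f (x + t)%R))%E.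
Proof.
move=> hf ff x0 t0.
have xt0 : 0 < x + t by rewrite addr_gt0.
have xtt0 : 0 < x + t + t by rewrite addr_gt0.
have tt0 : 0 <= t + t by rewrite addr_ge0 ?ltW.
pose g := fun z => f z - ctrans (t + t) f z.
have hg : hol0 g := hol0B hf (hol0_ctrans tt0 hf).
have m0 (h : R[i] -> R[i]) (s : R) : hol0 h -> measurable_fun setT (fun y => normc (h (s +i* y)) ^+ 2).
  by move=> /(measurable_sqabs_section s)/measurable_EFinP.
pose S (h : R[i] -> R[i]) (s y : R) : R := normc (h (s +i* y)) ^+ 2.
pose A y := S f x y + S f (x + t + t) y.
pose B y := S g x y + (S f (x + t) y + S f (x + t) y).
pose I y := complex.Re (f ((x + t + t) +i* y) * conjc (f (x +i* y))).
have mS h s : hol0 h -> measurable_fun setT (fun y => (S h s y)%:E).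
  by move=> hh; apply/measurable_EFinP; exact: m0.
have S0 h s y : 0 <= S h s y by exact: sqr_ge0.
have DE y : S g x y = A y - 2 * I y.
  rewrite /S /g ctransE// /A /S /I addrA !sqr_normc_ReIm.
  by move: (f _) (f _) => [p q] [r u] /=; ring.
have AE : (\int[mu]_y (A y)%:E = slice f x + slice f (x + t + t)%R)%E.
  under eq_integral do rewrite /A EFinD.
  rewrite ge0_integralD//; try by move=> y _; rewrite lee_fin.
    by apply/measurable_EFinP; exact: m0.
  by apply/measurable_EFinP; exact: m0.
have BE : (\int[mu]_y (B y)%:E = slice g x + (slice f (x + t)%R + slice f (x + t)%R))%E.
  under eq_integral do rewrite /B !EFinD.
  rewrite !ge0_integralD//; try by move=> y _; rewrite ?adde_ge0// lee_fin.
  - exact: mS.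
  - exact: mS.
  - exact: mS.
  - by apply: emeasurable_funD; exact: mS.
rewrite -AE -BE.
have mA : measurable_fun setT A by apply: measurable_funD; exact: m0.
have mB : measurable_fun setT B by do ?apply: measurable_funD; exact: m0.
have A0 y : 0 <= A y by rewrite addr_ge0.
have B0 y : 0 <= B y by rewrite !addr_ge0.
have close e N : 0 < e -> exists Y1 Y2, [/\ Y1 <= - N, N <= Y2 & `|segint A Y1 Y2 - segint B Y1 Y2| <= e /\
    segcont A Y1 Y2 /\ segcont B Y1 Y2].
  move=> e0; have e2 : 0 < e / 2 by rewrite divr_gt0.
  have [Y1 [Y2 [h1 h2 h12 hd]]] := strip_identity hf ff x0 t0 N e2.
  have cS h s : hol0 h -> 0 < s -> segcont (S h s) Y1 Y2 by move=> hh s0; exact: hol0_vcont.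
  have cA : segcont A Y1 Y2 by apply: segcontD; exact: cS.
  have cB : segcont B Y1 Y2 by do ?apply: segcontD; exact: cS.
  have cI : segcont I Y1 Y2.
    have -> : I = (fun y => 2^-1 * (A y + - S g x y)) by apply/funext => y; rewrite DE; field.
    by apply: segcontZ; apply: segcontD => //; apply: segcontN; exact: cS.
  exists Y1, Y2; split=> //; split=> //.
  have -> : segint A Y1 Y2 - segint B Y1 Y2 = - (2 * (segint (S f (x + t)) Y1 Y2 - segint I Y1 Y2)).
    have cSt : segcont (S f (x + t)) Y1 Y2 by exact: cS.
    have cSI : segcont (fun y => S f (x + t) y - I y) Y1 Y2 by apply: segcontD => //; exact: segcontN.
    have -> : segint B Y1 Y2 = segint A Y1 Y2 + 2 * (segint (S f (x + t)) Y1 Y2 - segint I Y1 Y2).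
      rewrite -(segintB cSt cI) -(segintZ 2 cSI) -(segintD cA); last exact: segcontZ.
      by apply: eq_segint => y _; rewrite /B DE; ring.
    by ring.
  by rewrite normrN normrM ger0_norm//; move: hd; rewrite -/I /S; lra.
apply/eqP; rewrite eq_le; apply/andP; split; apply: integral_le_of_segs => // e N e0;
  have [Y1 [Y2 [h1 h2 [h3 [cA cB]]]]] := close e N e0; exists Y1, Y2; split=> //;
  rewrite -!EFin_segint// -EFinD lee_fin; move: h3; rewrite ler_norml => /andP[]; lra.
Qed.

End strip.

(** * Translations and automorphisms in the weighted norm *)

Section sqnorm_operators.
Context (R : realType) (alpha : R).
Local Notation mu := (@lebesgue_measure R).
Implicit Types (f g : R[i] -> R[i]) (a t x : R) (b : R[i]).
Local Notation q := (bergman_sqnorm alpha).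

Lemma sqnorm_gt0_slice f : hol0 f ->
  q f = (\int[mu]_(x in `]0%R, +oo[) ((x `^ alpha)%:E * slice f x))%E.
Proof.
move=> hf; rewrite sqnorm_slice// [RHS]integral_mkcond; apply: eq_integral => x _.
rewrite patchE; case: ifPn => //; rewrite notin_setE /= in_itv/= andbT => /negP.
by rewrite -leNgt => /(slice_le0 hf) ->; rewrite mule0.
Qed.

Lemma measurable_weighted_slice f : hol0 f ->
  measurable_fun setT (fun x => (x `^ alpha)%:E * slice f x)%E.
Proof.
by move=> hf; apply: emeasurable_funM; [exact: measurable_powRE|exact: measurable_slice].
Qed.

Lemma weighted_slice_ge0 f x : (0 <= (x `^ alpha)%:E * slice f x)%E.
Proof. by rewrite mule_ge0 ?slice_ge0// lee_fin powR_ge0. Qed.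

(** The line identity integrated against [x^alpha]. The integrals are restricted to [x > 0] because
    the slices of [ctrans t f] are translated slices of [f] only there. *)
Lemma gram_identity f t : hol0 f -> (q f < +oo)%E -> 0 < t ->
  (q f + q (ctrans (t + t)%R f) =
   q (fun z => (f z - ctrans (t + t) f z)%R) + (q (ctrans t f) + q (ctrans t f)))%E.
Proof.
move=> hf ff t0.
have tt0 : 0 <= t + t by rewrite addr_ge0 ?ltW.
have h1 := hol0_ctrans tt0 hf; have h2 := hol0_ctrans (ltW t0) hf.
have h3 := hol0B hf h1.
have m f' : hol0 f' -> measurable_fun (`]0%R, +oo[%classic : set R) (fun x => (x `^ alpha)%:E * slice f' x)%E.
  by move=> h; apply: measurable_funTS; exact: measurable_weighted_slice.
have n f' x : (0 <= (x `^ alpha)%:E * slice f' x)%E by exact: weighted_slice_ge0.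
rewrite !sqnorm_gt0_slice//.
have D (A B : R -> \bar R) : measurable_fun (`]0%R, +oo[%classic : set R) A ->
    measurable_fun (`]0%R, +oo[%classic : set R) B -> (forall x, (0 <= A x)%E) -> (forall x, (0 <= B x)%E) ->
    (\int[mu]_(x in `]0%R, +oo[) A x + \int[mu]_(x in `]0%R, +oo[) B x =
     \int[mu]_(x in `]0%R, +oo[) (A x + B x))%E.
  by move=> mA mB A0 B0; rewrite ge0_integralD.
have nn f' x : (0 <= (x `^ alpha)%:E * slice f' x + (x `^ alpha)%:E * slice f' x)%E by rewrite adde_ge0.
have e1 := D _ _ (m _ hf) (m _ h1) (n _) (n _).
have e2 := D _ _ (m _ h2) (m _ h2) (n _) (n _).
have e3 := D _ _ (m _ h3) (emeasurable_funD (m _ h2) (m _ h2)) (n _) (nn _).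
apply: (etrans e1); apply: etrans; last by apply: (etrans (esym e3)); congr (_ + _)%E; exact: esym e2.
apply: eq_integral => x; rewrite inE /= in_itv/= andbT => x0.
have := slice_identity hf ff x0 t0.
rewrite -(slice_ctrans t hf x0) -(addrA x t t) -(slice_ctrans (t + t) hf x0) => E.
have s0 f' := slice_ge0 f' x.
rewrite -(ge0_muleDr _ (s0 _) (s0 _)) E.
by rewrite (ge0_muleDr _ (s0 _) (adde_ge0 (s0 _) (s0 _))) (ge0_muleDr _ (s0 _) (s0 _)).
Qed.

Lemma slice_convex f t x : hol0 f -> (q f < +oo)%E -> 0 < x -> 0 < t ->
  (slice f (x + t)%R + slice f (x + t)%R <= slice f x + slice f (x + t + t)%R)%E.
Proof.
by move=> hf ff x0 t0; rewrite (slice_identity hf ff x0 t0) leeDr// slice_ge0.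
Qed.

Lemma lee_halving (X Y Z W : \bar R) (p : R) : 0 < p -> (0 <= X)%E -> (0 <= Y)%E -> (0 <= Z)%E -> (0 <= W)%E ->
  (Y + Y <= X + Z)%E -> (Z <= X + p%:E * W)%E -> (Y <= X + (p / 2)%:E * W)%E.
Proof.
move=> p0; have p2 : 0 < p / 2 by rewrite divr_gt0.
case: X => [X| |]//; case: W => [W| |]//; case: Z => [Z| |]//; case: Y => [Y| |]// _ _ _ _;
  rewrite ?gt0_muley ?lte_fin// ?addey ?addye// ?leey//.
by rewrite -!EFinM -!EFinD !lee_fin; lra.
Qed.

(** Midpoint convexity applied to the bound for [2t] halves the far coefficient, while the
    coefficient of [slice f x], the mean of 1 and 1, stays 1. *)
Lemma slice_decay f t x k : hol0 f -> (q f < +oo)%E -> 0 < x -> 0 < t ->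
  (slice f (x + t)%R <= slice f x + ((2 ^+ k)^-1)%:E * slice f (x + 2 ^+ k * t)%R)%E.
Proof.
move=> hf ff x0; elim: k t => [|k IH] t t0.
  by rewrite expr0 invr1 !mul1e mul1r leeDr// slice_ge0.
have tt0 : 0 < t + t by rewrite addr_gt0.
have := IH _ tt0; rewrite addrA.
have -> : 2 ^+ k * (t + t) = 2 ^+ k.+1 * t by rewrite exprS; ring.
have -> : (2 ^+ k.+1 : R)^-1 = (2 ^+ k)^-1 / 2 by rewrite exprS invfM mulrC.
apply: lee_halving (slice_convex hf ff x0 t0); rewrite ?slice_ge0// invr_gt0 exprn_gt0//.
Qed.

(** The coefficient [2^-k] of the far slice is to be dominated by a null sequence times the weight
    at the far point [u]. For negative [alpha] the weight may decay like [2^(k alpha)], so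
    [rho = 2^(-1 - alpha)], which is below 1 because [alpha > -1]. *)
Lemma powR_growth c B : -1 < alpha -> 0 < c -> 0 < B ->
  exists2 K : R, 0 <= K & exists2 rho : R, 0 <= rho < 1 &
    forall k u, c <= u -> u <= 2 ^+ k * B -> (2 ^+ k)^-1 <= K * rho ^+ k * u `^ alpha.
Proof.
move=> al c0 B0; have [al0|al0] := leP 0 alpha.
  exists (c `^ alpha)^-1; first by rewrite invr_ge0 powR_ge0.
  exists 2^-1; first by apply/andP; split; lra.
  move=> k u cu _; rewrite exprVn mulrAC -[leLHS]mul1r ler_wpM2r ?invr_ge0 ?exprn_ge0//.
  rewrite mulrC ler_pdivlMr ?powR_gt0// mul1r.
  by apply: ge0_ler_powR => //; rewrite nnegrE ltW//; exact: lt_le_trans cu.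
exists (B `^ alpha)^-1; first by rewrite invr_ge0 powR_ge0.
exists (2 `^ (- 1 - alpha)).
  rewrite powR_ge0 /= -opprD powRN invf_lt1 ?powR_gt0// -[ltLHS](congr1 (fun h => h (1 + alpha)) (@powR1 R)).
  by apply: gt0_ltr_powR; rewrite ?nnegrE//; lra.
move=> k u cu uk.
have u0 : 0 < u by exact: lt_le_trans cu.
have E (s : R) : s `^ alpha = (s `^ (- alpha))^-1 by rewrite -powRN opprK.
have p2 : 0 < (2 ^+ k : R) by rewrite exprn_gt0.
have h1 : (2 ^+ k * B) `^ alpha <= u `^ alpha.
  rewrite !E lef_pV2 ?posrE ?powR_gt0 ?mulr_gt0//.
  apply: ge0_ler_powR; rewrite ?nnegrE ?oppr_ge0; first exact: ltW.
  - exact: ltW.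
  - by rewrite ltW// mulr_gt0.
  - exact: uk.
apply: (@le_trans _ _ ((B `^ alpha)^-1 * 2 `^ (-1 - alpha) ^+ k * (2 ^+ k * B) `^ alpha)); last first.
  by apply: ler_wpM2l h1; rewrite mulr_ge0 ?invr_ge0 ?exprn_ge0 ?powR_ge0.
rewrite powRM ?exprn_ge0 ?(ltW B0)//.
have -> : (2 ^+ k) `^ alpha = (2 `^ alpha) ^+ k :> R.
  transitivity (2 `^ (k%:R * alpha) : R); first by rewrite powRrM powR_mulrn.
  by rewrite mulrC powRrM powR_mulrn ?powR_ge0.
have -> : 2 `^ (- 1 - alpha) = 2^-1 * (2 `^ alpha)^-1 :> R.
  by rewrite powRD ?powRN ?powRr1//; apply/implyP => _; rewrite pnatr_eq0.
rewrite exprMn !exprVn le_eqVlt; apply/orP; left; apply/eqP; field.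
by rewrite !gt_eqF ?powR_gt0 ?exprn_gt0 ?powR_gt0.
Qed.

Lemma integral_itv0y_le (g : R -> \bar R) (B : \bar R) :
  measurable_fun setT g -> (forall x, (0 <= g x)%E) ->
  (forall a b : R, 0 < a -> a < b -> (\int[mu]_(x in `[a, b]) g x <= B)%E) ->
  (\int[mu]_(x in `]0%R, +oo[) g x <= B)%E.
Proof.
move=> mg g0 gB; pose F (n : nat) : set R := `[n.+2%:R^-1, n.+2%:R]%classic.
have -> : `]0%R, +oo[%classic = \bigcup_n F n.
  apply/seteqP; split=> [x|x [n _]]; last first.
    rewrite /F /= !in_itv/= andbT => /andP[h _]; apply: lt_le_trans h; by rewrite invr_gt0.
  rewrite /= in_itv/= andbT => x0; pose m := maxn (Num.truncn x^-1) (Num.truncn x).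
  exists m => //; rewrite /F /= in_itv/=; apply/andP; split.
    rewrite -[leRHS]invrK lef_pV2 ?posrE ?invr_gt0//; apply: ltW; apply: lt_le_trans (truncnS_gt _) _.
    by rewrite ler_nat ltnS; apply: leqW; exact: leq_maxl.
  apply: ltW; apply: lt_le_trans (truncnS_gt _) _.
  by rewrite ler_nat ltnS; apply: leqW; exact: leq_maxr.
have cv : (\int[mu]_(x in F i) g x)%E @[i --> \oo] --> (\int[mu]_(x in \bigcup_i F i) g x)%E.
  apply: ge0_nondecreasing_set_cvg_integral => //.
  - move=> n m nm; apply/subsetPset; rewrite /F; apply: subset_itv; rewrite bnd_simp.
      by rewrite lef_pV2 ?posrE// ler_nat !ltnS.
    by rewrite ler_nat !ltnS.
  - by move=> n; exact: measurable_itv.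
  - by move=> n; exact: measurable_funTS.
have := cvg_lim (@ereal_hausdorff R) cv => <-.
apply: lime_le; first by apply/cvg_ex; eexists; exact: cv.
apply: nearW => n; apply: gB; rewrite ?invr_gt0//.
apply: (@lt_trans _ _ 1); last by rewrite ltr1n.
by rewrite invf_lt1// ltr1n.
Qed.

(** Integrated over a compact interval [[c, d]], the far term of [slice_decay] is at most a constant
    times [rho ^+ k * q f] and disappears as [k] grows; the intervals then exhaust the half-line. *)
Lemma sqnorm_ctrans_le f t : -1 < alpha -> hol0 f -> (q f < +oo)%E -> 0 < t -> (q (ctrans t f) <= q f)%E.
Proof.
move=> al hf ff t0; have hc := hol0_ctrans (ltW t0) hf.
have q0 := bergman_sqnorm_ge0 alpha f.
have qE : q f = (fine (q f))%:E by rewrite fineK// ge0_fin_numE.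
set qf := fine _ in qE; have qf0 : 0 <= qf by rewrite -lee_fin -qE.
have mw := measurable_weighted_slice.
rewrite [leLHS]sqnorm_gt0_slice//; apply: integral_itv0y_le => [|x|c d c0 cd].
- exact: mw.
- exact: weighted_slice_ge0.
have d0 : 0 < d by exact: lt_trans cd.
(* For [x <= d] the far point [x + 2 ^+ k * t] is at most [2 ^+ k * (d + t)], which dictates [B]. *)
have [K K0 [rho /andP[r0 r1] hK]] := powR_growth (B := d + t) al c0 (addr_gt0 d0 t0).
have [K' K'0 hK'] : exists2 K' : R, 0 <= K' & forall x, c <= x <= d -> x `^ alpha <= K'.
  have [C C0 hC] := powR_lower (- alpha) c0 d0; exists C; first exact: ltW.
  move=> x hx; have x0 : 0 < x by case/andP: hx => h _; exact: lt_le_trans h.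
  have := hC x hx; rewrite powRN ler_pdivlMr ?powR_gt0//; lra.
have bound k : (\int[mu]_(x in `[c, d]) ((x `^ alpha)%:E * slice (ctrans t f) x) <= (qf + K' * K * qf * rho ^+ k)%:E)%E.
  have msk : measurable_fun setT (fun x : R => slice f (2 ^+ k * t + x)%R).
    by apply: measurableT_comp; [exact: measurable_slice|apply: measurable_funD].
  apply: (@le_trans _ _ (\int[mu]_(x in `[c, d]) ((x `^ alpha)%:E * slice f x + (K' * (2 ^+ k)^-1)%:E * slice f (2 ^+ k * t + x)%R))%E).
    apply: ge0_le_integral => //.
    - by move=> x _; exact: weighted_slice_ge0.
    - by apply: measurable_funTS; exact: mw.
    - apply: measurable_funTS; apply: emeasurable_funD; first exact: mw.
      exact: measurable_funeM.
    - move=> x; rewrite /= in_itv/= => hx; have x0 : 0 < x by case/andP: hx => h _; exact: lt_le_trans h.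
      rewrite slice_ctrans//.
      apply: (@le_trans _ _ ((x `^ alpha)%:E * (slice f x + ((2 ^+ k)^-1)%:E * slice f (x + 2 ^+ k * t)%R))%E).
        by rewrite lee_wpmul2l ?lee_fin ?powR_ge0//; exact: slice_decay.
      rewrite ge0_muleDr ?slice_ge0//; last by rewrite mule_ge0 ?slice_ge0// lee_fin invr_ge0 exprn_ge0.
      rewrite leeD2l// muleA -EFinM [(2 ^+ k * t + x)%R]addrC lee_wpmul2r ?slice_ge0// lee_fin.
      by rewrite ler_wpM2r ?invr_ge0 ?exprn_ge0// hK'.
  rewrite ge0_integralD//; last 4 first.
  - by move=> x _; exact: weighted_slice_ge0.
  - by apply: measurable_funTS; exact: mw.
  - by move=> x _; rewrite mule_ge0 ?slice_ge0// lee_fin mulr_ge0// invr_ge0 exprn_ge0.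
  - by apply: measurable_funTS; exact: measurable_funeM.
  rewrite EFinD; apply: leeD.
    rewrite -qE sqnorm_slice//; apply: ge0_subset_integral => //.
    - exact: mw.
    - by move=> x _; exact: weighted_slice_ge0.
  rewrite (@integral_shift_itv _ (2 ^+ k * t) c d (fun u => (K' * (2 ^+ k)^-1)%:E * slice f u)%E); last 2 first.
  - by apply: measurable_funeM; exact: measurable_slice.
  - by move=> x; rewrite mule_ge0 ?slice_ge0// lee_fin mulr_ge0// invr_ge0 exprn_ge0.
  have Kr0 : 0 <= K' * K * rho ^+ k by rewrite !mulr_ge0// exprn_ge0.
  apply: (@le_trans _ _ (\int[mu]_(x in `[(2 ^+ k * t + c)%R, (2 ^+ k * t + d)%R]) ((K' * K * rho ^+ k)%:E * ((x `^ alpha)%:E * slice f x)))%E).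
    apply: ge0_le_integral => //.
    - by move=> x _; rewrite mule_ge0 ?slice_ge0// lee_fin mulr_ge0// invr_ge0 exprn_ge0.
    - by apply: measurable_funTS; apply: measurable_funeM; exact: measurable_slice.
    - by apply: measurable_funTS; apply: measurable_funeM; exact: mw.
    - move=> x /=; rewrite in_itv/= => /andP[h1 h2].
      rewrite muleA -EFinM lee_wpmul2r ?slice_ge0// lee_fin -!mulrA ler_wpM2l// mulrA.
      apply: hK.
        by apply: le_trans h1; rewrite lerDr mulr_ge0 ?exprn_ge0 ?ltW.
      apply: le_trans h2 _; rewrite mulrDr addrC lerD2r -[leLHS]mul1r; apply: ler_wpM2r; first exact: ltW.
      by apply: exprn_ege1; rewrite ler1n.
  have mwf : measurable_fun (`[(2 ^+ k * t + c)%R, (2 ^+ k * t + d)%R]%classic : set R) (fun x => ((x `^ alpha)%:E * slice f x)%E).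
    by apply: measurable_funTS; exact: mw.
  have nwf x : (0 <= (x `^ alpha)%:E * slice f x)%E by exact: weighted_slice_ge0.
  rewrite ge0_integralZl//.
  have -> : K' * K * qf * rho ^+ k = K' * K * rho ^+ k * qf by ring.
  rewrite [leRHS]EFinM lee_wpmul2l ?lee_fin// -qE sqnorm_slice//; apply: ge0_subset_integral => //.
  exact: mw.
rewrite qE.
have cvr : (fun k => (qf + K' * K * qf * rho ^+ k)%R) @ \oo --> qf.
  rewrite -[X in _ --> X]addr0; apply: cvgD; first exact: cvg_cst.
  rewrite -[X in _ --> X](mulr0 (K' * K * qf)); apply: cvgM; first exact: cvg_cst.
  by apply: cvg_expr; rewrite ger0_norm.
apply: (@le_trans _ _ (lim ((fun k => (qf + K' * K * qf * rho ^+ k)%:E) @ \oo))).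
  apply: lime_ge; last exact: nearW.
  by apply/cvg_ex; exists qf%:E; apply: cvg_EFin cvr; exact: nearW.
rewrite le_eqVlt; apply/orP; left; apply/eqP; apply: cvg_lim => //.
by apply: cvg_EFin cvr; exact: nearW.
Qed.

Lemma sqnorm_acomp_auto a b f : 0 < a -> complex.Re b = 0 -> hol0 f ->
  q (acomp a b f) = (((a ^+ 2 * a `^ alpha)^-1)%:E * q f)%E.
Proof.
move=> a0 b0 hf; have hc : hol0 (acomp a b f) by apply: hol0_acomp => //; rewrite b0.
rewrite [in RHS]sqnorm_slice// sqnorm_gt0_slice//.
have mw := measurable_weighted_slice hf.
have n0 x : (0 <= (x `^ alpha)%:E * slice f x)%E by exact: weighted_slice_ge0.
transitivity ((a `^ alpha * a)^-1%:E * \int[mu]_x (((a * x + 0) `^ alpha)%:E * slice f (a * x + 0)%R))%E.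
  have mwa : measurable_fun setT (fun x => ((a * x + 0) `^ alpha)%:E * slice f (a * x + 0)%R)%E.
    exact: measurableT_comp mw (measurable_affine a 0).
  rewrite -ge0_integralZl//; last by rewrite lee_fin invr_ge0 mulr_ge0 ?powR_ge0 ?ltW.
  rewrite [RHS](_ : _ = \int[mu]_(x in `]0%R, +oo[) (((a `^ alpha * a)^-1)%:E * (((a * x + 0) `^ alpha)%:E * slice f (a * x + 0)%R)))%E; last first.
    rewrite [RHS]integral_mkcond; apply: eq_integral => x _.
    rewrite patchE; case: ifPn => //; rewrite notin_setE /= in_itv/= andbT => /negP.
    by rewrite -leNgt => x0; rewrite slice_le0 ?mule0//; rewrite addr0 pmulr_rle0.
  apply: eq_integral => x; rewrite inE /= in_itv/= andbT => x0.
  rewrite slice_acomp// b0 !muleA -!EFinM; congr (_%:E * _)%E.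
  rewrite addr0 powRM ?(ltW a0) ?(ltW x0)//; field.
  by rewrite !gt_eqF ?powR_gt0.
rewrite (@integral_affine _ a 0 (fun x => (x `^ alpha)%:E * slice f x)%E)// muleA -EFinM.
by congr (_%:E * _)%E; field; rewrite !gt_eqF ?powR_gt0.
Qed.

End sqnorm_operators.

(** * Completeness *)

Section completeness.
Context (R : realType) (alpha : R).
Local Notation mu := (@lebesgue_measure R).
Implicit Types (f g : R[i] -> R[i]) (x y : R).
Local Notation q := (bergman_sqnorm alpha).

(** The automorphism [w |-> x w + i y] carries 1 to [x + i y] and multiplies squared norms by an
    explicit factor, so the bound at 1 yields all others. *)
Lemma eval_bound : exists2 C : R, 0 < C & forall f x y, hol0 f -> 0 < x ->
  ((normc (f (x +i* y)) ^+ 2)%:E <= (C * (x ^+ 2 * x `^ alpha)^-1)%:E * q f)%E.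
Proof.
have [C C0 hC] := eval_at1 alpha; exists C => // f x y hf x0.
have := hC (acomp x (0 +i* y) f) (hol0_acomp (b := 0 +i* y) x0 (lexx 0) hf).
rewrite (@sqnorm_acomp_auto _ _ x (0 +i* y) f x0 erefl hf) muleA -EFinM.
by rewrite /acomp /= ltr01 (affine_symbolE x (0 +i* y) 1 0) /= mulr1 mulr0 addr0 add0r.
Qed.

Lemma eval_bound_strip (c d : R) : 0 < c -> 0 < d -> exists2 C : R, 0 < C & forall f x y, hol0 f ->
  c <= x <= d -> ((normc (f (x +i* y)) ^+ 2)%:E <= C%:E * q f)%E.
Proof.
move=> c0 d0; have [C C0 hC] := eval_bound; have [K K0 hK] := powR_lower (2 + alpha) c0 d0.
exists (C * K) => [|f x y hf hx]; first by rewrite mulr_gt0.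
have x0 : 0 < x by case/andP: hx => h _; exact: lt_le_trans h.
apply: le_trans (hC f x y hf x0) _; rewrite lee_wpmul2r ?bergman_sqnorm_ge0// lee_fin.
apply: ler_wpM2l; first exact: ltW.
have -> : x ^+ 2 * x `^ alpha = x `^ (2 + alpha).
  by rewrite powRD ?powR_mulrn ?(ltW x0)//; apply/implyP => _; rewrite gt_eqF.
by rewrite -[leLHS]mul1r ler_pdivrMr ?powR_gt0// hK.
Qed.

Lemma fatou_bound d (T : measurableType d) (m : {measure set T -> \bar R}) (g : (T -> \bar R)^nat) (h : T -> \bar R) (B : \bar R) :
  (forall n, measurable_fun setT (g n)) -> (forall n (x : T), (0 <= g n x)%E) ->
  (forall x : T, g n x @[n --> \oo] --> h x) -> (forall n, (\int[m]_x g n x <= B)%E) ->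
  (\int[m]_x h x <= B)%E.
Proof.
move=> mg g0 gh gB.
have := @fatou _ _ R m setT measurableT g mg (fun n (x : T) _ => g0 n x).
under eq_integral do rewrite (cvg_limn_einf_sup (gh _)).1.
move=> /le_trans; apply; rewrite limn_einf_lim; apply: lime_le; first exact: is_cvg_einfs.
apply: nearW => n; apply: le_trans (gB n); apply: ereal_inf_lbound.
by exists n => //=.
Qed.

Lemma boundary_far x1 x2 y1 y2 a b : x1 < a < x2 -> y1 < b < y2 ->
  exists2 dl : R, 0 < dl & [/\ dl <= a - x1, dl <= x2 - a, dl <= b - y1 & dl <= y2 - b] /\
    forall x y, [\/ x = x1, x = x2, y = y1 | y = y2] -> dl <= normc (x +i* y - a +i* b).
Proof.
move=> ha hb; set z := a +i* b.
pose dl : R := Num.min (Num.min (a - x1) (x2 - a)) (Num.min (b - y1) (y2 - b)).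
have dl0 : 0 < dl by rewrite !lt_min !subr_gt0; case/andP: ha => -> ->; case/andP: hb => -> ->.
have [d1 d2 d3 d4] : [/\ dl <= a - x1, dl <= x2 - a, dl <= b - y1 & dl <= y2 - b].
  by split; rewrite /dl ?ge_min ?lexx ?orbT.
have far x y : [\/ x = x1, x = x2, y = y1 | y = y2] -> dl <= normc (x +i* y - z).
  move=> bxy.
  have : dl <= `|x - a| \/ dl <= `|y - b|.
    by case: bxy => ->; [left; rewrite distrC|left|right; rewrite distrC|right];
      (apply: le_trans (ler_norm _); assumption).
  case=> h; apply: le_trans h _.
    exact: (normc_Re (x +i* y - z)).
  exact: (normc_Im (x +i* y - z)).
by exists dl.
Qed.

(** Rests on [1/(w - z - h) = 1/(w - z) + h/(w - z)^2 + h^2/((w - z)^2 (w - z - h))]. On the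
    boundary the kernel of the last term is at most [2 / dl ^+ 3] once [|h| < dl / 2]. *)
Lemma cauchy_kernel_cdiff f x1 x2 y1 y2 a b (M : R) : x1 < a < x2 -> y1 < b < y2 ->
  bcont f x1 x2 y1 y2 ->
  (forall x y, x1 <= x <= x2 -> y1 <= y <= y2 -> [\/ x = x1, x = x2, y = y1 | y = y2] ->
     normc (f (x +i* y)) <= M) ->
  cdiff_at (fun z => cint (fun w => f w * (w - z)^-1) x1 x2 y1 y2) (a +i* b).
Proof.
move=> ha hb bf fM; set z := a +i* b.
have x12 : x1 <= x2 by case/andP: ha => h1 h2; exact: ltW (lt_trans h1 h2).
have y12 : y1 <= y2 by case/andP: hb => h1 h2; exact: ltW (lt_trans h1 h2).
have M0 : 0 <= M.
  apply: le_trans (fM x1 y1 _ _ _); rewrite ?normc_ge0 ?lexx//; exact: Or41.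
have [dl dl0 [[d1 d2 d3 d4] far]] := boundary_far ha hb; rewrite -/z in far.
pose W w := (w - z)^-1.
have bW : bcont W x1 x2 y1 y2 by exact: bcont_inv_sub.
pose L := cint (fun w => f w * (W w * W w)) x1 x2 y1 y2.
have dl2 : 0 < dl / 2 by rewrite divr_gt0.
apply: (@cdiff_quadratic _ _ z L (4 * (M * (2 / dl ^+ 3)) * ((x2 - x1) + (y2 - y1))) _ dl2) => h hh.
have ha' : x1 < complex.Re (z + h) < x2.
  have := le_lt_trans (normc_Re h) hh; rewrite ltr_norml /z; case: h {hh} => p r /= /andP[? ?].
  by apply/andP; split; lra.
have hb' : y1 < complex.Im (z + h) < y2.
  have := le_lt_trans (normc_Im h) hh; rewrite ltr_norml /z; case: h {hh ha'} => p r /= /andP[? ?].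
  by apply/andP; split; lra.
pose W' w := (w - (z + h))^-1.
have bW' : bcont W' x1 x2 y1 y2.
  by have := bcont_inv_sub ha' hb'; rewrite /W'; case: (z + h).
pose G w := f w * (W w * W w * W' w).
have bG : bcont G x1 x2 y1 y2 by do ?apply: bcontM.
have bfW : bcont (fun w => f w * W w) x1 x2 y1 y2 by exact: bcontM.
have bfWW : bcont (fun w => f w * (W w * W w)) x1 x2 y1 y2 by do ?apply: bcontM.
have ne x y : [\/ x = x1, x = x2, y = y1 | y = y2] -> (x +i* y - z != 0) /\ (x +i* y - (z + h) != 0).
  move=> bxy; have h1 := far _ _ bxy.
  have h2 : dl / 2 <= normc (x +i* y - (z + h)).
    have := normcD (x +i* y - (z + h)) h.
    rewrite (_ : x +i* y - (z + h) + h = x +i* y - z); last by ring.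
    lra.
  by rewrite -!normc_gt0; split; lra.
have E : cint (fun w => f w * W' w) x1 x2 y1 y2 =
    cint (fun w => f w * W w) x1 x2 y1 y2 + h * L + h ^+ 2 * cint G x1 x2 y1 y2.
  have b1 := bcontZ h bfWW; have b2 := bcontZ (h ^+ 2) bG; have b3 := bcontD bfW b1.
  rewrite -(cintZ h x12 y12 bfWW) -(cintZ (h ^+ 2) x12 y12 bG).
  rewrite -(cintD x12 y12 bfW b1) -(cintD x12 y12 b3 b2).
  apply: eq_cint => // x y _ _ /ne[n1 n2]; rewrite /G /W /W'; field.
  by rewrite n1 n2.
rewrite -/z (_ : (fun w => f w * (w - (z + h))^-1) = (fun w => f w * W' w))//.
rewrite E (_ : _ - _ - _ = h ^+ 2 * cint G x1 x2 y1 y2); last by rewrite /W; ring.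
rewrite normcM normcX mulrC ler_wpM2r ?sqr_ge0//; apply: cint_bound => // x y hx hy bxy.
rewrite /G normcM; apply: ler_pM; rewrite ?normc_ge0 ?fM//.
rewrite !normcM !normcV.
have h1 := far _ _ bxy.
have h2 : dl / 2 <= normc (x +i* y - (z + h)).
  have := normcD (x +i* y - (z + h)) h.
  rewrite (_ : x +i* y - (z + h) + h = x +i* y - z); last by ring.
  lra.
have -> : 2 / dl ^+ 3 = dl^-1 * dl^-1 * (dl / 2)^-1 by field; rewrite gt_eqF.
have iv (s t : R) : 0 < s -> s <= t -> t^-1 <= s^-1.
  by move=> s0 st; rewrite lef_pV2 ?posrE// (lt_le_trans s0).
apply: ler_pM; rewrite ?mulr_ge0 ?invr_ge0 ?normc_ge0//; last exact: iv.
by apply: ler_pM; rewrite ?invr_ge0 ?normc_ge0//; exact: iv.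
Qed.

Lemma real_cauchy (u d : nat -> R) : d n @[n --> \oo] --> 0 ->
  (forall n m, (n <= m)%N -> `|u m - u n| <= d n) -> exists l, forall n, `|l - u n| <= d n.
Proof.
move=> d0 ud.
have /cvg_ex[l ul] : cvg (u n @[n --> \oo]).
  apply: R_complete; apply: cauchy_exP => e e0.
  have /cvgrPdist_lt/(_ e e0) [N _ hN] := d0.
  exists (u N); exists N => // n /= Nn; rewrite -ball_normE /ball_ /= distrC.
  apply: le_lt_trans (ud _ _ Nn) _; apply: le_lt_trans (ler_norm _) _.
  by have := hN N (leqnn N); rewrite sub0r normrN.
exists l => n; have : `|u m - u n| @[m --> \oo] --> `|l - u n|.
  by apply: cvg_norm; apply: cvgB => //; exact: cvg_cst.
move=> h; rewrite -(cvg_lim _ h)//; apply: limr_le; first by apply/cvg_ex; exists `|l - u n|.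
by exists n => // m /=; exact: ud.
Qed.

Lemma complex_cauchy (u : nat -> R[i]) (d : nat -> R) : d n @[n --> \oo] --> 0 ->
  (forall n m, (n <= m)%N -> normc (u m - u n) <= d n) ->
  exists l, forall n, normc (l - u n) <= 2 * d n.
Proof.
move=> d0 ud.
have [|l1 h1] := @real_cauchy (fun n => complex.Re (u n)) d d0.
  by move=> n m /ud; apply: le_trans; have := normc_Re (u m - u n); rewrite cReD cReN.
have [|l2 h2] := @real_cauchy (fun n => complex.Im (u n)) d d0.
  by move=> n m /ud; apply: le_trans; have := normc_Im (u m - u n); rewrite cImD cImN.
exists (l1 +i* l2) => n; apply: le_trans (normc_le_ReIm _) _; rewrite cReD cReN cImD cImN /=.
by have := h1 n; have := h2 n; lra.
Qed.

Lemma le_of_vanishing (d : nat -> R) (x K y : R) : d n @[n --> \oo] --> 0 -> 0 <= K ->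
  (forall n, x <= K * d n + y) -> x <= y.
Proof.
move=> d0 K0 h; apply/ler_addgt0Pr => e e0.
have e1 : 0 < e / (K + 1) by rewrite divr_gt0// ltr_wpDl.
have /cvgrPdist_lt/(_ _ e1) [N _ hN] := d0.
have := hN N (leqnn N); rewrite sub0r normrN ltr_pdivlMr ?ltr_wpDl// => hN'.
have := h N; have := ler_norm (d N); have := normr_ge0 (d N); nra.
Qed.

Lemma cint_inv_neq0 x1 x2 y1 y2 a b : x1 < a < x2 -> y1 < b < y2 ->
  cint (fun w => (w - (a +i* b))^-1) x1 x2 y1 y2 != 0.
Proof.
move=> ha hb; rewrite -normc_gt0; apply: lt_le_trans (cint_inv_ge ha hb).
have x12 : 0 < x2 - x1 by case/andP: ha => ? ?; lra.
have y12 : 0 < y2 - y1 by case/andP: hb => ? ?; lra.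
by rewrite divr_gt0 ?mulr_gt0// addr_gt0 ?exprn_gt0.
Qed.

Lemma cint_inv_cdiff x1 x2 y1 y2 a b : x1 < a < x2 -> y1 < b < y2 ->
  cdiff_at (fun z => cint (fun w => (w - z)^-1) x1 x2 y1 y2) (a +i* b).
Proof.
move=> ha hb.
have -> : (fun z => cint (fun w => (w - z)^-1) x1 x2 y1 y2) =
    (fun z => cint (fun w => 1 * (w - z)^-1) x1 x2 y1 y2) :> (R[i] -> R[i]).
  apply: funext => z.
  have -> // : (fun w : R[i] => 1 * (w - z)^-1) = (fun w => (w - z)^-1).
  by apply: funext => w; rewrite mul1r.
apply: (@cauchy_kernel_cdiff (fun=> 1) x1 x2 y1 y2 a b 1 ha hb) => *.
  exact: bcont_cst.
by rewrite normc1.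
Qed.

Lemma sqnorm_fatou (fs : nat -> R[i] -> R[i]) f (B : \bar R) :
  (forall n, hol0 (fs n)) -> hol0 f ->
  (forall z, 0 < complex.Re z -> normc (fs n z - f z) @[n --> \oo] --> (0 : R)) ->
  (forall n, (q (fs n) <= B)%E) -> (q f <= B)%E.
Proof.
move=> hfs hf fsf fsB; rewrite (sqnormE alpha hf).
pose g m p : \bar R := ((p.1 `^ alpha)%:E * sqabs (fs m) p)%E.
apply: (@fatou_bound _ _ (mu \x mu)%E g).
- by move=> m; exact: (measurable_weighted_sqabs alpha (hfs m)).
- by move=> m p; exact: weighted_sqabs_ge0.
- move=> [x y]; rewrite /g /sqabs /= -EFinM; under eq_fun do rewrite -EFinM.
  apply: cvg_EFin; first exact: nearW.
  apply: cvgM; first exact: cvg_cst.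
  have h : normc (fs m (x +i* y)) @[m --> \oo] --> normc (f (x +i* y)).
    have [x0|x0] := ltP 0 x; last first.
      have nx : ~ halfplane (x +i* y) by rewrite /halfplane /=; apply/negP; rewrite -leNgt.
      rewrite (hf.1 _ nx); under eq_fun do rewrite ((hfs _).1 _ nx).
      exact: cvg_cst.
    apply/cvgrPdist_le => e e0.
    have /cvgrPdist_lt/(_ _ e0) := fsf (x +i* y) x0; apply: filterS => m.
    rewrite sub0r normrN ger0_norm ?normc_ge0// => hm.
    have := normcD (fs m (x +i* y) - f (x +i* y)) (f (x +i* y)).
    have := normcD (f (x +i* y) - fs m (x +i* y)) (fs m (x +i* y)).
    rewrite !subrK [normc (f _ - _)]normcC => h1 h2; rewrite ler_norml; apply/andP; split; lra.
  by rewrite expr2; under eq_fun do rewrite expr2; exact: cvgM.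
- by move=> m; rewrite -(sqnormE alpha (hfs m)).
Qed.

(** Point evaluations make the sequence uniformly Cauchy on vertical strips. The limit inherits
    Cauchy's formula, hence is holomorphic, and Fatou's lemma in [m] for [fs (m + n) - fs n]
    transfers the rate to the limit. *)
Lemma completeness (fs : nat -> R[i] -> R[i]) (d : nat -> R) :
  (forall n, hol0 (fs n)) -> (q (fs 0%N) < +oo)%E -> (forall n, 0 <= d n) -> d n @[n --> \oo] --> 0 ->
  (forall n m, (n <= m)%N -> (q (fun z => (fs m z - fs n z)%R) <= (d n ^+ 2)%:E)%E) ->
  exists2 f, hol0 f & forall n, (q (fun z => (f z - fs n z)%R) <= (d n ^+ 2)%:E)%E.
Proof.
move=> hfs ff dge0 d0 fsd.
have strip_ c e : 0 < c -> 0 < e -> exists2 K : R, 0 < K & forall x y n m, c <= x <= e -> (n <= m)%N ->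
    normc (fs m (x +i* y) - fs n (x +i* y)) <= K * d n.
  move=> c0 e0; have [C C0 hC] := eval_bound_strip c0 e0.
  exists (Num.sqrt C) => [|x y n m hx nm]; first by rewrite sqrtr_gt0.
  have := hC _ x y (hol0B (hfs m) (hfs n)) hx.
  have C0' : (0 <= C%:E)%E by rewrite lee_fin ltW.
  move=> /le_trans /(_ (lee_wpmul2l C0' (fsd _ _ nm))).
  rewrite -EFinM lee_fin (_ : C * d n ^+ 2 = (Num.sqrt C * d n) ^+ 2); last first.
    by rewrite exprMn sqr_sqrtr// ltW.
  by rewrite ler_pXn2r// ?nnegrE ?normc_ge0// mulr_ge0 ?sqrtr_ge0.
have P (z : R[i]) : exists l, 0 < complex.Re z -> exists2 K, 0 < K & forall n, normc (l - fs n z) <= K * d n.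
  have [z0|z0] := boolP (0 < complex.Re z); last by exists 0.
  have [K K0 hK] := strip_ _ _ z0 z0.
  have [||l hl] := @complex_cauchy (fun n => fs n z) (fun n => K * d n).
  - by rewrite -[X in _ --> X](mulr0 K); apply: cvgM => //; exact: cvg_cst.
  - move=> n m nm; have := hK (complex.Re z) (complex.Im z) n m; rewrite lexx => /(_ isT nm).
    by case: (z).
  exists l => _; exists (2 * K); first by rewrite mulr_gt0.
  by move=> n; rewrite -mulrA.
have [F hF] := choice P.
pose f (z : R[i]) := if 0 < complex.Re z then F z else 0.
have fE z : 0 < complex.Re z -> exists2 K, 0 < K & forall n, normc (f z - fs n z) <= K * d n.
  by move=> z0; rewrite /f z0; exact: hF.
have unif c e : 0 < c -> 0 < e -> exists2 K : R, 0 < K & forall x y n, c <= x <= e ->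
    normc (f (x +i* y) - fs n (x +i* y)) <= K * d n.
  move=> c0 e0; have [K K0 hK] := strip_ c e c0 e0; exists K => // x y n hx.
  have x0 : 0 < x by case/andP: hx => h _; exact: lt_le_trans h.
  have [K' K'0 hK'] := fE (x +i* y) x0.
  pose d' m := d (m + n)%N.
  have d'0 : d' m @[m --> \oo] --> 0 by rewrite (cvg_shiftn n d).
  apply: (@le_of_vanishing d' _ K' _ d'0 (ltW K'0)) => m.
  have := normcD (f (x +i* y) - fs (m + n)%N (x +i* y)) (fs (m + n)%N (x +i* y) - fs n (x +i* y)).
  rewrite addrA subrK => /le_trans; apply; apply: lerD; first exact: hK'.
  by apply: hK => //; exact: leq_addl.
have fc x y : 0 < x -> ccont_at f (x +i* y).
  move=> x0 e e0; have x20 : 0 < x / 2 by rewrite divr_gt0.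
  have [K K0 hK] := unif (x / 2) (2 * x) x20 (mulr_gt0 (ltr0n _ 2) x0).
  have [N hN] : exists N, K * d N < e / 4.
    have e1 : 0 < e / 4 / K by rewrite !divr_gt0.
    have /cvgrPdist_lt/(_ _ e1) [N _ hN] := d0; exists N.
    have := hN N (leqnn N); rewrite sub0r normrN ltr_pdivlMr// mulrC.
    by apply: le_lt_trans; rewrite ler_wpM2l// ?ler_norm// ltW.
  have e4 : 0 < e / 4 by rewrite divr_gt0.
  have [dl dl0 hdl] := cdiff_ccont (hol0_cdiff y (hfs N) x0) e4.
  exists (Num.min dl (x / 2)); first by rewrite lt_min dl0.
  move=> [u v]; rewrite lt_min => /andP[/hdl h1 h2].
  have := le_lt_trans (normc_Re _) h2; rewrite /= ltr_norml => /andP[h3 h4].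
  have [g1 g2] : x / 2 <= u <= 2 * x /\ x / 2 <= x <= 2 * x by split; apply/andP; split; lra.
  have k1 := hK u v N g1; have k2 := hK x y N g2.
  rewrite (_ : f (u +i* v) - f (x +i* y) = (f (u +i* v) - fs N (u +i* v)) +
    (fs N (u +i* v) - fs N (x +i* y)) - (f (x +i* y) - fs N (x +i* y))); last by ring.
  apply: le_lt_trans (normcB _ _) _.
  have := normcD (f (u +i* v) - fs N (u +i* v)) (fs N (u +i* v) - fs N (x +i* y)).
  lra.
have fd x y : 0 < x -> cdiff_at f (x +i* y).
  move=> x0; pose x1 := x / 2; pose x2 := 3 * x / 2; pose y1 := y - 1; pose y2 := y + 1.
  have [x10 x20] : 0 < x1 /\ 0 < x2 by rewrite /x1 /x2 !divr_gt0 ?mulr_gt0.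
  have hx : x1 < x < x2 by rewrite /x1 /x2; apply/andP; split; lra.
  have hy : y1 < y < y2 by rewrite /y1 /y2; apply/andP; split; lra.
  have [x12 y12] : x1 <= x2 /\ y1 <= y2 by case/andP: hx; case/andP: hy; split; lra.
  have [K K0 hK] := unif x1 x2 x10 x20.
  have bf : bcont f x1 x2 y1 y2.
    by move=> u v /andP[hu _] _ _; apply: fc; exact: lt_le_trans hu.
  have [C C0 hC] := eval_bound_strip x10 x20.
  pose M := Num.sqrt (C * fine (q (fs 0%N))) + K * d 0%N.
  have fM u v : x1 <= u <= x2 -> normc (f (u +i* v)) <= M.
    move=> hu; rewrite -[f _](subrK (fs 0%N (u +i* v))) addrC; apply: le_trans (normcD _ _) _.
    apply: lerD; last exact: hK.
    have := hC _ u v (hfs 0%N) hu; rewrite -[q _]fineK ?ge0_fin_numE ?bergman_sqnorm_ge0//.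
    rewrite -EFinM lee_fin => h; rewrite -[leLHS]ger0_norm ?normc_ge0// -sqrtr_sqr.
    by rewrite ler_sqrt// (le_trans _ h)// sqr_ge0.
  pose N1 z := cint (fun w => (w - z)^-1) x1 x2 y1 y2.
  pose Nf z := cint (fun w => f w * (w - z)^-1) x1 x2 y1 y2.
  (* Cauchy's formula passes to the limit: replacing [f] by [fs n] on the boundary and at [z] costs
     a multiple of [d n]. *)
  have E a b : x1 < a < x2 -> y1 < b < y2 -> Nf (a +i* b) = f (a +i* b) * N1 (a +i* b).
    move=> ha hb; have [dl dl0 [_ far]] := boundary_far ha hb.
    have bi := bcont_inv_sub ha hb; set z := a +i* b in bi far *.
    have az : x1 <= a <= x2 by rewrite !ltW//; case/andP: ha.
    apply/eqP; rewrite -subr_eq0 -[_ == 0]negbK -normc_gt0 -leNgt.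
    have : normc (Nf z - f z * N1 z) <= 0.
      pose K2 := (4 * (K * dl^-1) * ((x2 - x1) + (y2 - y1)) + K * normc (N1 z)).
      have K20 : 0 <= K2.
        have k0 : 0 <= K / dl by rewrite divr_ge0 ?ltW.
        have k1 : 0 <= (x2 - x1) + (y2 - y1) by rewrite addr_ge0 ?subr_ge0.
        apply: addr_ge0; last by apply: mulr_ge0; [exact: ltW|exact: normc_ge0].
        by apply: mulr_ge0 => //; exact: mulr_ge0.
      apply: (@le_of_vanishing d _ K2 _ d0 K20) => n; rewrite addr0.
      have bfn : bcont (fs n) x1 x2 y1 y2.
        move=> u v /andP[hu _] _ _; apply: cdiff_ccont; apply: hol0_cdiff => //.
        exact: lt_le_trans hu.
      have cn : cint (fun w => fs n w * (w - z)^-1) x1 x2 y1 y2 = fs n z * N1 z.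
        apply: cauchy_formula => // u v /andP[hu _] _; apply: hol0_cdiff => //.
        exact: lt_le_trans hu.
      have bn : bcont (fun w => (-1) * (fs n w * (w - z)^-1)) x1 x2 y1 y2.
        by apply: bcontZ; exact: bcontM.
      have bfi : bcont (fun w => f w * (w - z)^-1) x1 x2 y1 y2 by exact: bcontM.
      have bni : bcont (fun w => fs n w * (w - z)^-1) x1 x2 y1 y2 by exact: bcontM.
      have -> : Nf z - f z * N1 z =
          cint (fun w => f w * (w - z)^-1 + (-1) * (fs n w * (w - z)^-1)) x1 x2 y1 y2 -
          (f z - fs n z) * N1 z.
        by rewrite (cintD x12 y12 bfi bn) (cintZ _ x12 y12 bni) cn /Nf; ring.
      have -> : K2 * d n = 4 * (K * d n * dl^-1) * ((x2 - x1) + (y2 - y1)) + K * d n * normc (N1 z).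
        by rewrite /K2; ring.
      apply: le_trans (normcB _ _) _; apply: lerD; last first.
        by rewrite normcM; apply: ler_wpM2r; [exact: normc_ge0|exact: hK].
      apply: cint_bound => //; first exact: bcontD.
      move=> u v hu hv buv.
      rewrite (_ : _ + _ = (f (u +i* v) - fs n (u +i* v)) * (u +i* v - z)^-1); last by ring.
      rewrite normcM normcV; apply: ler_pM; rewrite ?invr_ge0 ?normc_ge0//; first exact: hK.
      by rewrite lef_pV2 ?posrE// ?far// (lt_le_trans dl0)// far.
    by [].
  have N10 : N1 (x +i* y) != 0 by exact: cint_inv_neq0.
  have dN1 : cdiff_at N1 (x +i* y) by exact: cint_inv_cdiff.
  have dNf : cdiff_at Nf (x +i* y).
    by apply: (@cauchy_kernel_cdiff f x1 x2 y1 y2 x y M) => // u v hu _ _; exact: fM.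
  (* Near the point [f] is a quotient of two Cauchy integrals, both differentiable in their
     parameter. *)
  apply: (@cdiff_near _ (fun z => Nf z * (N1 z)^-1) _ _ (Num.min (x / 2) 1)).
  - by rewrite lt_min x10 ltr01.
  - move=> [u v]; rewrite lt_min => /andP[h1 h2].
    have := le_lt_trans (normc_Re _) h1; have := le_lt_trans (normc_Im _) h2.
    rewrite /= !ltr_norml => /andP[? ?] /andP[? ?].
    have [hu hv] : x1 < u < x2 /\ y1 < v < y2 by rewrite /x1 /x2 /y1 /y2; split; apply/andP; split; lra.
    by rewrite E// mulfK//; exact: cint_inv_neq0.
  - by apply: cdiffM => //; exact: cdiffV.
have hf : hol0 f.
  split=> [z|[x y]]; rewrite /halfplane /=; last by move=> x0; apply/cdiff_derivable/fd.
  by move=> /negP z0; rewrite /f (negbTE z0).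
exists f => // n.
apply: (@sqnorm_fatou (fun m z => fs (m + n)%N z - fs n z)).
- by move=> m; exact: (hol0B (hfs (m + n)%N) (hfs n)).
- exact: (hol0B hf (hfs n)).
- move=> z z0; have [K K0 hK] := fE z z0.
  have d'0 : d (m + n)%N @[m --> \oo] --> 0 by rewrite (cvg_shiftn n d).
  apply/cvgrPdist_le => e e0.
  have e1 : 0 < e / K by rewrite divr_gt0.
  have /cvgrPdist_lt/(_ _ e1) := d'0; apply: filterS => m.
  rewrite sub0r normrN ltr_pdivlMr// => hm.
  rewrite sub0r normrN ger0_norm ?normc_ge0// opprB addrA subrK normcC.
  apply: le_trans (hK _) _; apply: ltW; apply: le_lt_trans hm.
  by rewrite mulrC ler_wpM2r ?ler_norm// ltW.
- by move=> m; apply: fsd; exact: leq_addl.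
Qed.

End completeness.

(** * Composition operators on the Bergman space *)

Section bergman_operators.
Context (R : realType) (alpha : R).
Hypothesis al : -1 < alpha.
Local Notation mu := (@lebesgue_measure R).
Local Notation V := (bergman alpha).
Local Notation q := (bergman_sqnorm alpha).
Local Notation C a b := (@composition_op R alpha (affine_symbol a b)).
Implicit Types (f g h u v w : V) (a t : R) (b c l z : R[i]).

Lemma bergman_hol0 f : hol0 f.
Proof. by have [] := bergmanP f. Qed.

Definition sqn f : R := fine (q f).
Local Notation n2 := sqn.

Lemma sqnE f : q f = (n2 f)%:E.
Proof. by have [_ _ h] := bergmanP f; rewrite fineK. Qed.

Lemma sqn_lty f : (q f < +oo)%E.
Proof. by rewrite sqnE ltry. Qed.

Lemma sqn_ge0 f : 0 <= n2 f.
Proof. by rewrite fine_ge0// bergman_sqnorm_ge0. Qed.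

Lemma mem_bergman (F : R[i] -> R[i]) : hol0 F -> (q F < +oo)%E -> F \in in_bergman alpha.
Proof. by move=> [F0 hF] ff; rewrite inE; split. Qed.

Lemma bergman_ext f g : (forall z, 0 < complex.Re z -> f z = g z) -> f = g.
Proof.
move=> fg; apply/val_inj/funext => z; have [/fg //|z0] := ltP 0 (complex.Re z).
have nz : ~ halfplane z by rewrite /halfplane /=; apply/negP; rewrite -leNgt.
by rewrite /= (bergman_hol0 f).1// (bergman_hol0 g).1.
Qed.

Lemma bergmanD f g z : (f + g) z = f z + g z. Proof. by []. Qed.
Lemma bergmanN f z : (- f) z = - f z. Proof. by []. Qed.
Lemma bergmanZ l f z : (l *: f) z = l * f z. Proof. by []. Qed.
Lemma bergman0 z : (0 : V) z = 0. Proof. by []. Qed.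

Definition weight_sq f (p : R * R) : R := p.1 `^ alpha * normc (f (p.1 +i* p.2)) ^+ 2.

Lemma weight_sq_integrable f :
  (mu \x mu)%E.-integrable setT (EFin \o weight_sq f).
Proof.
have hf := bergman_hol0 f.
have mw := measurable_weighted_sqabs alpha hf.
apply/integrableP; split; first exact: mw.
apply: le_lt_trans (sqn_lty f); rewrite (sqnormE alpha hf) le_eqVlt; apply/orP; left; apply/eqP.
apply: eq_integral => p _; rewrite gee0_abs//; exact: weighted_sqabs_ge0.
Qed.

Lemma sqn_Rintegral f : n2 f = (\int[(mu \x mu)%E]_p weight_sq f p)%R.
Proof. by rewrite /sqn (sqnormE alpha (bergman_hol0 f)). Qed.

Lemma weight_sq_line u v t p : weight_sq (u + t%:C *: v) p =
  (1 - t) * weight_sq u p + (t * weight_sq (u + v) p + (t ^+ 2 - t) * weight_sq v p).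
Proof.
rewrite /weight_sq bergmanD bergmanZ bergmanD !sqr_normc_ReIm.
by case: (u _) (v _) => [u1 u2] [v1 v2] /=; ring.
Qed.

(** Says that the norm comes from an inner product without naming one: the squared norm is a
    quadratic polynomial along real lines. It holds pointwise under the integral, and [t = -1] is
    the parallelogram law. *)
Lemma sqn_line u v t :
  n2 (u + t%:C *: v) = (1 - t) * n2 u + (t * n2 (u + v) + (t ^+ 2 - t) * n2 v).
Proof.
have I (k : R) f : (mu \x mu)%E.-integrable setT (EFin \o (fun p => k * weight_sq f p)).
  have -> : EFin \o (fun p => k * weight_sq f p) = (fun p => (k%:E * (EFin \o weight_sq f) p)%E).
    by apply: funext => p.
  by apply: integrableZl => //; exact: weight_sq_integrable.
have I2 : (mu \x mu)%E.-integrable setT (EFin \o (fun p => t * weight_sq (u + v) p + (t ^+ 2 - t) * weight_sq v p)).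
  exact: (integrableD measurableT (I t (u + v)) (I (t ^+ 2 - t) v)).
rewrite !sqn_Rintegral.
have Z k f := RintegralZl k measurableT (weight_sq_integrable f).
rewrite -(Z (1 - t) u) -(Z t (u + v)) -(Z (t ^+ 2 - t) v).
rewrite -(RintegralD measurableT (I t (u + v)) (I (t ^+ 2 - t) v)).
rewrite -(RintegralD measurableT (I (1 - t) u) I2).
apply: eq_Rintegral => -[x y] _; exact: weight_sq_line.
Qed.

Lemma sqnZ l f : n2 (l *: f) = normc l ^+ 2 * n2 f.
Proof.
have [f0 hf] := bergman_hol0 f; rewrite /sqn.
by rewrite bergman_sqnormZ// fineM// sqnE.
Qed.

Lemma sqnN f : n2 (- f) = n2 f.
Proof. by rewrite -scaleN1r sqnZ normcN normc1 expr1n mul1r. Qed.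

Lemma sqn0 : n2 0 = 0.
Proof. by rewrite -[0 in LHS](scale0r (0 : V)) sqnZ normc0 expr0n mul0r. Qed.

Lemma sqnB f g : n2 (f - g) = n2 (g - f).
Proof. by rewrite -sqnN opprB. Qed.

Lemma sqn_eq0 f : n2 f = 0 -> f = 0.
Proof.
by move=> f0; apply: bergman_norm0_eq0; rewrite /bergman_norm -/(sqn f) f0 sqrtr0.
Qed.

Lemma sqn_gt0 f : f != 0 -> 0 < n2 f.
Proof.
by move=> f0; rewrite lt_neqAle sqn_ge0 andbT eq_sym; apply: contra_neq f0; exact: sqn_eq0.
Qed.

Lemma parallelogram u v : n2 (u + v) + n2 (u - v) = 2 * n2 u + 2 * n2 v.
Proof.
have := sqn_line u v (-1); rewrite rmorphN rmorph1 scaleN1r => ->; ring.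
Qed.

Definition nrm f : R := Num.sqrt (n2 f).

Lemma normE f : `|f| = (nrm f)%:C. Proof. by []. Qed.
Lemma nrm_ge0 f : 0 <= nrm f. Proof. exact: sqrtr_ge0. Qed.
Lemma sqr_nrm f : nrm f ^+ 2 = n2 f. Proof. by rewrite sqr_sqrtr// sqn_ge0. Qed.
Lemma nrmD f g : nrm (f + g) <= nrm f + nrm g.
Proof. by have := ler_normD f g; rewrite !normE -rmorphD/= lecR. Qed.
Lemma nrmN f : nrm (- f) = nrm f. Proof. by rewrite /nrm sqnN. Qed.
Lemma nrmZ l f : nrm (l *: f) = normc l * nrm f.
Proof. by rewrite /nrm sqnZ sqrtrM ?sqr_ge0// sqrtr_sqr ger0_norm// normc_ge0. Qed.
Lemma nrm0 : nrm 0 = 0. Proof. by rewrite /nrm sqn0 sqrtr0. Qed.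
Lemma nrm_gt0 f : f != 0 -> 0 < nrm f.
Proof. by move=> f0; rewrite sqrtr_gt0 sqn_gt0. Qed.
Lemma nrmB f g : nrm (f - g) = nrm (g - f).
Proof. by rewrite /nrm sqnB. Qed.
Lemma nrm_dist f g : nrm f <= nrm g + nrm (f - g).
Proof. by rewrite -{1}[f](subrKC g) nrmD. Qed.
Lemma nrm_le f (r : R) : 0 <= r -> n2 f <= r ^+ 2 -> nrm f <= r.
Proof. by move=> r0 h; rewrite -[r]ger0_norm// -sqrtr_sqr ler_wsqrtr. Qed.

Lemma eval_nrm z : 0 < complex.Re z ->
  exists2 K : R, 0 < K & forall f, normc (f z) <= K * nrm f.
Proof.
case: z => x y /= x0; have [K K0 hK] := eval_bound_strip alpha x0 x0.
have hx : x <= x <= x by rewrite lexx.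
exists (Num.sqrt K); first by rewrite sqrtr_gt0.
move=> f; have := hK f x y (bergman_hol0 f) hx; rewrite sqnE -EFinM lee_fin => h.
rewrite -[leLHS]ger0_norm ?normc_ge0// -sqrtr_sqr -sqrtrM; last exact: ltW.
exact: ler_wsqrtr.
Qed.

Lemma bergman_complete (us : nat -> V) (d : nat -> R) :
  (forall n, 0 <= d n) -> d n @[n --> \oo] --> 0 ->
  (forall n m, (n <= m)%N -> nrm (us m - us n) <= d n) ->
  exists u, forall n, nrm (u - us n) <= d n.
Proof.
move=> d0 dl h.
have h2 n m : (n <= m)%N -> (q (fun z => (us m z - us n z)%R) <= (d n ^+ 2)%:E)%E.
  move=> nm; have := h n m nm; rewrite -(@ler_pXn2r _ 2)// ?nnegrE ?nrm_ge0// sqr_nrm.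
  by rewrite -lee_fin -sqnE.
have [F hF FP] := completeness (fun n => bergman_hol0 (us n)) (sqn_lty _) d0 dl h2.
have ff : (q F < +oo)%E.
  have Bm := mem_bergman (hol0B hF (bergman_hol0 (us 0%N))) (le_lt_trans (FP 0%N) (ltry _)).
  have -> : F = (Bergman Bm + us 0%N : V); last exact: sqn_lty.
  by apply: funext => z; rewrite bergmanD /= subrK.
exists (Bergman (mem_bergman hF ff)) => n; apply: nrm_le; first exact: d0.
by have := FP n; rewrite -lee_fin -sqnE.
Qed.

(** This is [a^-(2 + alpha)]: two powers from the area element and [alpha] from the weight. *)
Definition dilation_factor a : R := (a ^+ 2 * a `^ alpha)^-1.
Local Notation kap := dilation_factor.

(** Splits off the translation by [Re b]. The remaining symbol is an automorphism, whose effect on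
    the norm is exact. *)
Lemma acomp_ctrans a b (F : R[i] -> R[i]) : 0 < a -> 0 <= complex.Re b ->
  acomp a b F = acomp a (0 +i* complex.Im b) (ctrans (complex.Re b) F).
Proof.
move=> a0 b0; apply: funext => -[x y]; rewrite /ctrans /acomp; case: ifP => // x0.
rewrite (affine_symbolE a (complex.Im b)*i x y) addr0 /= mulr_gt0//; congr F.
by rewrite !affine_symbolE /= !mul1r addr0.
Qed.

Lemma sqnorm_acomp_le a b (F : R[i] -> R[i]) : 0 < a -> 0 <= complex.Re b -> hol0 F ->
  (q F < +oo)%E -> (q (acomp a b F) <= (kap a)%:E * q F)%E.
Proof.
move=> a0 b0 hF ff; rewrite (acomp_ctrans F a0 b0).
rewrite (@sqnorm_acomp_auto _ alpha a (0 +i* complex.Im b) _ a0 erefl (hol0_ctrans b0 hF)).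
rewrite lee_wpmul2l//; first by rewrite lee_fin invr_ge0 mulr_ge0 ?powR_ge0// sqr_ge0.
move: b0; rewrite le_eqVlt => /orP[/eqP <-|b0]; last exact: sqnorm_ctrans_le.
rewrite (_ : ctrans 0 F = F)//; apply: funext => -[x y]; rewrite /ctrans /acomp.
case: ifP => [_|/negbT x0]; first by rewrite affine_symbolE /= mul1r mul1r !addr0.
by rewrite hF.1//; exact/negP.
Qed.

Section composition.
Variables (a : R) (b : R[i]).
Hypotheses (a0 : 0 < a) (b0 : 0 <= complex.Re b).

(** The norm bound shows that the default value of [insubd] is not taken, so the operator may be
    computed pointwise. *)
Lemma copE f : C a b f = acomp a b f :> (R[i] -> R[i]).
Proof.
rewrite /composition_op; apply: (@insubdK _ _ _ (0 : V)); apply: mem_bergman.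
  exact: hol0_acomp (bergman_hol0 f).
apply: le_lt_trans (sqnorm_acomp_le a0 b0 (bergman_hol0 f) (sqn_lty f)) _.
by rewrite sqnE -EFinM ltry.
Qed.

Lemma cop_val f z : 0 < complex.Re z -> C a b f z = f (a%:C * z + b).
Proof. by move=> z0; rewrite copE /acomp z0. Qed.

Lemma copD f g : C a b (f + g) = C a b f + C a b g.
Proof. by apply: bergman_ext => z z0; rewrite bergmanD !cop_val// bergmanD. Qed.

Lemma copZ l f : C a b (l *: f) = l *: C a b f.
Proof. by apply: bergman_ext => z z0; rewrite bergmanZ !cop_val// bergmanZ. Qed.

Lemma copB f g : C a b (f - g) = C a b f - C a b g.
Proof. by rewrite -scaleN1r copD copZ scaleN1r. Qed.

Lemma cop_le f : n2 (C a b f) <= kap a * n2 f.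
Proof.
have := sqnorm_acomp_le a0 b0 (bergman_hol0 f) (sqn_lty f).
by rewrite -copE !sqnE -EFinM lee_fin.
Qed.

Lemma cop_auto f : complex.Re b = 0 -> n2 (C a b f) = kap a * n2 f.
Proof.
move=> b00; have := @sqnorm_acomp_auto _ alpha a b f a0 b00 (bergman_hol0 f).
by rewrite -copE !sqnE -EFinM => -[].
Qed.

End composition.

Lemma cop_comp a b a' b' f : 0 < a -> 0 <= complex.Re b -> 0 < a' -> 0 <= complex.Re b' ->
  C a b (C a' b' f) = C (a' * a) (a'%:C * b + b') f.
Proof.
move=> a0 b0 a'0 b'0; have r0 : 0 <= complex.Re (a'%:C * b + b').
  by case: b b0 => b1 b2 /= b0; rewrite cReD cReM /= mul0r subr0 addr_ge0// mulr_ge0// ltW.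
apply: bergman_ext => z z0.
rewrite (cop_val (mulr_gt0 a'0 a0) r0 _ z0) (cop_val a0 b0 _ z0) (cop_val a'0 b'0).
  by rewrite rmorphM /= mulrDr mulrA addrA.
by case: z z0 => x y /= x0; rewrite cReD cReM /= mul0r subr0 ltr_wpDr// mulr_gt0.
Qed.

Lemma gram f t : 0 < t ->
  n2 f + n2 (C 1 (t + t)%:C f) = n2 (f - C 1 (t + t)%:C f) + 2 * n2 (C 1 t%:C f).
Proof.
move=> t0; have E s : 0 <= s -> ctrans s f = C 1 s%:C f by move=> s0; rewrite copE.
have := gram_identity (bergman_hol0 f) (sqn_lty f) t0.
rewrite !E ?addr_ge0 ?ltW//.
rewrite (_ : (fun z => (f z - C 1 (t + t)%:C f z)%R) = (f - C 1 (t + t)%:C f : V))//.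
by rewrite !sqnE -!EFinD => -[->]; ring.
Qed.

Lemma sqn_fatou (us : nat -> V) u (B : R) :
  (forall z, 0 < complex.Re z -> normc (us n z - u z) @[n --> \oo] --> (0 : R)) ->
  (forall n, n2 (us n) <= B) -> n2 u <= B.
Proof.
move=> hz hB; rewrite -lee_fin -sqnE.
apply: (@sqnorm_fatou R alpha us u B%:E (fun n => bergman_hol0 _) (bergman_hol0 u) hz) => n.
by rewrite sqnE lee_fin.
Qed.

Lemma supercyclicP (T : V -> V) : supercyclic T <->
  exists2 f, f != 0 & forall g (e : R), 0 < e ->
    exists n l, nrm (g - l *: iter n T f) < e.
Proof.
split=> -[f f0 hf]; exists f => //.
  move=> g e e0; have e0' : 0 < e%:C by rewrite ltcR.
  have [] := hf (ball g e%:C); [by exists g; exact: ballxx|exact: ball_open|].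
  move=> k [+ [n [l kE]]]; rewrite kE -ball_normE /ball_ /= normE ltcR => h.
  by exists n, l.
move=> O [g Og] oO; have := open_nbhs_nbhs (conj oO Og).
move=> /nbhs_ballP[e /= e0 he].
have eE : e = (complex.Re e)%:C by case: e e0 {he} => x y /= /andP[/eqP -> _].
have e0' : 0 < complex.Re e by rewrite -ltcR -eE.
have [n [l h]] := hf g _ e0'; exists (l *: iter n T f); split; last by exists n, l.
by apply: he; rewrite -ball_normE /ball_ /= eE normE ltcR.
Qed.

End bergman_operators.

(** * Powers of [1/(z + 1)] as test functions *)

Section test_functions.
Context (R : realType) (alpha : R).
Hypothesis al : -1 < alpha.
Local Notation mu := (@lebesgue_measure R).
Local Notation V := (bergman alpha).
Local Notation q := (bergman_sqnorm alpha).

Lemma integral_oneDsqr : (\int[mu]_x (oneDsqr x)^-1%:E = (pi : R)%:E)%E.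
Proof.
rewrite (@ge0_symfun_integralT _ (fun x : R => (oneDsqr x)^-1)).
- by rewrite -set_itvcy integral0y_oneDsqr -EFinM mulrC divfK.
- by move=> x; rewrite invr_ge0 ltW// (lt_le_trans ltr01) ?oneDsqr_ge1.
- exact: continuous_oneDsqrV.
- by move=> x; rewrite /oneDsqr /= sqrrN.
Qed.

Lemma is_derive_1D (x : R) : is_derive x 1 (fun y : R => 1 + y) 1.
Proof.
have := is_deriveD (is_derive_cst (1 : R) x 1) (is_derive_id x (1 : R)).
by rewrite add0r.
Qed.

(** The function is [(x/(1 + x))^(alpha + 1)/(alpha + 1)], bounded by [1/(alpha + 1)]; the integral
    behind it is the Beta integral B(alpha + 1, 1). *)
Lemma weight_antiderivative (x : R) : 0 < x ->
  is_derive x 1 (fun x => (alpha + 1)^-1 * (x `^ (alpha + 1) * (1 + x) `^ (- (alpha + 1))))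
    (x `^ alpha * (1 + x) `^ (- (alpha + 2))).
Proof.
move=> x0; have x10 : 0 < 1 + x by rewrite addr_gt0.
have d1 := is_derive1_powR (alpha + 1) x0.
have d2 := is_derive1_powR (- (alpha + 1)) x10.
have d3 := is_derive_1D x.
have d4 := is_derive1_comp (f := fun y : R => y `^ (- (alpha + 1))) (g := fun x : R => 1 + x) d2 d3.
apply: is_derive_eq.
have E1 : x `^ (alpha + 1) = x `^ alpha * x.
  by rewrite powRD ?powRr1 ?(ltW x0)//; apply/implyP => _; rewrite gt_eqF.
have E2 : (1 + x) `^ (- (alpha + 1)) = (1 + x) `^ (- (alpha + 2)) * (1 + x).
  rewrite -[X in _ * X]powRr1 ?(ltW x10)// -powRD; first by congr (_ `^ _); ring.
  by apply/implyP => _; rewrite gt_eqF.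
rewrite E1 E2 addrK (_ : - (alpha + 1) - 1 = - (alpha + 2)); last by ring.
rewrite /GRing.scale /=; field.
by rewrite gt_eqF// -ltrBlDr sub0r.
Qed.

Lemma integral_weight_le (a b : R) : 0 < a -> a < b ->
  (\int[mu]_(x in `[a, b]) (x `^ alpha * (1 + x) `^ (- (alpha + 2)))%:E <= ((alpha + 1)^-1)%:E)%E.
Proof.
move=> a0 ab; pose G (x : R) := (alpha + 1)^-1 * (x `^ (alpha + 1) * (1 + x) `^ (- (alpha + 1))).
have b0 : 0 < b by exact: lt_trans ab.
have dG (x : R) : 0 < x -> is_derive x 1 G (x `^ alpha * (1 + x) `^ (- (alpha + 2))).
  exact: weight_antiderivative.
have dpow (s x : R) : 0 < x -> derivable (fun y : R => y `^ s) x 1.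
  by move=> x0; have [] := is_derive1_powR s x0.
have al1 : 0 < alpha + 1 by rewrite -ltrBlDr sub0r.
have cG (x : R) : 0 < x -> {for x, continuous G}.
  by move=> x0; apply/differentiable_continuous/derivable1_diffP; have [] := dG x x0.
rewrite (@continuous_FTC2 _ _ G _ _ ab).
- rewrite -EFinB lee_fin lerBlDr; apply: (@le_trans _ _ (alpha + 1)^-1).
    rewrite /G ler_piMr ?invr_ge0 ?(ltW al1)// powRN ler_pdivrMr ?powR_gt0//; last by lra.
    by rewrite mul1r; apply: ge0_ler_powR; rewrite ?nnegrE; lra.
  by rewrite lerDl /G mulr_ge0 ?invr_ge0 ?(ltW al1)// mulr_ge0 ?powR_ge0.
- apply: derivable_within_continuous => x; rewrite in_itv/= => /andP[ax _].
  have x0 : 0 < x by exact: lt_le_trans ax.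
  have x10 : 0 < 1 + x by rewrite addr_gt0.
  apply: derivableM; first exact: dpow.
  have d3 := is_derive_1D x.
  by have [] := is_derive1_comp (f := fun y : R => y `^ (- (alpha + 2))) (g := fun x : R => 1 + x) (is_derive1_powR _ x10) d3.
- split.
  + by move=> x; rewrite in_itv/= => /andP[ax _]; have [] := dG x (lt_trans a0 ax).
  + by apply: cvg_at_right_filter; exact: cG.
  + by apply: cvg_at_left_filter; exact: cG.
- move=> x; rewrite in_itv/= => /andP[ax _]; rewrite derive1E.
  by have [_ ->] := dG x (lt_trans a0 ax).
Qed.

Definition test_fun (k : nat) : R[i] -> R[i] :=
  fun z => if 0 < complex.Re z then ((z + 1)^-1) ^+ k else 0.

Lemma Re_gt0_neq0 (z : R[i]) : 0 < complex.Re z -> z + 1 != 0.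
Proof. by case: z => x y /= x0; rewrite eq_complex /= addr0 negb_and gt_eqF// ltr_wpDl// ltW. Qed.

Lemma hol0_test_fun k : hol0 (test_fun k).
Proof.
split=> [z|[x y]]; rewrite /halfplane /=; first by rewrite /test_fun => /negP/negbTE ->.
move=> x0; apply: cdiff_derivable.
apply: (@cdiff_near _ (fun z => ((z + 1)^-1) ^+ k) _ _ x x0).
  move=> [u v] h; rewrite /test_fun /= ifT//.
  by have := le_lt_trans (normc_Re _) h; rewrite /= ltr_norml; lra.
apply: cdiffX; apply: cdiffV; first exact: (@Re_gt0_neq0 (x +i* y) x0).
by apply: cdiffD; [exact: cdiff_id|exact: cdiff_cst].
Qed.

(** One of the [k.+1] factors [|z + 1|^-2] is at most [1/(1 + y^2)] and pays for the integral over
    [y]; the others are at most [(1 + x)^-2] and pay for the weight. *)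
Lemma test_fun_lty k : alpha + 2 <= k%:R *+ 2 -> (q (test_fun k.+1) < +oo)%E.
Proof.
move=> hk; have hf := hol0_test_fun k.+1.
have bnd (x y : R) : 0 < x -> normc (test_fun k.+1 (x +i* y)) ^+ 2 <=
    (1 + x) `^ (- (alpha + 2)) * (oneDsqr y)^-1.
  move=> x0; have x10 : 0 < 1 + x by rewrite addr_gt0.
  rewrite /test_fun /= x0 normcX normcV exprAC exprVn sqr_normc_ReIm /= addr0 exprVn exprS invfM mulrC.
  have o0 : 0 < oneDsqr y by rewrite (lt_le_trans ltr01) ?oneDsqr_ge1.
  have y0 := sqr_ge0 y.
  have p0 : 0 < (x + 1) ^+ 2 + y ^+ 2 by rewrite ltr_wpDr// exprn_gt0// addrC.
  apply: ler_pM; rewrite ?invr_ge0 ?exprn_ge0 ?addr_ge0 ?sqr_ge0//.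
    rewrite powRN lef_pV2 ?posrE ?powR_gt0 ?exprn_gt0//.
    apply: (@le_trans _ _ ((1 + x) ^+ (k * 2))).
      rewrite -powR_mulrn ?(ltW x10)//; apply: ler_powR; first lra.
      by rewrite mulrnA -mulr_natr in hk *.
    rewrite mulnC exprM; apply: lerXn2r; rewrite ?nnegrE; nra.
  by rewrite lef_pV2 ?posrE// /oneDsqr; nra.
have slice_le (x : R) : 0 < x -> (slice (test_fun k.+1) x <= (pi : R)%:E * ((1 + x) `^ (- (alpha + 2)))%:E)%E.
  move=> x0; rewrite -integral_oneDsqr muleC.
  have mV : measurable_fun setT (fun y : R => ((oneDsqr y)^-1)%:E).
    by apply/measurable_EFinP; apply: continuous_measurable_fun; exact: continuous_oneDsqrV.
  have nV (y : R) : (0 <= ((oneDsqr y)^-1)%:E)%E.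
    by rewrite lee_fin invr_ge0 ltW// (lt_le_trans ltr01) ?oneDsqr_ge1.
  rewrite -ge0_integralZl ?lee_fin ?powR_ge0//.
  apply: ge0_le_integral => //.
  - by move=> y _; exact: sqabs_ge0.
  - exact: measurable_sqabs_section.
  - exact: measurable_funeM.
  - by move=> y _; rewrite -EFinM lee_fin; exact: bnd.
have mW : measurable_fun setT (fun x : R => (x `^ alpha * (1 + x) `^ (- (alpha + 2)))%:E).
  apply/measurable_EFinP; apply: measurable_funM; first exact: measurable_powR.
  apply: (measurableT_comp (measurable_powR (- (alpha + 2)))).
  exact: measurable_funD.
rewrite sqnorm_gt0_slice//.
apply: (@le_lt_trans _ _ (\int[mu]_(x in `]0%R, +oo[) ((pi : R)%:E * (x `^ alpha * (1 + x) `^ (- (alpha + 2)))%:E))%E).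
  apply: ge0_le_integral => //.
  - by move=> x _; exact: weighted_slice_ge0.
  - by apply: measurable_funTS; exact: measurable_weighted_slice.
  - by apply: measurable_funTS; exact: measurable_funeM.
  - move=> x; rewrite /= in_itv/= andbT => x0.
    rewrite EFinM muleCA; apply: lee_wpmul2l; first by rewrite lee_fin powR_ge0.
    exact: slice_le.
apply: (@le_lt_trans _ _ ((pi : R) * (alpha + 1)^-1)%:E); last exact: ltry.
apply: integral_itv0y_le.
- exact: measurable_funeM.
- by move=> x; rewrite -EFinM lee_fin mulr_ge0 ?pi_ge0// mulr_ge0 ?powR_ge0.
move=> a b a0 ab; rewrite ge0_integralZl//; last 3 first.
- exact: measurable_funTS.
- by move=> x _; rewrite lee_fin mulr_ge0 ?powR_ge0.
- by rewrite lee_fin pi_ge0.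
by rewrite EFinM lee_wpmul2l ?lee_fin ?pi_ge0//; exact: integral_weight_le.
Qed.

(** [h1] has no zero and [1/(z + 1)] is injective, so the values of the pair at two distinct points
    are linearly independent. All refutations of density end by contradicting this, apart from the
    parabolic one. *)
Lemma exists_test_functions : exists h1 h2 : V,
  forall z, 0 < complex.Re z -> h1 z != 0 /\ h2 z = h1 z * (z + 1)^-1.
Proof.
have [k hk] : exists k : nat, alpha + 2 <= k%:R *+ 2.
  exists (Num.truncn (alpha + 2)).+1; have := truncnS_gt (alpha + 2).
  have : 0 <= (Num.truncn (alpha + 2)).+1%:R :> R by [].
  by move: _.+1%:R => s; rewrite mulr2n; lra.
have hk1 : alpha + 2 <= k.+1%:R *+ 2 by apply: le_trans hk _; rewrite lerMn2r ler_nat leqnSn.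
exists (Bergman (mem_bergman (hol0_test_fun k.+1) (test_fun_lty hk))).
exists (Bergman (mem_bergman (hol0_test_fun k.+2) (test_fun_lty hk1))) => z z0 /=.
rewrite /test_fun z0; split; first by rewrite expf_neq0// invr_neq0// Re_gt0_neq0.
by rewrite exprSr.
Qed.

End test_functions.

(** * Separability *)

Section hilbert.
Context (R : realType) (alpha : R).
Hypothesis al : -1 < alpha.
Local Notation V := (bergman alpha).
Local Notation n2 := (@sqn R alpha).
Local Notation nrm := (@nrm R alpha).
Implicit Types (f g h u v w m : V) (t : R) (b c l z : R[i]).

(* The real part of the inner product. *)
Definition ip u v : R := (n2 (u + v) - n2 u - n2 v) / 2.

Lemma ipC u v : ip u v = ip v u.
Proof. by rewrite /ip [v + u]addrC addrAC. Qed.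

Lemma ipE u v : n2 (u + v) = n2 u + n2 v + 2 * ip u v.
Proof. by rewrite /ip; field. Qed.

Lemma sqn_addZ u v t : n2 (u + t%:C *: v) = n2 u + 2 * t * ip u v + t ^+ 2 * n2 v.
Proof. by rewrite sqn_line ipE; ring. Qed.

Lemma sqn_sub u v : n2 (u - v) = n2 u + n2 v - 2 * ip u v.
Proof. have := parallelogram u v; rewrite ipE; lra. Qed.

Lemma ipZr u v t : ip u (t%:C *: v) = t * ip u v.
Proof. by rewrite {1}/ip sqn_addZ sqnZ normc_real real_normK ?num_real//; field. Qed.

Lemma ipNr u v : ip u (- v) = - ip u v.
Proof. by rewrite -[X in ip u X]scaleN1r -(rmorphN1 (real_complex R)) ipZr mulN1r. Qed.

Lemma ipNl u v : ip (- u) v = - ip u v.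
Proof. by rewrite ipC ipNr ipC. Qed.

Lemma ip_id u : ip u u = n2 u.
Proof. by rewrite /ip -mulr2n -scaler_nat sqnZ -(rmorph_nat (real_complex R)) normc_real normr_nat; field. Qed.

(** The theorem of Jordan and von Neumann: additivity is a linear combination of four instances of
    the parallelogram law. *)
Lemma ipDr u v w : ip u (v + w) = ip u v + ip u w.
Proof.
have P1 := parallelogram (u + v) w; have P2 := parallelogram (u + w) v.
have P3 := parallelogram u (v - w); have P4 := parallelogram v w.
have E1 : u + w + v = u + v + w by exact: addrAC.
have E2 : u + w - v = u - (v - w) by rewrite opprB addrA.
have E3 : u + v - w = u + (v - w) by rewrite addrA.
rewrite /ip addrA; rewrite E1 E2 in P2; rewrite E3 in P1.
move: (n2 (u + v + w)) (n2 (u - (v - w))) (n2 (u + (v - w))) (n2 (v - w)) (n2 (v + w))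
  (n2 (u + v)) (n2 (u + w)) (n2 u) (n2 v) (n2 w) P1 P2 P3 P4 => *; lra.
Qed.

Lemma ipDl u v w : ip (u + v) w = ip u w + ip v w.
Proof. by rewrite ipC ipDr ![ip w _]ipC. Qed.

Lemma ip_unitary u v l : normc l = 1 -> ip (l *: u) (l *: v) = ip u v.
Proof. by move=> l1; rewrite /ip -scalerDr !sqnZ l1 expr1n !mul1r. Qed.

Lemma ipCS u v : ip u v ^+ 2 <= n2 u * n2 v.
Proof.
have [v0|v0] := eqVneq (n2 v) 0.
  have -> : v = 0 by exact: sqn_eq0.
  by rewrite /ip addr0 sqn0 subr0 subrr mul0r mulr0 expr0n.
have v1 : 0 < n2 v by rewrite lt_neqAle eq_sym v0 sqn_ge0.
have := sqn_ge0 (u + (- (ip u v / n2 v))%:C *: v); rewrite sqn_addZ.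
set x := ip u v => h; rewrite -ler_pdivrMr//.
have -> : x ^+ 2 / n2 v = - (2 * (- (x / n2 v)) * x + (- (x / n2 v)) ^+ 2 * n2 v) by field.
lra.
Qed.

Lemma half_pow_cvg (a : R) : a / 2 ^+ n @[n --> \oo] --> (0 : R).
Proof.
rewrite -[X in _ --> X](mulr0 a); apply: cvgM; first exact: cvg_cst.
under eq_fun do rewrite -exprVn; apply: cvg_expr.
by rewrite ger0_norm ?invr_ge0// invf_lt1// ltr1n.
Qed.

Lemma cvg0_small (d : nat -> R) e : d n @[n --> \oo] --> (0 : R) -> 0 < e ->
  exists N, forall n, (N <= n)%N -> `|d n| < e.
Proof.
move=> /cvgrPdist_lt h /h [N _ hN]; exists N => n /hN.
by rewrite sub0r normrN.
Qed.

(* A minimising sequence is Cauchy by the parallelogram law. *)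
Lemma nearest_point (M : set V) h : M 0 ->
  (forall x y, M x -> M y -> M ((2^-1 : R)%:C *: (x + y))) ->
  exists p, (forall e : R, 0 < e -> exists2 m, M m & nrm (p - m) < e) /\
            (forall m, M m -> nrm (h - p) <= nrm (h - m)).
Proof.
move=> M0 Mmid; pose S := [set n2 (h - m) | m in M].
have lbS : has_lbound S by exists 0 => _ [m _ <-]; exact: sqn_ge0.
have S0 : S !=set0 by exists (n2 (h - 0)), 0.
have infS : has_inf S by [].
pose I := inf S.
(* An excess of [4^-n] over the infimum makes the squared distance of two later terms at most
   [4 * 4^-n], by the parallelogram law and the midpoint hypothesis; hence the rate [2 / 2 ^+ n]
   below. *)
have P n : exists m, M m /\ n2 (h - m) < I + (4 ^+ n)^-1.
  have p4 : 0 < (4 ^+ n)^-1 :> R by rewrite invr_gt0 exprn_gt0.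
  have [_ [m Mm <-] hm] := inf_adherent p4 infS.
  by exists m.
have [ms hms] := choice P.
have Ile m : M m -> I <= n2 (h - m).
  by move=> Mm; apply: ge_inf => //; exists m.
have d0 n : 0 <= 2 / 2 ^+ n :> R by rewrite divr_ge0 ?exprn_ge0.
have cau n k : (n <= k)%N -> nrm (ms k - ms n) <= 2 / 2 ^+ n.
  move=> nk; apply: nrm_le => //.
  have [Mn hn] := hms n; have [Mk hk] := hms k.
  have := parallelogram (h - ms n) (h - ms k).
  have -> : h - ms n + (h - ms k) = 2%:C *: (h - (2^-1 : R)%:C *: (ms n + ms k)).
    rewrite scalerBr scalerA -rmorphM /= divff// scale1r.
    rewrite (_ : 2%:C = 2%:R :> R[i]) ?rmorph_nat// scaler_nat mulr2n.
    by rewrite opprD addrACA.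
  have -> : h - ms n - (h - ms k) = ms k - ms n by rewrite opprB addrC addrA subrK.
  rewrite sqnZ normc_real normr_nat.
  have := Ile _ (Mmid _ _ Mn Mk).
  have -> : (2 / 2 ^+ n) ^+ 2 = 4 * (4 ^+ n)^-1 :> R.
    by rewrite expr_div_n -exprM mulnC exprM -!natrX.
  have : (4 ^+ k)^-1 <= (4 ^+ n)^-1 :> R.
    by rewrite lef_pV2 ?posrE ?exprn_gt0// ler_weXn2l// ler1n.
  move: hn hk; move: ((4 ^+ k)^-1) ((4 ^+ n)^-1) (n2 (h - ms n)) (n2 (h - ms k)) (n2 (ms k - ms n)).
  by move: (n2 _) => x a b c d e *; lra.
have [p hp] := bergman_complete d0 (half_pow_cvg 2) cau.
have small (e : R) : 0 < e -> exists2 n, 2 / 2 ^+ n < e & (4 ^+ n)^-1 < e ^+ 2.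
  move=> e0; have [N hN] := cvg0_small (half_pow_cvg 2) e0.
  have := hN N (leqnn N); rewrite ger0_norm// => h1; exists N => //.
  apply: le_lt_trans (_ : (2 / 2 ^+ N) ^+ 2 < _); last first.
    by rewrite ltr_pXn2r// nnegrE// ltW.
  have -> : (2 / 2 ^+ N) ^+ 2 = 4 * (4 ^+ N)^-1 :> R.
    by rewrite expr_div_n -exprM mulnC exprM -!natrX.
  by rewrite ler_peMl ?invr_ge0 ?exprn_ge0// ler1n.
exists p; split=> [e e0|m Mm].
  have [n h1 _] := small e e0; exists (ms n); first by have [] := hms n.
  exact: le_lt_trans (hp n) h1.
apply/ler_addgt0Pr => e e0; have e2 : 0 < e / 2 by rewrite divr_gt0.
have [n h1 h2] := small _ e2; have [Mn hn] := hms n.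
have k1 : nrm (h - p) <= nrm (h - ms n) + e / 2.
  rewrite (_ : h - p = (h - ms n) + (ms n - p)); last by rewrite addrA subrK.
  by apply: le_trans (nrmD _ _) _; rewrite lerD2l nrmB (le_trans (hp n))// ltW.
have k2 : nrm (h - ms n) <= nrm (h - m) + e / 2.
  apply: nrm_le; first by rewrite addr_ge0 ?nrm_ge0// ltW.
  rewrite sqrrD sqr_nrm; have := Ile m Mm; have := nrm_ge0 (h - m).
  rewrite mulr2n; nra.
lra.
Qed.

(** Minimality at [t = 0] kills the linear term [2 * t * ip u m], and the expansion of the square
    reduces to Pythagoras. *)
Lemma line_orthogonal u m : (forall t, n2 u <= n2 (u + t%:C *: m)) -> n2 u + n2 m <= n2 (u + m).
Proof.
move=> h; have hip : ip u m = 0.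
  have [m0|m0] := eqVneq (n2 m) 0.
    have := ipCS u m; rewrite m0 mulr0 => h0; apply/eqP; rewrite -sqrf_eq0 eq_le h0/=.
    exact: sqr_ge0.
  have := h (- (ip u m / n2 m)); rewrite sqn_addZ; set x := ip u m => h1.
  have : x ^+ 2 / n2 m <= 0.
    have -> : x ^+ 2 / n2 m = - (2 * (- (x / n2 m)) * x + (- (x / n2 m)) ^+ 2 * n2 m) by field.
    lra.
  rewrite pmulr_lle0 ?invr_gt0; last by rewrite lt_neqAle eq_sym m0 sqn_ge0.
  by move=> h2; apply/eqP; rewrite -sqrf_eq0 eq_le h2 sqr_ge0.
by rewrite ipE hip mulr0 addr0.
Qed.

(* [u] spans the orthogonal complement of the kernel of the evaluation at [z]. *)
Lemma kernel_vector z : 0 < complex.Re z ->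
  exists u : V, u z != 0 /\ forall m, m z = 0 -> n2 u + n2 m <= n2 (u + m).
Proof.
move=> z0; have [h [_ /(_ z z0) [hz _]]] := exists_test_functions al.
have [K K0 hK] := eval_nrm alpha z0.
have Mmid (x y : V) : x z = 0 -> y z = 0 -> ((2^-1 : R)%:C *: (x + y)) z = 0.
  by move=> x0 y0; rewrite bergmanZ bergmanD x0 y0 addr0 mulr0.
have [p [pM hp]] := @nearest_point [set m : V | m z = 0] h (bergman0 alpha z) Mmid.
have pz : p z = 0.
  apply/eqP; rewrite -[_ == 0]negbK -normc_gt0 -leNgt; apply/ler_addgt0Pr => e e0.
  have e1 : 0 < e / K by rewrite divr_gt0.
  have [m /= mz hm] := pM _ e1; rewrite add0r.
  have := hK (p - m); rewrite bergmanD bergmanN mz subr0 => /le_trans; apply.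
  by rewrite mulrC -ler_pdivlMr// ltW.
exists (h - p); split; first by rewrite bergmanD bergmanN pz subr0.
move=> m mz; apply: line_orthogonal => t.
have pmz : (p - t%:C *: m) z = 0 by rewrite bergmanD bergmanN bergmanZ mz mulr0 subr0.
have := hp _ pmz.
rewrite -(@ler_pXn2r _ 2)// ?nnegrE ?nrm_ge0// !sqr_nrm.
by rewrite opprB addrA addrAC.
Qed.

(** A [g] orthogonal to [u] lies in the kernel of the evaluation. Otherwise write [g = c *: u + m]
    with [c] nonzero and [m z = 0]: orthogonality of [u] and [m] gives
    [|g|^2 >= |c|^2 |u|^2 + |m|^2 > |m|^2], against the minimality of [g]. *)
Lemma orthogonal_kernel_eval z u g : 0 < complex.Re z -> u z != 0 ->
  (forall m, m z = 0 -> n2 u + n2 m <= n2 (u + m)) ->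
  (forall c, n2 g <= n2 (g + c *: u)) -> g z = 0.
Proof.
move=> z0 uz hu hg; apply/eqP/negPn/negP => gz.
pose c := g z / u z; have c0 : c != 0 by rewrite mulf_neq0// invr_neq0.
pose m := g - c *: u; have mz : m z = 0.
  by rewrite /m bergmanD bergmanN bergmanZ /c divfK// subrr.
have h1 := hg (- c); rewrite scaleNr -/m in h1.
have gE : g = c *: (u + c^-1 *: m) by rewrite scalerDr scalerA mulfV// scale1r /m addrC subrK.
have mz' : (c^-1 *: m) z = 0 by rewrite bergmanZ mz mulr0.
have := hu _ mz'; have c1 : 0 < normc c by rewrite normc_gt0.
have c2 : 0 < normc c ^+ 2 by rewrite exprn_gt0.
rewrite -(ler_pM2l c2) mulrDr -[in X in _ <= X -> _]sqnZ -gE sqnZ normcV exprVn mulrA mulfV ?gt_eqF// mul1r.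
have u0 : u != 0 by apply: contra_neq uz => ->; rewrite bergman0.
have := mulr_gt0 c2 (sqn_gt0 u0); lra.
Qed.

Definition qc (r : rat * rat) : R[i] := ratr r.1 +i* ratr r.2.

Lemma qcM (r : rat) s : qc (r * s.1, r * s.2) = (ratr r)%:C * qc s.
Proof.
transitivity (((ratr r * ratr s.1) +i* (ratr r * ratr s.2)) : R[i]).
  by rewrite /qc /= !rmorphM.
rewrite /qc; move: (ratr r : R) (ratr s.1 : R) (ratr s.2 : R) => x y z.
by apply/eqP; rewrite eq_complex /= !mul0r subr0 addr0 !eqxx.
Qed.

Lemma qc_dense c e : 0 < e -> exists r, normc (c - qc r) < e.
Proof.
move=> e0; have h (x : R) : exists r : rat, `|x - ratr r| < e / 2.
  have xe : x - e / 2 < x + e / 2 by lra.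
  have [r] := rat_in_itvoo xe; rewrite in_itv/= => hr; exists r; rewrite ltr_distlC//; lra.
case: c => x y; have [r hr] := h x; have [s hs] := h y; exists (r, s).
apply: le_lt_trans (normc_le_ReIm _) _ => /=; lra.
Qed.

Lemma bergman_eq0_rat g : (forall r, 0 < complex.Re (qc r) -> g (qc r) = 0) -> g = 0.
Proof.
move=> hg; apply: bergman_ext => -[x y] x0; rewrite bergman0.
apply/eqP; rewrite -[_ == 0]negbK -normc_gt0 -leNgt; apply/ler_addgt0Pr => e e0.
have [d d0 hd] := cdiff_ccont (hol0_cdiff y (bergman_hol0 g) x0) e0.
have m0 : 0 < Num.min d x by rewrite lt_min d0.
have [r] := qc_dense (x +i* y) m0; rewrite lt_min => /andP[h1 h2].
rewrite normcC in h1; have := hd _ h1.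
have r0 : 0 < complex.Re (qc r).
  by have := le_lt_trans (normc_Re _) h2; rewrite /= ltr_norml; lra.
by rewrite hg// sub0r normcNr add0r => /ltW.
Qed.

(** The countable set consists of combinations, with rational complex coefficients, of the vectors
    of [kernel_vector] at rational points. What is orthogonal to all of them vanishes at every
    rational point, hence is 0. As [D] is closed only under rational operations, [nearest_point] is
    stated for midpoints instead of subspaces. *)
Lemma bergman_separable : exists zs : nat -> V, forall h (e : R), 0 < e -> exists n, nrm (h - zs n) < e.
Proof.
have P r : exists u : V, 0 < complex.Re (qc r) ->
    u (qc r) != 0 /\ forall m, m (qc r) = 0 -> n2 u + n2 m <= n2 (u + m).
  have [r0|r0] := ltP 0 (complex.Re (qc r)); last by exists 0.
  by have [u hu] := kernel_vector r0; exists u.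
have [U hU] := choice P.
pose G (s : seq ((rat * rat) * (rat * rat))) : V := \sum_(p <- s) qc p.1 *: U p.2.
pose D := range G.
have D0 : D 0 by exists [::] => //; rewrite /G big_nil.
have DD x y : D x -> D y -> D (x + y).
  by move=> [s _ <-] [s' _ <-]; exists (s ++ s') => //; rewrite /G big_cat.
have DZ (r : rat) x : D x -> D ((ratr r : R)%:C *: x).
  move=> [s _ <-]; exists [seq ((r * p.1.1, r * p.1.2), p.2) | p <- s] => //.
  rewrite /G big_map scaler_sumr; apply: eq_bigr => p _ /=; rewrite scalerA.
  by rewrite qcM.
have DU r s : D (qc r *: U s) by exists [:: (r, s)] => //; rewrite /G big_seq1.
have clD h e : 0 < e -> exists2 m, D m & nrm (h - m) < e.
  move=> e0; have Dmid x y : D x -> D y -> D ((2^-1 : R)%:C *: (x + y)).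
    by move=> Dx Dy; have := DZ (2^-1) _ (DD _ _ Dx Dy); rewrite fmorphV rmorph_nat.
  have [p [pD hp]] := @nearest_point D h D0 Dmid.
  suff hp0 : h - p = 0.
    by rewrite (subr0_eq hp0); exact: pD.
  apply: bergman_eq0_rat => r r0; have [Ur hUr] := hU r r0.
  apply: (orthogonal_kernel_eval r0 Ur hUr) => c.
  rewrite -!sqr_nrm ler_pXn2r// ?nnegrE ?nrm_ge0//; apply/ler_addgt0Pr => d d0.
  have d2 : 0 < d / 2 by rewrite divr_gt0.
  have d3 : 0 < d / 2 / (nrm (U r) + 1) by rewrite divr_gt0// ltr_wpDl ?nrm_ge0.
  (* Minimality of [p] compares with elements of [D] only, so [p] and the coefficient [- c] are both
     approximated from there, at a cost of [d / 2] each. *)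
  have [s hs] := qc_dense (- c) d3; have [m Dm hm] := pD _ d2.
  apply: le_trans (hp _ (DD _ _ Dm (DU s r))) _.
  rewrite (_ : h - (m + qc s *: U r) = (h - p + c *: U r) + (p - m) + (- c - qc s) *: U r); last first.
    by rewrite scalerBl scaleNr opprD addrA [h - p + c *: U r + (p - m)]addrAC [h - p + (p - m)]addrA subrK [RHS]addrA addrK.
  apply: le_trans (nrmD _ _) _; have := nrmD (h - p + c *: U r) (p - m).
  have : nrm ((- c - qc s) *: U r) <= d / 2; last lra.
  rewrite nrmZ; move: hs; rewrite ltr_pdivlMr ?ltr_wpDl ?nrm_ge0// => /ltW; apply: le_trans.
  by rewrite ler_wpM2l ?normc_ge0// lerDl.
exists (fun n => if unpickle n is Some s then G s else 0) => h e e0.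
have [_ [s _ <-] hs] := clD h e e0.
by exists (pickle s); rewrite pickleK.
Qed.

End hilbert.

(** * The translation semigroup *)

(* Otherwise unification compares norms by unfolding them down to integrals. *)
Local Opaque sqn nrm.

Section translation_semigroup.
Context (R : realType) (alpha : R).
Hypothesis al : -1 < alpha.
Local Notation V := (bergman alpha).
Local Notation n2 := (@sqn R alpha).
Local Notation nrm := (@nrm R alpha).
Local Notation C a b := (@composition_op R alpha (affine_symbol a b)).
Local Notation kap := (@dilation_factor R alpha).
Implicit Types (f g h u v w : V) (a s t e : R) (b c l z : R[i]).

Definition transl t (f : V) : V := C 1 t%:C f.
Local Notation T := transl.

Lemma kap1 : kap 1 = 1.
Proof. by rewrite /dilation_factor powR1 expr1n mulr1 invr1. Qed.

Lemma kap_gt0 a : 0 < a -> 0 < kap a.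
Proof. by move=> a0; rewrite invr_gt0 mulr_gt0 ?exprn_gt0 ?powR_gt0. Qed.

Lemma kapM a s : 0 < a -> 0 < s -> kap (a * s) = kap a * kap s.
Proof. by move=> a0 s0; rewrite /dilation_factor powRM ?ltW// -invfM exprMn mulrACA. Qed.

Lemma kap_le1 a : 1 <= a -> kap a <= 1.
Proof.
move=> a1; have a0 : 0 < a by exact: lt_le_trans a1.
rewrite /dilation_factor invf_le1 ?mulr_gt0 ?exprn_gt0 ?powR_gt0//.
rewrite -[_ ^+ 2]powR_mulrn ?(ltW a0)// -powRD; last by apply/implyP => _; rewrite gt_eqF.
by rewrite -[leLHS](powRr0 a); apply: ler_powR => //; have := al; lra.
Qed.

(** The dilation and the imaginary translation form an automorphism; up to the factor [kap a], the
    norm sees only the translation by [Re b]. *)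
Lemma cop_sqn a b f : 0 < a -> 0 <= complex.Re b -> n2 (C a b f) = kap a * n2 (T (complex.Re b) f).
Proof.
move=> a0 b0; have b00 : 0 <= complex.Re (0 +i* complex.Im b) by [].
have b01 : 0 <= complex.Re (complex.Re b)%:C by [].
have -> : C a b f = C a (0 +i* complex.Im b) (T (complex.Re b) f).
  rewrite /transl (cop_comp al f a0 b00 ltr01 b01) rmorph1 !mul1r.
  by congr (C _ _ f); case: b {b0 b00 b01} => x y; apply/eqP; rewrite eq_complex /= add0r addr0 !eqxx.
exact: (cop_auto al a0 b00).
Qed.

Lemma transl_val t f z : 0 <= t -> 0 < complex.Re z -> T t f z = f (z + t%:C).
Proof. by move=> t0 z0; rewrite /transl (cop_val al)// rmorph1 mul1r. Qed.

Lemma translB t f g : 0 <= t -> T t (f - g) = T t f - T t g.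
Proof. by move=> t0; exact: (copB al ltr01 (t0 : 0 <= complex.Re t%:C)). Qed.

Lemma translD t f g : 0 <= t -> T t (f + g) = T t f + T t g.
Proof. by move=> t0; exact: (copD al ltr01 (t0 : 0 <= complex.Re t%:C)). Qed.

Lemma transl_transl s t f : 0 <= s -> 0 <= t -> T s (T t f) = T (s + t) f.
Proof.
move=> s0 t0; rewrite /transl (cop_comp al)//.
by rewrite mul1r rmorph1 mul1r -rmorphD.
Qed.

Lemma transl_le t f : 0 <= t -> n2 (T t f) <= n2 f.
Proof. by move=> t0; have := cop_le al ltr01 (t0 : 0 <= complex.Re t%:C) f; rewrite kap1 mul1r. Qed.

Lemma transl_mono s t f : 0 <= s -> s <= t -> n2 (T t f) <= n2 (T s f).
Proof.
move=> s0 st; have ts : 0 <= t - s by rewrite subr_ge0.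
by rewrite -[t](subrK s) -(transl_transl _ ts s0); exact: transl_le.
Qed.

Lemma transl_gram t f : 0 < t -> n2 (f - T (t + t) f) = n2 f + n2 (T (t + t) f) - 2 * n2 (T t f).
Proof. by move=> t0; rewrite (gram al f t0) addrK. Qed.

Lemma transl_logconvex t f : 0 < t -> n2 (T t f) ^+ 2 <= n2 f * n2 (T (t + t) f).
Proof.
move=> t0; have -> : n2 (T t f) = ip f (T (t + t) f); last exact: ipCS.
by have := transl_gram f t0; rewrite sqn_sub; move: (ip _ _) (n2 _) (n2 _) (n2 _) => x y z w; lra.
Qed.

(** The value of [T t f] at [z] is that of [f] at [z + t], where the squared evaluation bound decays
    like [(x + t)^-(2 + alpha)]; [X] comes from solving for the point where the bound reaches
    [e ^+ 2]. *)
Lemma transl_vanish z f e : 0 < complex.Re z -> 0 < e ->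
  exists X, forall t, 0 <= t -> X <= t -> normc (T t f z) <= e.
Proof.
case: z => x y /= x0 e0; have [K K0 hK] := eval_bound alpha.
have a2 : 0 < 2 + alpha by have := al; lra.
pose X := (K * n2 f / e ^+ 2) `^ (2 + alpha)^-1.
have X0 : 0 <= X by exact: powR_ge0.
exists X => t t0 Xt; rewrite transl_val//.
have -> : (x +i* y) + t%:C = (x + t) +i* y by apply/eqP; rewrite eq_complex /= addr0 !eqxx.
have xt : 0 < x + t by rewrite ltr_wpDr.
rewrite -(@ler_pXn2r _ 2)// ?nnegrE ?normc_ge0 ?(ltW e0)//.
have := hK f _ y (bergman_hol0 f) xt; rewrite sqnE -EFinM lee_fin => /le_trans; apply.
have p0 : 0 < (x + t) ^+ 2 * (x + t) `^ alpha by rewrite mulr_gt0 ?exprn_gt0 ?powR_gt0.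
rewrite mulrAC ler_pdivrMr//.
rewrite -ler_pdivrMl ?exprn_gt0// mulrC.
have -> : (x + t) ^+ 2 * (x + t) `^ alpha = (x + t) `^ (2 + alpha).
  by rewrite powRD ?powR_mulrn ?(ltW xt)//; apply/implyP => _; rewrite gt_eqF.
have -> : K * n2 f / e ^+ 2 = X `^ (2 + alpha).
  rewrite /X -powRrM mulVf ?gt_eqF// powRr1// divr_ge0 ?sqr_ge0// mulr_ge0 ?sqn_ge0//; exact: ltW.
by apply: ge0_ler_powR; rewrite ?nnegrE ?(ltW a2) ?(ltW xt)//; apply: le_trans Xt _; rewrite lerDr ltW.
Qed.

(* The Gram identity bounds [|T_X f - T_(X+2n) f|^2] by [|T_X f|^2] minus the infimum of
   the [|T_t f|^2], and [T_(X+2n) f] vanishes pointwise, so Fatou's lemma applies. *)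
Lemma transl_decay f e : 0 < e -> exists2 X, 0 <= X & forall t, X <= t -> n2 (T t f) <= e.
Proof.
move=> e0; pose S := [set n2 (T t f) | t in [set t | 0 <= t]].
have infS : has_inf S.
  by split; [exists (n2 (T 0 f)), 0 => //=|exists 0 => _ [t _ <-]; exact: sqn_ge0].
have [_ [X X0 <-] hX] := inf_adherent e0 infS.
have lbS t : 0 <= t -> inf S <= n2 (T t f).
  by move=> t0; apply: ge_inf; [case: infS|exists t].
exists X => // t Xt; apply: le_trans (transl_mono _ X0 Xt) _.
pose us n := T X f - T (n.+1%:R + n.+1%:R) (T X f).
have n0 (n : nat) : 0 < n.+1%:R :> R by [].
apply: (@sqn_fatou R alpha us) => [z z0|n].
  apply/cvgrPdist_le => d d0; have [Y hY] := transl_vanish (T X f) z0 d0.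
  near=> n; rewrite sub0r normrN ger0_norm ?normc_ge0//.
  rewrite /us bergmanD bergmanN addrAC subrr sub0r normcNr; apply: hY.
    by rewrite addr_ge0.
  apply: (@le_trans _ _ n%:R); first by near: n; exact: nbhs_infty_ger.
  by rewrite -natrD ler_nat addSn leqW// leq_addr.
have XN : 0 <= X + n.+1%:R by rewrite addr_ge0.
have := transl_gram (T X f) (n0 n); rewrite /us => ->.
have := lbS _ XN; have := transl_mono (T X f) (ltW (n0 n)) (_ : n.+1%:R <= n.+1%:R + n.+1%:R).
rewrite lerDl ler0n => /(_ isT).
rewrite (transl_transl f (ltW (n0 n)) X0) [n.+1%:R + X]addrC.
move: (n2 _) (n2 _) (n2 (T X f)) (inf S) hX => a b c d *; lra.
Unshelve. all: by end_near. Qed.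

Lemma half_powS t k : t / 2 ^+ k.+1 + t / 2 ^+ k.+1 = t / 2 ^+ k.
Proof. by rewrite exprS; field; rewrite gt_eqF ?exprn_gt0. Qed.

(** Fatou's lemma along [d / 2 ^+ k] prevents a loss of norm in the limit, and the Gram identity
    bounds the squared distance from [f] to [T (s + s) f] by the loss [n2 f - n2 (T s f)]. *)
Lemma transl_cvg0 f d e : 0 < d -> 0 < e -> exists k, nrm (f - T (d / 2 ^+ k) f) < e.
Proof.
move=> d0 e0; have s0 k : 0 < d / 2 ^+ k by rewrite divr_gt0 ?exprn_gt0.
have e2 : 0 < e ^+ 2 / 2 by rewrite divr_gt0 ?exprn_gt0.
have [k hk] : exists k, n2 f - e ^+ 2 / 2 < n2 (T (d / 2 ^+ k.+1) f).
  apply: contrapT => /forallNP h; suff : n2 f <= n2 f - e ^+ 2 / 2 by lra.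
  apply: (@sqn_fatou R alpha (fun k => T (d / 2 ^+ k.+1) f)) => [[x y] z0|k]; last first.
    by rewrite leNgt; apply/negP; exact: h.
  apply/cvgrPdist_le => r r0.
  have [dl dl0 hdl] := cdiff_ccont (hol0_cdiff y (bergman_hol0 f) z0) r0.
  have [N hN] := cvg0_small (half_pow_cvg d) dl0.
  exists N => // k Nk; rewrite sub0r normrN ger0_norm ?normc_ge0// (transl_val _ (ltW (s0 _)) z0).
  apply/ltW/hdl; rewrite addrC addKr normc_real; apply: hN.
  exact: leq_trans (leqnSn k).
exists k; rewrite -(@ltr_pXn2r _ 2)// ?nnegrE ?nrm_ge0 ?(ltW e0)// sqr_nrm.
rewrite -half_powS transl_gram//.
have := transl_mono f (ltW (s0 k.+1)) (_ : d / 2 ^+ k.+1 <= d / 2 ^+ k.+1 + d / 2 ^+ k.+1).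
rewrite lerDl (ltW (s0 _)) => /(_ isT).
by move: (n2 _) (n2 _) (n2 _) hk => x y z *; lra.
Qed.

(* For [u_(n+1) = u_n - T_2t u_n] the Gram identity makes the series of the [|T_t u_n|^2]
   converge, while [T_t u_n] stays in [T_t f - ran T_2t]. *)
Lemma transl_range_double t f e : 0 < t -> 0 < e -> exists g, nrm (T t f - T (t + t) g) < e.
Proof.
move=> t0 e0; have tt0 : 0 < t + t by rewrite addr_gt0.
pose u n := iter n (fun v => v - T (t + t) v) f.
have uE n : exists g, u n = f - T t g.
  elim: n => [|n [g IH]].
    by exists 0; rewrite -[X in T t X](subrr f) translB ?subrr ?subr0// ltW.
  exists (g + T t (u n)); rewrite /u iterS -/(u n) translD ?ltW// transl_transl ?ltW//.
  by rewrite opprD addrA -IH.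
have [n hn] : exists n, n2 (T t (u n)) < e ^+ 2.
  apply: contrapT => /forallNP h.
  have h2 n : n2 (u n) <= n2 f - n%:R * e ^+ 2.
    elim: n => [|n IH]; first by rewrite mul0r subr0.
    rewrite /u iterS -/(u n) transl_gram//.
    have := h n; move/negP; rewrite -leNgt.
    have := transl_mono (u n) (ltW t0) (_ : t <= t + t); rewrite lerDl ltW// => /(_ isT).
    rewrite -natr1 mulrDl mul1r; move: (n2 _) (n2 _) (n2 _) (n2 _) IH => x y z w; lra.
  have e2 : 0 < e ^+ 2 by rewrite exprn_gt0.
  have := h2 (Num.truncn (n2 f / e ^+ 2)).+1; have := truncnS_gt (n2 f / e ^+ 2).
  rewrite ltr_pdivrMr// => h3 h4; have := sqn_ge0 (u (Num.truncn (n2 f / e ^+ 2)).+1).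
  by move: h3 h4; lra.
have [g gE] := uE n; exists g.
rewrite -transl_transl ?ltW// -translB ?ltW// -gE.
by rewrite -(@ltr_pXn2r _ 2)// ?nnegrE ?nrm_ge0 ?(ltW e0)// sqr_nrm.
Qed.

Lemma sqn_le_sqrt f e : 0 <= e -> nrm f <= Num.sqrt e -> n2 f <= e.
Proof.
move=> e0 h; rewrite -sqr_nrm -[leRHS](sqr_sqrtr e0).
by apply: lerXn2r; rewrite ?nnegrE ?nrm_ge0 ?sqrtr_ge0.
Qed.

Lemma nrm_tri f g h : nrm (f - h) <= nrm (f - g) + nrm (g - h).
Proof. by have := nrmD (f - g) (g - h); rewrite addrA subrK. Qed.

Lemma nrm_tri_lt f g h e : nrm (f - g) < e / 2 -> nrm (g - h) < e / 2 -> nrm (f - h) < e.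
Proof.
move=> h1 h2; apply: le_lt_trans (nrm_tri f g h) _.
by rewrite [e]splitr; exact: ltrD.
Qed.

(** Strong continuity approximates [f] from the range at a time [t / 2 ^+ k], and
    [transl_range_double] carries the approximation from each dyadic time to its double. *)
Lemma transl_dense_range t f e : 0 < t -> 0 < e -> exists g, nrm (f - T t g) < e.
Proof.
move=> t0 e0; have s0 k : 0 < t / 2 ^+ k by rewrite divr_gt0 ?exprn_gt0.
have H k h d : 0 < d -> exists g, nrm (T (t / 2 ^+ k) h - T t g) < d.
  elim: k h d => [|k IH] h d d0; first by exists h; rewrite expr0 divr1 subrr nrm0.
  have d2 : 0 < d / 2 by rewrite divr_gt0.
  have [g1 hg1] := transl_range_double h (s0 k.+1) d2.
  rewrite half_powS in hg1; have [g hg] := IH g1 _ d2; exists g.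
  exact: nrm_tri_lt hg1 hg.
have e3 : 0 < e / 2 by rewrite divr_gt0.
have [k hk] := transl_cvg0 f t0 e3; have [g hg] := H k f _ e3; exists g.
exact: nrm_tri_lt hk hg.
Qed.

(** Log-convexity passes a zero from time [2s] back to time [s]; along [t / 2 ^+ k] strong
    continuity brings it to time 0. *)
Lemma transl_inj0 t f : 0 < t -> n2 (T t f) = 0 -> f = 0.
Proof.
move=> t0 Tf; have s0 k : 0 < t / 2 ^+ k by rewrite divr_gt0 ?exprn_gt0.
have H k : n2 (T (t / 2 ^+ k) f) = 0.
  elim: k => [|k IH]; first by rewrite expr0 divr1.
  have := transl_logconvex f (s0 k.+1); rewrite half_powS IH mulr0 => h.
  by apply/eqP; rewrite -sqrf_eq0 eq_le h sqr_ge0.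
apply: sqn_eq0; apply/eqP; rewrite eq_le sqn_ge0 andbT; apply/ler_addgt0Pr => e e0.
have e1 : 0 < Num.sqrt e by rewrite sqrtr_gt0.
have [k] := transl_cvg0 f t0 e1.
rewrite (sqn_eq0 (H k)) subr0 add0r => hf; apply: sqn_le_sqrt; exact: ltW.
Qed.

End translation_semigroup.

(** * Necessity *)

Section necessity.
Context (R : realType) (alpha : R).
Hypothesis al : -1 < alpha.
Local Notation V := (bergman alpha).
Local Notation n2 := (@sqn R alpha).
Local Notation nrm := (@nrm R alpha).
Local Notation C a b := (@composition_op R alpha (affine_symbol a b)).
Local Notation kap := (@dilation_factor R alpha).
Local Notation T := (@transl R alpha).
Implicit Types (f g h u v w : V) (a s t e : R) (b c l z : R[i]).

Definition projective_orbit_dense (S : V -> V) f :=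
  forall g e, 0 < e -> exists n l, nrm (g - l *: iter n S f) < e.

Lemma dense_le (S : V -> V) f (F G : V -> R) (K : R) :
  projective_orbit_dense S f -> 0 < K ->
  (forall g h, F g <= F h + K * nrm (g - h)) -> (forall g h, G h <= G g + K * nrm (g - h)) ->
  (forall n l, F (l *: iter n S f) <= G (l *: iter n S f)) -> forall g, F g <= G g.
Proof.
move=> Sf K0 hF hG FG g; apply/ler_addgt0Pr => e e0.
have e1 : 0 < e / 2 / K by rewrite !divr_gt0.
have [n [l]] := Sf g _ e1; rewrite ltr_pdivlMr// mulrC.
have := hF g (l *: iter n S f); have := hG g (l *: iter n S f); have := FG n l.
by move: (F g) (F _) (G g) (G _) (K * _) => x y z r k; lra.
Qed.

Lemma iterB (S : V -> V) n u v : (forall u v, S (u - v) = S u - S v) ->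
  iter n S (u - v) = iter n S u - iter n S v.
Proof. by move=> SB; elim: n => // n IH; rewrite !iterS IH SB. Qed.

Lemma iterZ (S : V -> V) n c u : (forall c u, S (c *: u) = c *: S u) ->
  iter n S (c *: u) = c *: iter n S u.
Proof. by move=> SZ; elim: n => // n IH; rewrite !iterS IH SZ. Qed.

Lemma nrm_iter (S : V -> V) s n u : (forall u, nrm (S u) = s * nrm u) ->
  nrm (iter n S u) = s ^+ n * nrm u.
Proof. by move=> hS; elim: n => [|n IH]; rewrite ?mul1r// iterS hS IH mulrA exprS. Qed.

Section similarity.
Variables (S : V -> V) (s : R) (f : V).
Hypotheses (SB : forall u v, S (u - v) = S u - S v) (SZ : forall c u, S (c *: u) = c *: S u).
Hypotheses (s0 : 0 <= s) (hS : forall u, nrm (S u) = s * nrm u).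
Hypotheses (f0 : f != 0) (Sf : projective_orbit_dense S f).

(** [S - c] commutes with the iterates of [S], so on an orbit vector it produces an iterate of
    [S f - c *: f]; iterates scale all norms alike, which fixes the ratio along the orbit. *)
Lemma similarity_shift c : exists K, forall g, nrm (S g - c *: g) = K * nrm g.
Proof.
have nf : 0 < nrm f by exact: nrm_gt0.
pose K := nrm (S f - c *: f) / nrm f; exists K.
have K0 : 0 <= K by rewrite divr_ge0 ?nrm_ge0.
have EQ n l : nrm (S (l *: iter n S f) - c *: (l *: iter n S f)) = K * nrm (l *: iter n S f).
  rewrite SZ scalerA [c * l]mulrC -scalerA -scalerBr !nrmZ.
  rewrite -iterS iterSr -(iterZ _ _ _ SZ) -(iterB _ _ _ SB) !(nrm_iter _ _ hS).
  by rewrite /K; field; rewrite gt_eqF.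
(* A common Lipschitz constant for both sides of the equality; the 1 makes it positive. *)
pose L := s + normc c + K + 1.
have L0 : 0 < L by rewrite ltr_wpDl// !addr_ge0 ?normc_ge0.
have lipF g h : nrm (S g - c *: g) <= nrm (S h - c *: h) + L * nrm (g - h).
  have -> : S g - c *: g = (S h - c *: h) + (S (g - h) - c *: (g - h)).
    by rewrite SB scalerBr addrACA [S h + _]addrC subrK -opprD [c *: h + _]addrC subrK.
  apply: le_trans (nrmD _ _) _; rewrite lerD2l; apply: le_trans (nrmD _ _) _.
  rewrite nrmN nrmZ hS -mulrDl; apply: ler_wpM2r; first exact: nrm_ge0.
  by rewrite /L -addrA lerDl addr_ge0.
have lipG g h : K * nrm g <= K * nrm h + L * nrm (g - h).
  apply: (@le_trans _ _ (K * (nrm h + nrm (g - h)))); first by rewrite ler_wpM2l// nrm_dist.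
  rewrite mulrDr lerD2l; apply: ler_wpM2r; first exact: nrm_ge0.
  by rewrite /L -addrA addrCA lerDl !addr_ge0// normc_ge0.
move=> g; apply/eqP; rewrite eq_le; apply/andP; split; move: g.
  apply: (dense_le Sf L0 lipF) => [g h|n l]; last by rewrite EQ.
  by rewrite [nrm (g - h)]nrmB; exact: (lipG h g).
apply: (dense_le Sf L0 lipG) => [g h|n l]; last by rewrite EQ.
by rewrite [nrm (g - h)]nrmB; exact: (lipF h g).
Qed.

(** In the expansion of [|S g - c g|^2] every term but the inner product is known to be a constant
    multiple of [n2 g]. *)
Lemma similarity_numerical_range c : normc c = 1 ->
  exists k, forall g, ip (S g) (c *: g) = k * n2 g.
Proof.
move=> c1; have [K hK] := similarity_shift c.
exists ((s ^+ 2 + 1 - K ^+ 2) / 2) => g.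
have := sqn_sub (S g) (c *: g); rewrite sqnZ c1 expr1n mul1r.
rewrite -[n2 (_ - _)]sqr_nrm hK -[n2 (S g)]sqr_nrm hS !exprMn !sqr_nrm.
by move: (ip _ _) (n2 g) => x y h; lra.
Qed.

(* The numerical range of [S] is a point; polarise. *)
Lemma similarity_scalar : exists c, forall g, S g = c *: g.
Proof.
have SN v : S (- v) = - S v by rewrite -scaleN1r SZ scaleN1r.
have SD u v : S (u + v) = S u + S v by rewrite -{1}[v]opprK SB SN opprK.
have [k1 h1] := similarity_numerical_range (normc1 R).
(* For unit [g] the constants for [1] and [- 'i] are the real part and minus the imaginary part of
   [<S g, g>], whence the scalar [k1 - k2 'i] below. *)
have [k2 h2] := @similarity_numerical_range (- 'i) ltac:(by rewrite normcNr normc_i).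
have pol c k : (forall g, ip (S g) (c *: g) = k * n2 g) ->
    forall u v, ip (S u) (c *: v) + ip (S v) (c *: u) = 2 * k * ip u v.
  move=> hk u v; have := hk (u + v); rewrite SD scalerDr ipDl !ipDr !hk ipE.
  by move: (ip _ _) (ip _ _) (ip _ _) (n2 u) (n2 v) => x y z p q h; lra.
have ii : 'i * 'i = -1 :> R[i] by rewrite -expr2 sqr_i.
have E u v : ip (S u) v = k1 * ip u v + k2 * ip u ('i *: v).
  have e1 := pol _ _ h1 u v; have e2 := pol _ _ h2 u ('i *: v).
  rewrite !scale1r in e1; rewrite SZ scalerA mulNr ii opprK scale1r scaleNr ipNr in e2.
  rewrite ip_unitary ?normc_i// in e2.
  by move: e1 e2; move: (ip _ _) (ip _ _) (ip _ _) (ip _ _) => x y z w; lra.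
exists (k1%:C - k2%:C * 'i) => u; apply/eqP; rewrite -subr_eq0; apply/eqP/sqn_eq0.
set w := S u - _; rewrite -ip_id {1}/w ipC ipDr ipNr ![ip w _]ipC E.
have ipZl t v x : ip (t%:C *: v) x = t * ip v x by rewrite ipC ipZr ipC.
rewrite scalerBl ipDl ipNl -scalerA !ipZl.
have -> : ip u ('i *: w) = - ip ('i *: u) w.
  rewrite -[ip ('i *: u) w](ip_unitary _ _ (_ : normc 'i = 1)) ?normc_i// scalerA ii scaleN1r ipNl opprK.
  by [].
ring.
Qed.

(** As [S] is a scalar, the projective orbit lies on the line through [f]. By density every [g] is a
    limit of multiples of [f], and evaluations are continuous. *)
Lemma similarity_rank_one g (z w : R[i]) : 0 < complex.Re z -> 0 < complex.Re w -> g z * f w = g w * f z.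
Proof.
move=> z0 w0; have [c hc] := similarity_scalar.
have [K K0 hK] := eval_nrm alpha z0; have [L L0 hL] := eval_nrm alpha w0.
have iE n : iter n S f = c ^+ n *: f.
  by elim: n => [|n IH]; rewrite ?scale1r// iterS IH hc scalerA exprS.
apply/eqP; rewrite -subr_eq0 -[_ == 0]negbK -normc_gt0 -leNgt; apply/ler_addgt0Pr => e e0.
pose M := K * normc (f w) + L * normc (f z) + 1.
have M0 : 0 < M by rewrite ltr_wpDl// addr_ge0// mulr_ge0 ?normc_ge0 ?ltW.
have e1 : 0 < e / M by rewrite divr_gt0.
have [n [l]] := Sf g e1; rewrite iE scalerA; set m := l * _ => hm; set d := g - m *: f in hm.
have -> : g z * f w - g w * f z = d z * f w - d w * f z.
  by rewrite /d !bergmanD !bergmanN !bergmanZ; ring.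
rewrite add0r; apply: le_trans (normcB _ _) _; rewrite !normcM.
apply: (@le_trans _ _ (M * nrm d)); last by rewrite mulrC -ler_pdivlMr// ltW.
have := hK d; have := hL d; have := nrm_ge0 d; have := normc_ge0 (f w); have := normc_ge0 (f z).
rewrite /M; move: (normc _) (normc _) (normc _) (normc _) (nrm d) => x y p q r; nra.
Qed.

(** Both test functions would be proportional to [f], so their quotient [1/(z + 1)] would take the
    same value at [w] and [w + 1], where [f] does not vanish at [w]. *)
Lemma similarity_not_dense : False.
Proof.
have [h1 [h2 hh]] := exists_test_functions al.
have [w w0 fw] : exists2 w, 0 < complex.Re w & f w != 0.
  apply: contrapT => h; move/eqP: f0; apply; apply: bergman_ext => z z0; rewrite bergman0.
  by apply/eqP/negPn/negP => fz; apply: h; exists z.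
have z0 : 0 < complex.Re (w + 1) by rewrite cReD addr_gt0.
have [h1z h2z] := hh _ z0; have [h1w h2w] := hh _ w0.
have e1 := similarity_rank_one h1 z0 w0; have := similarity_rank_one h2 z0 w0.
rewrite h2z h2w mulrAC e1 [RHS]mulrAC => /(mulfI _).
have fz : f (w + 1) != 0.
  apply: contra_neq (mulf_neq0 h1z fw) => fz; by rewrite e1 fz mulr0.
move=> /(_ (mulf_neq0 h1w fz)) /invr_inj /eqP.
by rewrite -subr_eq0 [w + 1 + 1]addrC addrK oner_eq0.
Qed.

End similarity.

Lemma nrm_sqrt_of (k : R) u v : 0 <= k -> n2 u = k * n2 v -> nrm u = Num.sqrt k * nrm v.
Proof.
move=> k0 h; apply/eqP; rewrite -(@eqrXn2 _ 2)// ?mulr_ge0 ?sqrtr_ge0 ?nrm_ge0//.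
by rewrite sqr_nrm exprMn sqr_nrm h sqr_sqrtr.
Qed.

Lemma not_dense_automorphism a b f : 0 < a -> complex.Re b = 0 -> f != 0 ->
  ~ projective_orbit_dense (C a b) f.
Proof.
move=> a0 b0 f0; have b00 : 0 <= complex.Re b by rewrite b0.
apply: (@similarity_not_dense (C a b) (Num.sqrt (kap a))) => //.
- by move=> u v; exact: copB.
- by move=> c u; exact: copZ.
- by move=> u; apply: nrm_sqrt_of; [exact/ltW/kap_gt0|exact: cop_auto].
Qed.

Lemma not_dense_parabolic b f : 0 < complex.Re b -> f != 0 -> ~ projective_orbit_dense (C 1 b) f.
Proof.
move=> b0 f0 Sf; have b00 := ltW b0; set S := C 1 b in Sf.
have SE u : n2 (S u) = n2 (T (complex.Re b) u) by rewrite (cop_sqn al)// kap1 mul1r.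
have Sle u : nrm (S u) <= nrm u.
  apply: nrm_le; first exact: nrm_ge0.
  by rewrite sqr_nrm SE transl_le.
have lc u : n2 (S u) ^+ 2 <= n2 u * n2 (S (S u)).
  have -> : n2 (S (S u)) = n2 (T (complex.Re b + complex.Re b) u).
    have bb : 0 <= complex.Re (b + b) by rewrite cReD addr_ge0.
    rewrite /S (cop_comp al u ltr01 b00 ltr01 b00) rmorph1 !mul1r.
    by rewrite (cop_sqn al u ltr01 bb) kap1 mul1r cReD.
  by rewrite SE; exact: transl_logconvex.
have f1 : 0 < n2 f by exact: sqn_gt0.
have Sf0 : 0 < n2 (S f).
  rewrite lt_neqAle sqn_ge0 andbT eq_sym; apply/eqP => h; move/eqP: f0; apply.
  by apply: (transl_inj0 al b0); rewrite -SE; exact: h.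
pose rho := n2 (S f) / n2 f; have rho0 : 0 < rho by rewrite divr_gt0.
(* Log-convexity makes the ratios of consecutive squared norms nondecreasing along the orbit, and
   [rho] is the first of them. *)
have H n : rho * n2 (iter n S f) <= n2 (iter n.+1 S f).
  elim: n => [|n IH]; first by rewrite /rho /= divfK// gt_eqF.
  have := lc (iter n S f); rewrite -!iterS; move: IH.
  move: (sqn_ge0 (iter n S f)) (sqn_ge0 (iter n.+1 S f)) (sqn_ge0 (iter n.+2 S f)).
  move: (n2 _) (n2 _) (n2 _) => x y z x0 y0 z0 h1 h2.
  have [->|yn] := eqVneq y 0; first by rewrite mulr0.
  have y1 : 0 < y by rewrite lt_neqAle eq_sym yn.
  have z1 : 0 < z by rewrite lt_neqAle x0 andbT; apply/eqP => x00; move: h2; rewrite -x00; nra.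
  rewrite -(ler_pM2l z1); apply: le_trans h2; rewrite mulrCA mulrA expr2.
  by apply: ler_wpM2r.
have bnd g : Num.sqrt rho * nrm g <= nrm (S g).
  pose L := Num.sqrt rho + 1.
  have L0 : 0 < L by rewrite ltr_wpDl ?sqrtr_ge0.
  move: g; apply: (dense_le Sf L0) => [g h|g h|n l].
  - apply: (@le_trans _ _ (Num.sqrt rho * (nrm h + nrm (g - h)))).
      by rewrite ler_wpM2l ?sqrtr_ge0// nrm_dist.
    rewrite mulrDr lerD2l; apply: ler_wpM2r; first exact: nrm_ge0.
    by rewrite /L lerDl.
  - apply: le_trans (nrm_dist _ (S g)) _; rewrite lerD2l -(copB al) //.
    apply: le_trans (Sle _) _; rewrite nrmB -[leLHS]mul1r; apply: ler_wpM2r; first exact: nrm_ge0.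
    by rewrite /L lerDr sqrtr_ge0.
  - rewrite [S (l *: _)](copZ al ltr01 b00) -/S !nrmZ mulrCA ler_wpM2l ?normc_ge0//.
    rewrite -(@ler_pXn2r _ 2)// ?nnegrE ?mulr_ge0 ?sqrtr_ge0 ?nrm_ge0//.
    by rewrite exprMn sqr_sqrtr ?(ltW rho0)// !sqr_nrm; exact: H.
have bnd2 g : rho * n2 g <= n2 (S g).
  rewrite -!sqr_nrm -[X in X * _](sqr_sqrtr (ltW rho0)) -exprMn; apply: lerXn2r; rewrite ?nnegrE.
  - exact: mulr_ge0 (sqrtr_ge0 _) (nrm_ge0 _).
  - exact: nrm_ge0.
  - exact: bnd.
(* Applied to the dilate [C t 0 f], the lower bound concerns translation by [t * Re b] of [f]
   itself, since the factor [kap t] occurs on both sides. Large [t] contradicts [transl_decay]. *)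
have K t : 0 < t -> rho * n2 f <= n2 (T (t * complex.Re b) f).
  move=> t0; have z0 : 0 <= complex.Re (0 : R[i]) by [].
  have := bnd2 (C t 0 f); rewrite (cop_auto al t0 z0); last by [].
  have tb : complex.Re (t%:C * b + 0) = t * complex.Re b by rewrite addr0 cReM /= mul0r subr0.
  have tb0 : 0 <= t * complex.Re b by rewrite mulr_ge0// ltW.
  have tb1 : 0 <= complex.Re (t%:C * b + 0) by rewrite tb.
  rewrite /S (cop_comp al f ltr01 b00 t0 z0) mulr1 (cop_sqn al f t0 tb1) tb mulrCA.
  by rewrite ler_pM2l// kap_gt0.
have e0 : 0 < rho * n2 f / 2 by rewrite divr_gt0// mulr_gt0.
have [X X0 hX] := transl_decay al f e0.
have t0 : 0 < (X + 1) / complex.Re b by rewrite divr_gt0// ltr_wpDl.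
have tE : (X + 1) / complex.Re b * complex.Re b = X + 1 by rewrite divfK ?gt_eqF.
have := K _ t0; rewrite tE.
have := hX (X + 1); rewrite lerDl => /(_ ler01).
by move: (n2 (T _ _)) (rho * n2 f) e0 => x y e0; lra.
Qed.

Lemma not_dense_contraction a b f : 0 < a < 1 -> 0 < complex.Re b ->
  ~ projective_orbit_dense (C a b) f.
Proof.
move=> /andP[a0 a1] b0 Sf; have b00 := ltW b0; set S := C a b in Sf.
have a1' : 0 < 1 - a by rewrite subr_gt0.
(* The fixed point of the symbol. It lies in the half-plane because [a < 1] and [Re b > 0], and the
   symbol sends [p + r] to [p + a r]. *)
pose p := ((1 - a)^-1)%:C * b.
have pE : a%:C * p + b = p.
  rewrite /p mulrA -rmorphM -[X in _ + X]mul1r -mulrDl -(rmorph1 (real_complex R)) -rmorphD /=.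
  by congr (_%:C * _); field; rewrite gt_eqF.
have p0 : 0 < complex.Re p by rewrite cReM /= mul0r subr0 mulr_gt0// invr_gt0.
have pr r : 0 <= r -> 0 < complex.Re (p + r%:C) by move=> r0; rewrite cReD /= ltr_wpDr.
have iE n r : 0 <= r -> iter n S f (p + r%:C) = f (p + (a ^+ n * r)%:C).
  elim: n r => [|n IH] r r0; first by rewrite mul1r.
  rewrite iterS /S (cop_val al a0 b00) ?pr//.
  have -> : a%:C * (p + r%:C) + b = p + (a * r)%:C by rewrite mulrDr addrAC pE rmorphM.
  by rewrite IH ?mulr_ge0 ?(ltW a0)// exprSr mulrA.
have [h1 [h2 hh]] := exists_test_functions al.
have w0 := pr 1 ler01; set w := p + 1%:C in w0.
have [K K0 hK] := eval_nrm alpha p0; have [L L0 hL] := eval_nrm alpha w0.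
have [h1p h2p] := hh _ p0; have [h1w h2w] := hh _ w0.
have ip n : iter n S f p = f p by have := iE n 0 (lexx 0); rewrite mulr0 addr0.
(* The orbit keeps the value [f p] at [p]; were it 0, all functions of the space would vanish at
   [p], among them [h1]. *)
have fp : f p != 0.
  apply/eqP => fp0; move: h1p; rewrite -normc_gt0 ltNge => /negP; apply.
  apply/ler_addgt0Pr => e e0; have e1 : 0 < e / K by rewrite divr_gt0.
  have [n [l hl]] := Sf h1 _ e1; have := hK (h1 - l *: iter n S f).
  rewrite bergmanD bergmanN bergmanZ ip fp0 mulr0 subr0 add0r => /le_trans; apply.
  by rewrite mulrC -ler_pdivlMr// ltW.
have [M M0 hM] : exists2 M, 0 < M & forall n, normc (iter n S f w) <= M.
  have q0 : 0 < complex.Re p + 1 by rewrite addr_gt0.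
  have [B B0 hB] := eval_bound_strip alpha p0 q0.
  exists (Num.sqrt (B * n2 f) + 1) => [|n]; first by rewrite ltr_wpDl// sqrtr_ge0.
  rewrite /w iE// mulr1; apply: (@le_trans _ _ (Num.sqrt (B * n2 f))); last by rewrite lerDl.
  have -> : p + (a ^+ n)%:C = (complex.Re p + a ^+ n) +i* complex.Im p.
    by case: (p) => x y; apply/eqP; rewrite eq_complex /= addr0 !eqxx.
  have hx : complex.Re p <= complex.Re p + a ^+ n <= complex.Re p + 1.
    by rewrite lerDl exprn_ge0 ?(ltW a0)//= lerD2l exprn_ile1// ltW.
  have := hB f _ (complex.Im p) (bergman_hol0 f) hx; rewrite sqnE -EFinM lee_fin => h.
  by rewrite -[leLHS]ger0_norm ?normc_ge0// -sqrtr_sqr; exact: ler_wsqrtr.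
have key g : g p = 0 -> g w = 0.
  move=> gp; apply/eqP; rewrite -[_ == 0]negbK -normc_gt0 -leNgt; apply/ler_addgt0Pr => e e0.
  have fp1 : 0 < normc (f p) by rewrite normc_gt0.
  pose Q := L + K * M / normc (f p).
  have Q0 : 0 < Q by rewrite addr_gt0// divr_gt0// mulr_gt0.
  have e1 : 0 < e / Q by rewrite divr_gt0.
  have [n [l hl]] := Sf g _ e1; set d := g - _ in hl.
  (* As [g p = 0], evaluating the error [d] at [p] isolates [l * f p]: a good approximation of [g]
     forces [l] to be small. *)
  have dp : normc l <= K * nrm d / normc (f p).
    rewrite ler_pdivlMr// -normcM; have := hK d.
    by rewrite /d bergmanD bergmanN bergmanZ ip gp sub0r normcNr.
  have -> : g w = d w + l * iter n S f w by rewrite /d bergmanD bergmanN bergmanZ subrK.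
  rewrite add0r; apply: le_trans (normcD _ _) _; rewrite normcM.
  apply: (@le_trans _ _ (Q * nrm d)); last by rewrite mulrC -ler_pdivlMr// ltW.
  rewrite /Q mulrDl; apply: lerD; first exact: hL.
  apply: (@le_trans _ _ (K * nrm d / normc (f p) * M)).
    by apply: ler_pM => //; exact: normc_ge0.
  by rewrite le_eqVlt; apply/orP; left; apply/eqP; ring.
(* This combination vanishes at [p], while its value at [w] is [h1 p * h1 w] times the nonzero
   difference of [1/(w + 1)] and [1/(p + 1)]. *)
have := key (h1 p *: h2 - h2 p *: h1); rewrite !(bergmanD, bergmanN, bergmanZ).
rewrite [h2 p * _]mulrC subrr => /(_ erefl) /eqP; rewrite h2w h2p.
rewrite -mulrA -mulrBr mulf_eq0 (negbTE h1p) /= [_^-1 * _]mulrC -mulrBr mulf_eq0 (negbTE h1w) /=.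
rewrite subr_eq0 => /eqP /invr_inj /eqP.
by rewrite /w addrAC -subr_eq0 [p + 1 + _]addrC addrK oner_eq0.
Qed.

End necessity.

(** * Sufficiency *)

Lemma sqr_le_mono (R : realDomainType) (x y : R) : 0 <= y -> x ^+ 2 <= y ^+ 2 -> x <= y.
Proof. by move=> y0 h; rewrite leNgt; apply/negP => yx; nra. Qed.

Section sufficiency.
Context (R : realType) (alpha : R).
Hypothesis al : -1 < alpha.
Local Notation V := (bergman alpha).
Local Notation n2 := (@sqn R alpha).
Local Notation nrm := (@nrm R alpha).
Local Notation C a b := (@composition_op R alpha (affine_symbol a b)).
Local Notation kap := (@dilation_factor R alpha).
Local Notation T := (@transl R alpha).
Implicit Types (f g h u v x y : V) (s t e : R) (c l z : R[i]).
Variables (a : R) (b : R[i]).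
Hypotheses (a1 : 1 < a) (b0 : 0 < complex.Re b).
Let S := C a b.
(** The fixed point of the symbol is [- p], outside the closed half-plane, so the n-th iterate of
    the symbol is [a^n (w + p) - p]. *)
Let p : R[i] := ((a - 1)^-1)%:C * b.

Let a0 : 0 < a. Proof. exact: lt_trans a1. Qed.

Let p0 : 0 < complex.Re p.
Proof. by rewrite /p cReM /= mul0r subr0 mulr_gt0// invr_gt0 subr_gt0. Qed.

Let ReZ t c : complex.Re (t%:C * c) = t * complex.Re c.
Proof. by rewrite cReM /= mul0r subr0. Qed.

Let an1 n : 0 <= a ^+ n - 1.
Proof. by rewrite subr_ge0 exprn_ege1// ltW. Qed.

Let orbit_Re n : 0 <= complex.Re ((a ^+ n - 1)%:C * p).
Proof. by rewrite ReZ mulr_ge0 ?an1 ?(ltW p0). Qed.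

Let iter_S n f : iter n S f = C (a ^+ n) ((a ^+ n - 1)%:C * p) f.
Proof.
have an n' : 0 < a ^+ n' by rewrite exprn_gt0.
elim: n => [|n IH].
  apply: bergman_ext => z z0; rewrite (cop_val al (an 0%N) (orbit_Re 0%N))//.
  by rewrite expr0 subrr mul0r addr0 mul1r.
rewrite iterS IH /S (cop_comp al f a0 (ltW b0) (an n) (orbit_Re n)) -exprSr.
congr (C _ _ f); rewrite /p !mulrA -!rmorphM -mulrDl -rmorphD /=; congr (_%:C * _).
by rewrite exprSr; field; rewrite subr_eq0 gt_eqF.
Qed.

(** The inverse of the n-th iterate of the symbol, [a^-n (w + p) - p], does not preserve the
    half-plane. Dropping the last [- p] repairs this, at the price of the translation by [p] in the
    composite. *)
Let right_inverse n h : V := C (a ^- n) ((a ^- n)%:C * p) h.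

Let iter_right_inverse n h : iter n S (right_inverse n h) = C 1 p h.
Proof.
have an : 0 < a ^+ n by rewrite exprn_gt0.
have an' : 0 < a ^- n by rewrite invr_gt0.
have pn : 0 <= complex.Re ((a ^- n)%:C * p) by rewrite ReZ mulr_ge0// ltW.
rewrite iter_S /right_inverse (cop_comp al h an (orbit_Re n) an' pn) mulVf ?gt_eqF//.
congr (C _ _ h); rewrite mulrA -rmorphM -mulrDl -rmorphD /= -[RHS]mul1r; congr (_ * _).
by rewrite -(rmorph1 (real_complex R)); congr (_%:C); field; rewrite gt_eqF.
Qed.

(** The imaginary part of [p] is undone by an invertible translation, which leaves the range of a
    real one. *)
Let range_dense y e : 0 < e -> exists h, nrm (y - C 1 p h) < e.
Proof.
move=> e0; have [g hg] := transl_dense_range al y p0 e0.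
have q0 : 0 <= complex.Re (0 +i* - complex.Im p) by [].
exists (C 1 (0 +i* - complex.Im p) g).
rewrite (cop_comp al g ltr01 (ltW p0) ltr01 q0) rmorph1 !mul1r.
suff -> : p + (0 +i* - complex.Im p) = (complex.Re p)%:C by [].
by case: (p) => u v; apply/eqP; rewrite eq_complex /= addr0 subrr !eqxx.
Qed.

Let iter_S_le n f : nrm (iter n S f) <= nrm f.
Proof.
have an : 0 < a ^+ n by rewrite exprn_gt0.
apply: nrm_le; first exact: nrm_ge0.
rewrite sqr_nrm iter_S; apply: le_trans (cop_le al an (orbit_Re n) f) _.
rewrite -[leRHS]mul1r; apply: ler_wpM2r; first exact: sqn_ge0.
by apply: (kap_le1 al); rewrite exprn_ege1// ltW.
Qed.

(** The factors [kap (a ^- n)] and [kap (a ^+ n)] cancel, leaving [nrm h] times the norm of the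
    translate of [x] by [(a ^+ n - 1) * Re p], a time that tends to infinity by Bernoulli's
    inequality. The summand 1 allows a later division by this factor. *)
Let orbit_product x h e : 0 < e -> exists n, (1 + nrm (right_inverse n h)) * nrm (iter n S x) < e.
Proof.
move=> e0; pose k := 1 + nrm h; have k0 : 0 < k by rewrite ltr_wpDr ?nrm_ge0.
have d0 : 0 < (e / 2 / k) ^+ 2 by rewrite exprn_gt0// !divr_gt0.
have [X X0 hX] := transl_decay al x d0.
have bern n : n%:R * (a - 1) <= a ^+ n - 1.
  elim: n => [|n IH]; first by rewrite mul0r subrr.
  rewrite -natr1 mulrDl mul1r exprS; have := an1 n; move: a1 IH; move: (a ^+ n) (n%:R * _) => u v; nra.
have a10 : 0 < a - 1 by rewrite subr_gt0.
have [n tn] : exists n, X <= (a ^+ n - 1) * complex.Re p.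
  exists (Num.truncn (X / complex.Re p / (a - 1))).+1.
  rewrite -ler_pdivrMr//; apply: le_trans (bern _); rewrite -ler_pdivrMr//.
  exact: ltW (truncnS_gt _).
exists n.
set t := (a ^+ n - 1) * complex.Re p in tn.
have an : 0 < a ^+ n by rewrite exprn_gt0.
have an' : 0 < a ^- n by rewrite invr_gt0.
have pn : 0 <= complex.Re ((a ^- n)%:C * p) by rewrite ReZ mulr_ge0// ltW.
have Tx : nrm (T t x) <= e / 2 / k.
  by apply: nrm_le; [rewrite ltW// !divr_gt0|exact: hX].
have E1 : n2 (iter n S x) = kap (a ^+ n) * n2 (T t x).
  by rewrite iter_S (cop_sqn al x an (orbit_Re n)) ReZ.
have b1 : nrm (iter n S x) <= nrm (T t x).
  apply: nrm_le; first exact: nrm_ge0.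
  rewrite E1 sqr_nrm -[leRHS]mul1r; apply: ler_wpM2r; first exact: sqn_ge0.
  by apply: (kap_le1 al); rewrite exprn_ege1// ltW.
have b2 : nrm (right_inverse n h) * nrm (iter n S x) <= nrm h * nrm (T t x).
  apply: sqr_le_mono; first exact: mulr_ge0 (nrm_ge0 _) (nrm_ge0 _).
  have R1 : n2 (right_inverse n h) <= kap (a ^- n) * n2 h by exact: cop_le.
  move: R1 E1; move: (right_inverse n h) (iter n S x) (T t x) => A B D R1 E1.
  rewrite !exprMn !sqr_nrm E1.
  apply: (@le_trans _ _ (kap (a ^- n) * n2 h * (kap (a ^+ n) * n2 D))).
    by apply: ler_wpM2r R1; rewrite -E1; exact: sqn_ge0.
  rewrite mulrACA -(kapM _ an' an) mulVf ?gt_eqF// kap1 mul1r; exact: lexx.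
rewrite mulrDl mul1r; apply: le_lt_trans (lerD b1 b2) _.
rewrite -[X in X + _]mul1r -mulrDl; apply: (@le_lt_trans _ _ (k * (e / 2 / k))).
  by apply: ler_wpM2l => //; exact: ltW.
by rewrite mulrC divfK ?gt_eqF// ltr_pdivrMr// ltr_pMr// ltr1n.
Qed.

(** Adding [m] times [right_inverse n h] to [x] makes [m^-1] times the n-th iterate equal to
    [C 1 p h] plus a remainder [m^-1 S^n x]. Thanks to [orbit_product] some [m] is small enough for
    the displacement and large enough for the remainder. Three errors of [e / 4] stay below [e]. *)
Let approach x y t e : 0 < t -> 0 < e -> exists x' r, [/\ 0 < r, r <= t / 2, nrm (x' - x) + r <= t &
  exists n l, forall u, nrm (u - x') <= r -> nrm (y - l *: iter n S u) < e].
Proof.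
move=> t0 e0; have e4 : 0 < e / 4 by rewrite divr_gt0.
have [h hh] := range_dense y e4.
have e5 : 0 < t * (e / 4) / 2 by rewrite divr_gt0// mulr_gt0.
have [n hn] := orbit_product x h e5.
pose k := 1 + nrm (right_inverse n h).
have k0 : 0 < k by rewrite ltr_wpDr ?nrm_ge0.
(* [m * k = t / 2] bounds the displacement of the centre. The second bound on [r] absorbs the factor
   [m^-1], since iterates of [S] do not increase norms. *)
pose m : R := t / 2 / k; have m0 : 0 < m by rewrite !divr_gt0.
pose r := Num.min (t / 2) (m * (e / 4)).
have r0 : 0 < r by rewrite lt_min; apply/andP; split; [exact: divr_gt0|exact: mulr_gt0].
exists (x + m%:C *: right_inverse n h), r; split=> //.
- by rewrite ge_min lexx.
- rewrite addrAC subrr add0r nrmZ normc_real gtr0_norm// [t]splitr; apply: lerD; last by rewrite ge_min lexx.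
  apply: (@le_trans _ _ (m * k)); first by apply: ler_wpM2l; [exact: ltW|rewrite /k lerDr].
  by rewrite /m divfK ?gt_eqF.
exists n, (m^-1)%:C => u hu; set x' := x + _ in hu.
have SB v w : S (v - w) = S v - S w by exact: (copB al a0 (ltW b0)).
have SZ c v : S (c *: v) = c *: S v by exact: (copZ al a0 (ltW b0)).
have mm : (m^-1)%:C * m%:C = 1 by rewrite -rmorphM /= mulVf ?gt_eqF.
have -> : y - (m^-1)%:C *: iter n S u =
    (y - C 1 p h) - (m^-1)%:C *: iter n S x - (m^-1)%:C *: iter n S (u - x').
  have -> : iter n S (u - x') = iter n S u - (iter n S x + m%:C *: C 1 p h).
    rewrite (iterB _ _ _ SB); congr (_ - _).
    rewrite -[LHS](subrK (iter n S x)) -(iterB _ _ _ SB) {1}/x' addrAC subrr add0r.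
    by rewrite (iterZ _ _ _ SZ) iter_right_inverse addrC.
  rewrite scalerBr scalerDr scalerA mm scale1r opprB.
  by rewrite -[y - _ - _]addrA -opprD [C 1 p h + _]addrC addrA subrK.
have mV x1 : nrm ((m^-1)%:C *: x1) = nrm x1 / m.
  by rewrite nrmZ normc_real gtr0_norm ?invr_gt0// mulrC.
have h1 : nrm (iter n S x) / m < e / 4.
  rewrite ltr_pdivrMr// /m mulrC [t / 2 / k]mulrC -mulrA ltr_pdivlMl//.
  by move: hn; rewrite mulrAC.
have h2 : nrm (iter n S (u - x')) / m <= e / 4.
  rewrite ler_pdivrMr// mulrC; apply: le_trans (iter_S_le _ _) _; apply: le_trans hu _.
  by rewrite ge_min lexx orbT.
apply: le_lt_trans (nrmD _ _) _; rewrite nrmN mV.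
have := nrmD (y - C 1 p h) (- ((m^-1)%:C *: iter n S x)); rewrite nrmN mV.
move: (nrm (_ - _ - _)) (nrm (y - _)) (nrm _ / m) (nrm _ / m) h1 h2 hh => q1 q2 q3 q4; lra.
Qed.

(** Baire's argument along one sequence: a stage fixes an iterate and a scalar that serve a whole
    closed ball, so the common point of the balls inherits every approximation. *)
Lemma hyperbolic_supercyclic : supercyclic S.
Proof.
have [zs hzs] := bergman_separable al.
have [h1 [h2 hh]] := exists_test_functions al.
have h10 : h1 != 0.
  have z0 : 0 < complex.Re (1 : R[i]) by exact: ltr01.
  by have [hz _] := hh _ z0; apply: contra_neq hz => ->; rewrite bergman0.
(* Stage [n] decodes to the index of a vector of the dense sequence and the index of a tolerance. A
   number that codes no pair is assigned [(0, 0)], which is harmless. *)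
pose target n : nat * nat := odflt (0%N, 0%N) (unpickle n).
pose tol (n : nat) : R := ((target n).2).+1%:R^-1.
have P (q : nat * (V * R)) : exists q' : V * R, 0 < q.2.2 ->
    [/\ 0 < q'.2, q'.2 <= q.2.2 / 2, nrm (q'.1 - q.2.1) + q'.2 <= q.2.2 &
     exists n l, forall u, nrm (u - q'.1) <= q'.2 -> nrm (zs (target q.1).1 - l *: iter n S u) < tol q.1].
  have [t0|t0] := ltP 0 q.2.2; last by exists (0, 0).
  have e0 : 0 < tol q.1 by rewrite invr_gt0.
  have [x' [r H]] := approach q.2.1 (zs (target q.1).1) t0 e0.
  by exists (x', r).
have [step hstep] := choice P.
(* The initial ball, around [h1] with half its norm as radius, keeps the limit away from 0. *)
pose st := fix st n := if n is m.+1 then step (m, st m) else (h1, nrm h1 / 2).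
have r0 n : 0 < (st n).2.
  elim: n => [|n IH]; first by rewrite /= divr_gt0// nrm_gt0.
  by have [] := hstep (n, st n) IH.
have rhalf n : (st n).2 <= nrm h1 / 2 / 2 ^+ n.
  elim: n => [|n IH]; first by rewrite expr0 divr1.
  have [_ h _ _] := hstep (n, st n) (r0 n); apply: le_trans h _.
  by rewrite exprSr invfM mulrA ler_wpM2r// invr_ge0.
have rn0 n : 0 <= (st n).2 by exact: ltW.
have rcvg : (st n).2 @[n --> \oo] --> (0 : R).
  apply: (@squeeze_cvgr _ _ _ _ (fun=> 0) (fun n => nrm h1 / 2 / 2 ^+ n)).
  - by apply: nearW => n; rewrite rn0 rhalf.
  - exact: cvg_cst.
  - exact: half_pow_cvg.
have near_ n m : (n <= m)%N -> nrm ((st m).1 - (st n).1) + (st m).2 <= (st n).2.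
  move=> /subnK <-; elim: (m - n)%N => [|k IH]; first by rewrite add0n subrr nrm0 add0r.
  have [_ _ h _] := hstep ((k + n)%N, st (k + n)%N) (r0 _).
  rewrite addSn; apply: le_trans IH.
  have := nrm_tri (st (k + n).+1).1 (st (k + n)%N).1 (st n).1.
  move: h; rewrite /=; move: (nrm _) (nrm _) (nrm _) => q1 q2 q3; lra.
have cau n m : (n <= m)%N -> nrm ((st m).1 - (st n).1) <= (st n).2.
  by move=> nm; apply: le_trans (near_ n m nm); rewrite lerDl; exact: rn0.
have [u hu] := bergman_complete rn0 rcvg cau.
apply/supercyclicP; exists u.
  apply: contraTneq (hu 0%N) => ->; rewrite sub0r nrmN /= -ltNge.
  by rewrite ltr_pdivrMr// ltr_pMr ?nrm_gt0// ltr1n.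
move=> g e e0; have e2 : 0 < e / 2 by rewrite divr_gt0.
have [i hi] := hzs g _ e2.
have [k _ hk] := near_infty_natSinv_lt (PosNum e2).
pose n := pickle (i, k).
have tn : target n = (i, k) by rewrite /target /n pickleK.
have [_ _ _ [N [l hN]]] := hstep (n, st n) (r0 n).
exists N, l; apply: nrm_tri_lt hi _.
(* Target [n] is served by the ball of stage [n.+1], and the limit lies in every ball. *)
have := hN u (hu n.+1); rewrite /= /tol tn /=; move/lt_trans; apply.
exact: (hk k (leqnn k)).
Qed.

End sufficiency.

Theorem theorem3 (R : realType) (alpha a : R) (b : R[i])
    (halpha : -1 < alpha) (ha : 0 < a) (hb : 0 <= complex.Re b) :
  supercyclic (@composition_op R alpha (affine_symbol a b)) <->
  1 < a /\ 0 < complex.Re b.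
Proof.
split=> [/supercyclicP [f f0 hf]|[a1 b0]]; last exact: hyperbolic_supercyclic.
(* The case [Re b = 0] is excluded for all [a] at once, because the cases [a = 1] and [a < 1] rely
   on [Re b > 0]. *)
have b0 : 0 < complex.Re b.
  rewrite lt_neqAle hb andbT; apply/eqP => /esym b0.
  exact: (not_dense_automorphism halpha ha b0 f0 hf).
split=> //; rewrite ltNge le_eqVlt; apply/negP => /predU1P[a1|a1].
  by move: hf; rewrite a1; exact: (not_dense_parabolic halpha b0 f0).
by apply: (not_dense_contraction halpha _ b0 hf); rewrite ha.
Qed.
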